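(* Let $L,s>0$ and assume that $Q(\alpha|x)$ is in $\mathcal C(L,s)$ with $\lfloor s\rfloor\le p$. Suppose that assumptions (X), (F) and (K) stated in the context hold. Then for every $\mathbf v\in\mathbb N^d$ with $|\mathbf v|\le\lfloor s\rfloor$ and every $\alpha\in[\underline\alpha,\overline\alpha]$: (i) for any finite $m>0$, $$\left(\int_{\mathcal X_0}\left|\widehat b_{\mathbf v}(\alpha;h,x)-b_{\mathbf v}(\alpha|x)\right|^m dx\right)^{1/m}=O_{\mathbb P}\left(\left(\frac1n\right)^{\frac{s-|\mathbf v|}{2s+d}}\right)$$ provided $h$ is asymptotically proportional to $n^{-1/(2s+d)}$; (ii) $$\sup_{x\in\mathcal X_0}\left|\widehat b_{\mathbf v}(\alpha;h,x)-b_{\mathbf v}(\alpha|x)\right|=O_{\mathbb P}\left(\left(\frac{\log n}n\right)^{\frac{s-|\mathbf v|}{2s+d}}\right)$$ if $h$ is asymptotically proportional to $\left(\frac{\log n}n\right)^{1/(2s+d)}$.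
   Context: Data. $(X,Y)$ is a random pair with $X\in\mathbb R^d$ and $Y\in\mathbb R$; $(X_1,Y_1),\dots,(X_n,Y_n)$ are i.i.d. copies of $(X,Y)$. $F(y|x)$ is the conditional c.d.f. of $Y$ given $X=x$ and $Q(\alpha|x)=\inf\{y:F(y|x)\ge\alpha\}$. $[\underline\alpha,\overline\alpha]\subset(0,1)$ is a fixed interval. $\|\cdot\|$ is the Euclidean norm. Assumption (X). $X$ has a Lebesgue density $f(\cdot)$ that is strictly positive and continuously differentiable over the compact support $\mathcal X$ of $X$. $\mathcal X_0$ is a compact subset of the interior of $\mathcal X$. Assumption (F). $F(\cdot|\cdot)$ has a continuous conditional density $f(y|x)$, strictly positive for $y\in\mathbb R$, $x\in\mathcal X$. The partial derivative $\partial F(y|x)/\partial x$ is continuous over $\mathbb R\times\mathcal X$. There is $L_0>0$ with $|f(y|x)-f(y'|x')|\le L_0\|(x,y)-(x',y')\|$ for all $(x,y),(x',y')\in\mathcal X\times\mathbb R$. Assumption (K). The nonnegative kernel $K:\mathbb R^d\to\mathbb R$ is Lipschitz, has compact support $\mathcal K$, satisfies $\int K(z)dz=1$ and, for some $\underline K>0$, $K(z)\ge\underline K\,\mathbb I(\|z\|\le1)$. The (deterministic) bandwidth $h=h_n$ lies in $[\underline h_n,\overline h_n]$ with $0<\underline h_n\le\overline h_n<\infty$, $\lim_n\overline h_n=0$, $\lim_n(\log n)/(n\underline h_n^d)=0$. ''$h$ is asymptotically proportional to $a_n$'' means that $h/a_n$ converges to a constant in $(0,\infty)$. Notation. For $\mathbf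 v\in\mathbb N^d$: $|\mathbf v|=v_1+\cdots+v_d$, $\mathbf v!=\prod_i v_i!$, $z^{\mathbf v}=\prod_i z_i^{v_i}$. $p$ is the (fixed) order of the local polynomial, $P$ is the number of $\mathbf v\in\mathbb N^d$ with $|\mathbf v|\le p$ (ordered lexicographically), $\mathbf U(z)=(z^{\mathbf v}/\mathbf v!,\ |\mathbf v|\le p)^T\in\mathbb R^P$. The loss is $\ell_\alpha(q)=|q|+(2\alpha-1)q=2q(\alpha-\mathbb I(q\le0))$. Estimator: $\widehat{\mathbf b}(\alpha;h,x)=(\widehat b_{\mathbf v}(\alpha;h,x),|\mathbf v|\le p)^T$ is a minimizer over $\mathbf b\in\mathbb R^P$ of $\frac1{nh^d}\sum_{i=1}^n\ell_\alpha(Y_i-\mathbf U(X_i-x)^T\mathbf b)K(\frac{X_i-x}h)$. Partial derivatives: $b_{\mathbf v}(\alpha|x)=\partial^{|\mathbf v|}Q(\alpha|x)/\partial x_1^{v_1}\cdots\partial x_d^{v_d}$. H\''older class. $\lfloor s\rfloor$ denotes the lowest integer part of $s$: the unique integer with $\lfloor s\rfloor<s\le\lfloor s\rfloor+1$ (strict inequality on the left). $Q\in\mathcal C(L,s)$ means: for all $\alpha\in[\underline\alpha,\overline\alpha]$, $x\mapsto Q(\alpha|x)$ is $\lfloor s\rfloor$ times continuously differentiable over $\mathcal X$; and for all $\mathbf v$ with $|\mathbf v|=\lfloor s\rfloor$, all $\alpha\in[\underline\alpha,\overline\alpha]$ and all $x,x'\in\mathcal X$, $|b_{\mathbf v}(\alpha|x)-b_{\mathbf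 v}(\alpha|x')|\le L\|x-x'\|^{s-\lfloor s\rfloor}$. *)

(* Defs.v *)
From HB Require Import structures.
From mathcomp Require Import all_boot all_order all_algebra.
From mathcomp Require Import all_classical all_reals all_analysis.

Set Implicit Arguments.
Unset Strict Implicit.
Unset Printing Implicit Defensive.

Import Order.TTheory GRing.Theory Num.Theory.
Import numFieldNormedType.Exports.

Local Open Scope classical_set_scope.
Local Open Scope ring_scope.

(* Row vectors carry the product sigma-algebra, generated by the coordinate
   maps exactly as the library does for n.-tuple; over R it is the Borel
   sigma-algebra. *)
Section measurable_rV.
Context {R : realType} (n : nat).

Let coors : 'I_n -> 'rV[R]_n -> R := fun i x => x 0 i.

Let rV_set0 : g_sigma_preimage coors set0.
Proof. exact: sigma_algebra0. Qed.

Let rV_setC A : g_sigma_preimage coors A -> g_sigma_preimage coors (~` A).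
Proof. exact: sigma_algebraC. Qed.

Let rV_bigcup (F : _^nat) : (forall i, g_sigma_preimage coors (F i)) ->
  g_sigma_preimage coors (\bigcup_i (F i)).
Proof. exact: sigma_algebra_bigcup. Qed.

HB.instance Definition _ := @isMeasurable.Build default_measure_display
  'rV[R]_n (g_sigma_preimage coors) rV_set0 rV_setC rV_bigcup.

Lemma measurable_coord (i : 'I_n) :
  measurable_fun [set: 'rV[R]_n] (fun x : 'rV[R]_n => x 0 i).
Proof.
move=> _ Y mY; rewrite setTI; apply: sub_sigma_algebra => /=.
rewrite -bigcup_seq/=; exists i => /=; first by rewrite mem_index_enum.
by exists Y => //; rewrite setTI.
Qed.

Lemma measurable_fun_rV d1 (T1 : measurableType d1) (f : T1 -> 'rV[R]_n) :
  (forall i, measurable_fun [set: T1] (fun t => f t 0 i)) ->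
  measurable_fun [set: T1] f.
Proof.
move=> mf; have sub : preimage_set_system [set: T1] f
    (g_sigma_preimage coors) `<=` measurable.
  rewrite -[X in X `<=` _]g_sigma_preimageE.
  apply: smallest_sub; first exact: sigma_algebra_measurable.
  move=> _ [B + <-]; rewrite -bigcup_seq => -[i _ [C mC <-]].
  by rewrite !setTI; have := mf i measurableT C mC; rewrite setTI.
by move=> _ A mA; apply: sub; exists A.
Qed.

End measurable_rV.

Section lebesgue_rV.
Context {R : realType}.

Definition cons_rV (n : nat) (u : measurableTypeR R * 'rV[R]_n) : 'rV[R]_n.+1 :=
  row_mx u.1%:M u.2.

Lemma measurable_cons_rV n : measurable_fun setT (@cons_rV n).
Proof.
apply: measurable_fun_rV => i; rewrite /cons_rV.
have [j ij|j ij] := @split_ordP 1 n i.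
- apply: eq_measurable_fun measurable_fst => u _ /=.
  by rewrite ij (@row_mxEl _ 1 1 n) !ord1 mxE eqxx mulr1n.
- apply: eq_measurable_fun
    (measurableT_comp (@measurable_coord R n j) measurable_snd) => u _ /=.
  by rewrite ij (@row_mxEr _ 1 1 n).
Qed.

Lemma cons_rV_head n u : @cons_rV n u ord0 ord0 = u.1.
Proof.
rewrite /cons_rV (_ : ord0 = lshift n (ord0 : 'I_1)); last exact/val_inj.
by rewrite (@row_mxEl _ 1 1 n) mxE.
Qed.

Lemma cons_rV_tail n u : @rsubmx _ 1 1 n (@cons_rV n u) = u.2.
Proof. by rewrite /cons_rV row_mxKr. Qed.

Section step.
Local Open Scope ereal_scope.
Context (n : nat) (m : {sigma_finite_measure set 'rV[R]_n -> \bar R}).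

Definition leb_step : set 'rV[R]_n.+1 -> \bar R :=
  pushforward (@lebesgue_measure R \x m) (@cons_rV n).

Let leb_step_measure : {measure set 'rV[R]_n.+1 -> \bar R} :=
  measure_function_pushforward__canonical__measure_function_Measure
    (@lebesgue_measure R \x m) (@measurable_cons_rV n).

HB.instance Definition _ := isMeasure.Build _ _ _ leb_step
  (measure0 leb_step_measure) (measure_ge0 leb_step_measure)
  (@measure_semi_sigma_additive _ _ _ leb_step_measure).

Let leb_step_sigma_finite : sigma_finite setT leb_step.
Proof.
have /sigma_finiteP[F [TF ndF Foo]] := sigma_finiteT (@lebesgue_measure R).
have /sigma_finiteP[G [TG ndG Goo]] := sigma_finiteT m.
pose tl (x : 'rV[R]_n.+1) : 'rV[R]_n := @rsubmx _ 1 1 n x.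
pose hd (x : 'rV[R]_n.+1) : measurableTypeR R := (x ord0 ord0 : R).
have mtl : measurable_fun setT tl.
  apply: measurable_fun_rV => i.
  by apply: eq_measurable_fun (@measurable_coord R n.+1 (rshift 1 i)) => x _;
    rewrite /tl mxE.
have mhd : measurable_fun setT hd by exact: measurable_coord.
exists (fun k => hd @^-1` F k `&` tl @^-1` G k).
  apply/seteqP; split=> // x _.
  have [i _ Fi] : (\bigcup_k F k) (hd x) by rewrite -TF.
  have [j _ Gj] : (\bigcup_k G k) (tl x) by rewrite -TG.
  exists (maxn i j) => //; split.
    by have /subsetPset/(_ _ Fi) := ndF _ _ (leq_maxl i j).
  by have /subsetPset/(_ _ Gj) := ndG _ _ (leq_maxr i j).
move=> k; have [mF Fk] := Foo k; have [mG Gk] := Goo k; split.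
  apply: measurableI; first by rewrite -[X in measurable X]setTI; exact: mhd.
  by rewrite -[X in measurable X]setTI; exact: mtl.
rewrite /leb_step /pushforward.
rewrite (_ : _ @^-1` _ = F k `*` G k); last first.
  by apply/seteqP; split => u /=; rewrite /hd /tl cons_rV_head cons_rV_tail.
by rewrite product_measure1E// lte_mul_pinfty// ge0_fin_numE.
Qed.

HB.instance Definition _ :=
  @Measure_isSigmaFinite.Build _ _ _ leb_step leb_step_sigma_finite.

End step.

(* Lebesgue measure on R^n: a point mass for n = 0, then the product of the
   one-dimensional Lebesgue measure with the n-dimensional one, transported
   along R * R^n ~ R^n.+1. *)
Fixpoint leb (n : nat) : {sigma_finite_measure set 'rV[R]_n -> \bar R} :=
  match n return {sigma_finite_measure set 'rV[R]_n -> \bar R} with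
  | 0%N => \d_(0 : 'rV[R]_0)
  | n'.+1 => leb_step (leb n')
  end.

End lebesgue_rV.

Section euclidean.
Context {R : realType} {d : nat}.
Implicit Types x z : 'rV[R]_d.

(* The library norm `|x| on 'rV is the sup norm; it induces the same topology. *)
Definition enorm x : R := Num.sqrt (\sum_(i < d) x 0 i ^+ 2).

Definition enorm_pair x (y : R) : R := Num.sqrt (enorm x ^+ 2 + y ^+ 2).

End euclidean.

(* Multi-indices v in N^d. *)
Section multi_index.
Context {d : nat}.
Implicit Types v : {ffun 'I_d -> nat}.

Definition mi_size v : nat := \sum_(i < d) v i.
Definition mi_fact v : nat := \prod_(i < d) (v i)`!.
Definition mi_pow {R : realType} (z : 'rV[R]_d) v : R :=
  \prod_(i < d) z 0 i ^+ v i.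
Definition mi0 : {ffun 'I_d -> nat} := [ffun=> 0%N].
Definition mi_succ v (i : 'I_d) : {ffun 'I_d -> nat} :=
  [ffun j => (v j + (j == i))%N].

End multi_index.

(* The finite type of the multi-indices of size at most p; it indexes the P
   coordinates of R^P = {ffun mindex d p -> R}. *)
Definition mindex (d p : nat) :=
  {v : {ffun 'I_d -> 'I_p.+1} | (\sum_(i < d) v i <= p)%N}.

Definition mi_of {d p : nat} (v : mindex d p) : {ffun 'I_d -> nat} :=
  [ffun i => (val v i : nat)].

Section smoothness.
Context {R : realType} {d : nat}.
Implicit Types (A : set 'rV[R]_d) (g : 'rV[R]_d -> R).

Definition basis_vec (i : 'I_d) : 'rV[R]_d := delta_mx 0 i.

Definition partial (i : 'I_d) g : 'rV[R]_d -> R :=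
  fun x => 'D_(basis_vec i) g x.

(* d^|v| g / dx_1^(v_1) ... dx_d^(v_d) *)
Definition mpartial (v : {ffun 'I_d -> nat}) g : 'rV[R]_d -> R :=
  foldr (fun i => iter (v i) (partial i)) g (enum 'I_d).

(* g is k times continuously differentiable over A, with derivatives G: the
   partial derivatives up to order k exist in the interior of A and extend to
   continuous functions G v on A.  This is the reading of "C^k over A" for a
   closed set A, on whose boundary the two-sided limits defining partial
   derivatives are not available. *)
Definition derivatives_on A (k : nat) g
    (G : {ffun 'I_d -> nat} -> 'rV[R]_d -> R) : Prop :=
  [/\ forall x, A x -> G mi0 x = g x,
      forall v, (mi_size v <= k)%N -> {within A, continuous (G v)} &
      forall v i x, (mi_size v < k)%N -> interior A x ->
        is_derive x (basis_vec i) (G v) (G (mi_succ v i) x)].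

Definition cont_diff_on A (k : nat) g : Prop :=
  exists G, derivatives_on A k g G.

(* The integer k such that k < s <= k + 1, for s > 0. *)
Definition lowint (s : R) : nat := `|Num.ceil s|%N.-1.

Lemma lowint_itv (s : R) : 0 < s ->
  (lowint s)%:R < s <= (lowint s).+1%:R.
Proof.
move=> s0; have c0 : (0 < Num.ceil s)%R by rewrite ceil_gt0.
have cE : (Num.ceil s)%:~R = (lowint s).+1%:R :> R.
  rewrite /lowint prednK ?absz_gt0 ?gt_eqF//.
  by rewrite natr_absz gtr0_norm.
have /andP[c1 c2] := ceil_itv s.
rewrite -cE c2 andbT; move: c1.
by rewrite intrD cE -addn1 natrD addrK.
Qed.

(* Q in C(L, s), for the quantile orders alpha in [al, au]. *)
Definition holder_class A (al au L s : R) (Q : R -> 'rV[R]_d -> R) : Prop :=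
  forall alpha, al <= alpha <= au ->
  exists2 G, derivatives_on A (lowint s) (Q alpha) G &
  forall v x x', mi_size v = lowint s -> A x -> A x' ->
    `|G v x - G v x'| <= L * enorm (x - x') `^ (s - (lowint s)%:R).

End smoothness.

Section probability_notions.
Context {R : realType} {dT : measure_display} {T : measurableType dT}
  (P : probability T R).

(* Z_0, Z_1, ... are mutually independent with the law of Z. *)
Definition iid_copies {dU : measure_display} {U : measurableType dU}
    (Z : T -> U) (Zs : nat -> T -> U) : Prop :=
  (forall i B, measurable B -> P (Zs i @^-1` B) = P (Z @^-1` B)) /\
  (forall (J : seq nat) (B : nat -> set U), uniq J ->
    (forall i, measurable (B i)) ->
    fine (P (\big[setI/setT]_(i <- J) (Zs i @^-1` B i))) =
    \prod_(i <- J) fine (P (Zs i @^-1` B i))).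

(* Z_n = O_P(a_n).  The variables are extended-real valued and need not be
   measurable (suprema, arbitrary choices of minimizers), so the exceptional
   event is only required to be covered by a measurable event of small
   probability; for measurable Z_n this is the usual notion. *)
Definition big_O_P (Z : nat -> T -> \bar R) (a : nat -> R) : Prop :=
  forall eps : R, 0 < eps -> exists2 C : R, 0 < C &
  \forall n \near \oo, exists E : set T,
    [/\ measurable E, [set w | ~ (`|Z n w| <= (C * a n)%:E)%E] `<=` E &
        (P E <= eps%:E)%E].

End probability_notions.

Section conditional_quantile.
Context {R : realType} {d : nat}.

Definition msupport (mu : set 'rV[R]_d -> \bar R) : set 'rV[R]_d :=
  [set x | forall U, open U -> U x -> (0 < mu U)%E].

Definition is_cond_law {dT : measure_display} {T : measurableType dT}
    (P : probability T R) (X : T -> 'rV[R]_d) (Y : T -> R)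
    (kappa : R.-pker 'rV[R]_d ~> R) : Prop :=
  forall (A : set 'rV[R]_d) (B : set R), measurable A -> measurable B ->
    P (X @^-1` A `&` Y @^-1` B) =
    (\int[pushforward P X]_(x in A) kappa x B)%E.

(* The conditional c.d.f. F(y|x); kappa x is a version of the conditional law of
   Y given X = x. *)
Definition ccdf (kappa : R.-pker 'rV[R]_d ~> R) (y : R) (x : 'rV[R]_d) : R :=
  fine (kappa x `]-oo, y]%classic).

Definition cquantile (kappa : R.-pker 'rV[R]_d ~> R) (alpha : R)
    (x : 'rV[R]_d) : R :=
  inf [set y | alpha <= ccdf kappa y x].

End conditional_quantile.

Section local_polynomial.
Context {R : realType} {d p : nat}.

Definition check_loss (alpha q : R) : R := `|q| + (2 * alpha - 1) * q.

(* The vector of the z^v / v!, |v| <= p. *)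
Definition lp_basis (z : 'rV[R]_d) : {ffun mindex d p -> R} :=
  [ffun v => mi_pow z (mi_of v) / (mi_fact (mi_of v))%:R].

Definition lp_criterion (K : 'rV[R]_d -> R) (n : nat) (xs : nat -> 'rV[R]_d)
    (ys : nat -> R) (alpha h : R) (x : 'rV[R]_d)
    (b : {ffun mindex d p -> R}) : R :=
  (n%:R * h ^+ d)^-1 *
  \sum_(i < n) check_loss alpha
      (ys i - \sum_(v : mindex d p) lp_basis (xs i - x) v * b v) *
    K (h^-1 *: (xs i - x)).

Definition is_lp_estimator {T : Type} (K : 'rV[R]_d -> R)
    (Xs : nat -> T -> 'rV[R]_d) (Ys : nat -> T -> R) (al au : R)
    (bhat : nat -> T -> R -> R -> 'rV[R]_d -> {ffun mindex d p -> R}) : Prop :=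
  forall n w alpha h x, al <= alpha <= au -> 0 < h ->
  forall b, lp_criterion K n (Xs ^~ w) (Ys ^~ w) alpha h x
              (bhat n w alpha h x)
         <= lp_criterion K n (Xs ^~ w) (Ys ^~ w) alpha h x b.

End local_polynomial.

Section assumptions.
Context {R : realType} {d : nat}.

(* muX is the law of X. *)
Definition assumption_X (muX : set 'rV[R]_d -> \bar R) (X0 : set 'rV[R]_d) :
    Prop :=
  [/\ compact (msupport muX),
      exists f : 'rV[R]_d -> R,
        [/\ measurable_fun setT f, forall x, 0 <= f x,
            forall A, measurable A ->
              muX A = (\int[leb d]_(x in A) (f x)%:E)%E,
            forall x, msupport muX x -> 0 < f x &
            cont_diff_on (msupport muX) 1 f],
      compact X0 & X0 `<=` interior (msupport muX)].

Definition assumption_F (kappa : R.-pker 'rV[R]_d ~> R) (A : set 'rV[R]_d) :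
    Prop :=
  exists f : R -> 'rV[R]_d -> R,
  [/\ forall y x, A x -> (ccdf kappa y x)%:E =
        (\int[lebesgue_measure]_(t in `]-oo, y]) (f t x)%:E)%E,
      {within [set: R] `*` A, continuous (fun u => f u.1 u.2)},
      forall y x, A x -> 0 < f y x,
      (* as in derivatives_on, jointly in (y, x) *)
      forall i : 'I_d, exists2 DF : R -> 'rV[R]_d -> R,
        {within [set: R] `*` A, continuous (fun u => DF u.1 u.2)} &
        forall y x, interior A x ->
          is_derive x (basis_vec i) (ccdf kappa y) (DF y x) &
      exists2 L0 : R, 0 < L0 & forall x x' y y', A x -> A x' ->
        `|f y x - f y' x'| <= L0 * enorm_pair (x - x') (y - y')].

Definition assumption_K (K : 'rV[R]_d -> R) : Prop :=
  [/\ forall z, 0 <= K z,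
      exists LK : R, forall z z', `|K z - K z'| <= LK * enorm (z - z'),
      compact (closure [set z | K z != 0]),
      (\int[leb d]_z (K z)%:E = 1)%E &
      exists2 K0 : R, 0 < K0 & forall z, K0 * (enorm z <= 1)%R%:R <= K z].

Definition bandwidth (h : nat -> R) : Prop :=
  exists hlo hup : nat -> R,
  [/\ forall n, (0 < n)%N -> 0 < hlo n /\ hlo n <= h n <= hup n,
      hup n @[n --> \oo] --> (0 : R) &
      ln n%:R / (n%:R * hlo n ^+ d) @[n --> \oo] --> (0 : R)].

Definition asymp_prop (h a : nat -> R) : Prop :=
  exists2 c : R, 0 < c & h n / a n @[n --> \oo] --> c.

End assumptions.

(* Main.v *)
Require Import Defs.
From HB Require Import structures.
From mathcomp Require Import all_boot all_order all_algebra.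
From mathcomp Require Import all_classical all_reals all_analysis.
From mathcomp Require Import measurable_realfun.
From mathcomp Require Import ring lra zify.

(** Write b for the coefficients of the Taylor polynomial of Q(alpha|.) at x.  By the
    Hoelder condition this polynomial is within C h^s of Q(alpha|.) on the window of the
    kernel ([taylor_remainder]).  Measure the error of the estimator by
    theta_v = h^|v| (bhat_v - b_v).

    The criterion is convex and minimal at bhat.  If some |theta_v| exceeded t, the segment
    from b to bhat would contain a point where the largest |theta_v| equals t and where the
    criterion is not above its value at b.  Knight's identity splits the difference of the
    criterion between these two points into a linear term and a nonnegative curvature
    term.  The linear term is at most t times the scores
    S_v(x) = sum_i K((X_i-x)/h) ((X_i-x)/h)^v/v! (alpha - 1(Y_i <= Q(alpha|X_i))).
    For the curvature, a polynomial with a coefficient of size t stays above c t, or below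
    - c t, on a whole box taken from a finite family ([lp_value_lower]); the observations
    in that box whose response is within c t/4 of the quantile, on the side of that sign,
    contribute c t/2 each, and there are about n h^d t of them.  So the curvature is of
    order n h^d t^2 and wins as soon as t is a large multiple of |S(x)|/(n h^d) + h^s
    ([lp_error_bound]).  Only counts of observations in cells enter; they are controlled
    for all x at once by Chernoff bounds on a net of polynomial size ([lower_event],
    [upper_event]), because both choices of h make n h^d h^s dominate log n.

    It remains to bound the scores.  Since P(Y <= Q(alpha|X) | X) = alpha
    ([cdf_quantile]) they are centered, and S_v(x)/sqrt(n h^d) has bounded exponential
    moments ([score_mgf_iid]).  For the uniform rate, Chernoff bounds on a net give
    sup |S_v| = O(sqrt(n h^d log n)) ([score_event]).  For the integrated rate the
    logarithm is avoided: by Tonelli and Markov the integral over X0 of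
    exp(|S_v(x)|/sqrt(n h^d)) is bounded in probability, and it controls every moment of
    the scores ([score_moments], [powR_sum_le]).  In both cases the bandwidth balances the
    score term with h^s, and dividing theta_v by h^|v| gives h^(s-|v|).

    The minimizers are arbitrary, so the error need not be measurable in x or w: the
    integral of the error is only ever compared with larger measurable functions
    ([nonneg_integral_le]), and exceptional events are enlarged to measurable ones. *)

Set Implicit Arguments.
Unset Strict Implicit.
Unset Printing Implicit Defensive.

Import Order.TTheory GRing.Theory Num.Theory.
Import numFieldNormedType.Exports.

Local Open Scope classical_set_scope.
Local Open Scope ring_scope.

Lemma le_of_eq disp (T : porderType disp) (x y : T) : x = y -> (x <= y)%O.
Proof. by move=> ->. Qed.

(** * Boxes *)

Section boxes.
Context {R : realType} {d : nat}.
Implicit Types (x z : 'rV[R]_d) (A : set 'rV[R]_d).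

(** Sup-norm balls rather than Euclidean ones: their volumes and nets are products. *)
Definition box x (r : R) : set 'rV[R]_d :=
  [set z | forall i, `|z 0 i - x 0 i| <= r].

Lemma subset_box x x' r r' :
  (forall i, `|x 0 i - x' 0 i| + r <= r') -> box x r `<=` box x' r'.
Proof.
move=> xr z zx i; apply: le_trans (xr i).
rewrite (_ : z 0 i - x' 0 i = (x 0 i - x' 0 i) + (z 0 i - x 0 i)); last lra.
by rewrite (le_trans (ler_normD _ _))// lerD2l.
Qed.

Lemma measurable_box x r : measurable (box x r).
Proof.
rewrite (_ : box x r =
  \bigcap_(i in [set: 'I_d]) (fun z : 'rV[R]_d => z 0 i) @^-1` [set y | `|y - x 0 i| <= r]).
  apply: fin_bigcap_measurable => // i _.
  rewrite -[X in measurable X]setTI; apply: (@measurable_coord R d i) => //.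
  have -> : [set y | `|y - x 0 i| <= r] = `[x 0 i - r, x 0 i + r]%classic :> set R.
    by apply/seteqP; split => y /=; rewrite in_itv/= ler_distl.
  exact: measurable_itv.
by apply/seteqP; split => [z zx i _|z zx i]; [exact: zx|exact: (zx i)].
Qed.

Lemma nbhs_box x A : nbhs x A -> exists2 r : R, 0 < r & box x r `<=` A.
Proof.
move=> [P nP PA].
suff [r r0 rP] : exists2 r : R, 0 < r & forall i y, `|y - x 0 i| <= r -> P 0 i y.
  exists r => // z zx; apply: PA => i j; rewrite (ord1 i); apply: rP; exact: zx.
have H (i : 'I_d) : \forall r \near 0^'+, forall y : R, `|y - x 0 i| <= r -> P 0 i y.
  have /nbhs_ballP[e /= e0 eP] := nP 0 i.
  near=> r => y yr; apply: eP; rewrite /ball/= distrC.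
  by apply: le_lt_trans yr _; near: r; exact: nbhs_right_lt.
have H' : \forall r \near (0 : R)^'+, forall (i : 'I_d) (y : R), `|y - x 0 i| <= r -> P 0 i y.
  exact: filter_forall.
near (0 : R)^'+ => r; exists r => //; near: r; exact: H'.
Unshelve. all: by end_near.
Qed.

Lemma box_nbhs x r : 0 < r -> nbhs x (box x r).
Proof.
move=> r0; exists (fun _ i => [set y | `|y - x 0 i| <= r]).
  move=> i j; rewrite (ord1 i); apply/nbhs_ballP; exists r => //= y.
  by rewrite /ball/= distrC => /ltW.
by move=> z; apply.
Qed.

(** Rational boxes form a countable base. *)
Lemma open_measurable_rV A : open A -> measurable A.
Proof.
move=> oA.
pose q_box (u : {ffun 'I_d -> rat} * nat) :=
  box (\row_i (ratr (u.1 i) : R)) (u.2.+1%:R^-1).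
rewrite (_ : A = \bigcup_(u in [set: {ffun 'I_d -> rat} * nat])
   (if `[< q_box u `<=` A >] then q_box u else set0)).
  apply: countable_bigcupT_measurable; first exact: countableP.
  move=> u; case: asboolP => _ //; exact: measurable_box.
apply/seteqP; split => [x Ax|x [u _]]; last first.
  by case: asboolP => // uA; exact: uA.
have /nbhs_box[r r0 rA] : nbhs x A by exact: open_nbhs_nbhs.
have [k kr] : exists k : nat, k.+1%:R^-1 < r / 2.
  have r20 : 0 < r / 2 by rewrite divr_gt0.
  have [k _ k0] := near_infty_natSinv_lt (PosNum r20).
  by exists k; exact: (k0 k (leqnn k)).
have H i : {q : rat | x 0 i - k.+1%:R^-1 < ratr q < x 0 i + k.+1%:R^-1}.
  apply: cid.
  have [|q] := @rat_in_itvoo R (x 0 i - k.+1%:R^-1) (x 0 i + k.+1%:R^-1).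
    have k0 : 0 < k.+1%:R^-1 :> R by rewrite invr_gt0.
    by rewrite ltrBlDr -addrA ltrDl addr_gt0.
  by rewrite in_itv/= => ?; exists q.
exists ([ffun i => projT1 (H i)], k) => //.
have Hx i : `|ratr (projT1 (H i)) - x 0 i| < k.+1%:R^-1.
  by case: (H i) => q/= /andP[q1 q2]; rewrite ltr_distl q1 q2.
case: asboolP => [_|nA]; last (exfalso; apply: nA).
  by move=> i; rewrite mxE ffunE/= distrC; exact: ltW (Hx i).
apply: (subset_trans _ rA); apply: subset_box => i.
rewrite mxE ffunE/= [leRHS]splitr lerD// ltW//.
by apply: lt_trans (Hx i) kr.
Qed.

Lemma closed_measurable_rV A : closed A -> measurable A.
Proof.
move=> cA; rewrite -(setCK A); apply: measurableC.
by apply: open_measurable_rV; exact: closed_openC.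
Qed.

Lemma continuous_measurable_rV (f : 'rV[R]_d -> R) :
  continuous f -> measurable_fun setT f.
Proof.
move=> /continuousP cf; apply: (measurability _ (RGenOInfty.measurableE R)) => _ [_ [x ->] <-].
by rewrite setTI; apply: open_measurable_rV; exact: cf.
Qed.

Lemma within_continuous_measurable_rV A (f : 'rV[R]_d -> R) :
  closed A -> {within A, continuous f} -> measurable_fun A f.
Proof.
move=> cA /continuousP cf.
apply: (measurability _ (RGenOInfty.measurableE R)) => _ [_ [x ->] <-].
have := cf _ (@rray_open _ R x); rewrite open_subspaceP => -[U oU UA].
rewrite setIC -UA; apply: measurableI; first exact: open_measurable_rV.
exact: closed_measurable_rV.
Qed.

End boxes.

Lemma leb_box (R : realType) d (x : 'rV[R]_d) (r : R) : 0 <= r ->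
  leb d (box x r) = ((2 * r) ^+ d)%:E.
Proof.
move=> r0; elim: d x => [|d IHd] x.
  rewrite /= /dirac indicE (_ : _ \in _) //.
  by apply/mem_set => -[].
rewrite /= /leb_step/pushforward.
rewrite (_ : _ @^-1` _ = `[x ord0 ord0 - r, x ord0 ord0 + r]%classic `*` box (@rsubmx _ 1 1 d x) r).
  rewrite product_measure1E//; [|exact: measurable_box].
  rewrite IHd.
  have -> : lebesgue_measure_lebesgue_measure__canonical__measure_function_Measure R
     `[(x ord0 ord0 - r)%R, (x ord0 ord0 + r)%R]%classic = (2 * r)%:E.
    rewrite [LHS]lebesgue_measure_itv/= lte_fin.
    case: ltP => h; first by rewrite -EFinB; congr (_ %:E); lra.
    by congr (_ %:E); lra.
  by rewrite -EFinM exprS.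
have tailE (a : R) (u : 'rV[R]_d) j :
    u 0 j = @cons_rV R d (a, u) 0 (rshift 1 j).
  by have /matrixP/(_ 0 j) := @cons_rV_tail R d (a, u); rewrite mxE => ->.
apply/seteqP; split => -[a u] /=.
  move=> H; split.
    by have := H ord0; rewrite cons_rV_head /= in_itv/= ler_distl.
  by move=> i; have := H (rshift 1 i); rewrite -tailE mxE.
rewrite in_itv/= -ler_distl => -[H1 H2] i.
have [j ij|j ij] := @split_ordP 1 d i.
  have -> : i = ord0 by apply/val_inj; rewrite ij/= ord1.
  by rewrite cons_rV_head.
by have := H2 j; rewrite ij -tailE mxE.
Qed.

(** * Integration of nonnegative functions *)

(** The integral of a nonnegative function is a supremum over the simple functions below it,
    so it is monotone even among functions that are not measurable. *)
Lemma nonneg_integral_le {R : realType} d (T : measurableType d) (mu : {measure set T -> \bar R})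
    (D : set T) (f g : T -> \bar R) :
  (forall x, D x -> 0 <= f x)%E -> (forall x, D x -> f x <= g x)%E ->
  (\int[mu]_(x in D) f x <= \int[mu]_(x in D) g x)%E.
Proof.
move=> f0 fg; have g0 x : D x -> (0 <= g x)%E.
  by move=> Dx; exact: le_trans (f0 x Dx) (fg x Dx).
rewrite !ge0_integralE//; apply: le_ereal_sup => _ [h hf <-].
exists h => // x; apply: le_trans (hf x) _; rewrite !patchE.
by case: ifPn => // /set_mem /fg.
Qed.

Section weight.
Local Open Scope ereal_scope.
Context {R : realType} d1 d2 (T : measurableType d1) (U : measurableType d2).
Variables (P : {measure set T -> \bar R}) (Z : T -> U).
Hypothesis mZ : measurable_fun setT Z.

Import HBNNSimple.

Lemma measurable_preimage B : measurable B -> measurable (Z @^-1` B).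
Proof. by move=> mB; rewrite -[X in measurable X]setTI; exact: mZ. Qed.

(** A weight W whose conditional mean given Z is the constant c on D can be replaced by c
    under the integral of any function of Z: the hypothesis is the case of indicators, and
    nonnegative functions are increasing limits of simple ones. *)
Lemma integral_weight (W : T -> R) (c : R) (D : set U) :
  measurable_fun setT W -> (forall w, 0 <= W w)%R -> (0 <= c)%R -> measurable D ->
  (forall B, measurable B -> B `<=` D ->
    \int[P]_(w in Z @^-1` B) (W w)%:E = c%:E * P (Z @^-1` B)) ->
  forall g : U -> R, measurable_fun setT g -> (forall u, 0 <= g u)%R ->
  \int[P]_(w in Z @^-1` D) (g (Z w) * W w)%:E =
  c%:E * \int[P]_(w in Z @^-1` D) (g (Z w))%:E.
Proof.
move=> mW W0 c0 mD HW g mg g0.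
have mZD := measurable_preimage mD.
have mEg : measurable_fun [set: U] (fun u => (g u)%:E) by exact/measurable_EFinP.
pose h := nnsfun_approx measurableT mEg.
have hcvg x : (EFin \o h n) x @[n --> \oo] --> (g x)%:E.
  by apply: (cvg_nnsfun_approx measurableT mEg) => // u _; rewrite /= lee_fin.
have mhZ n : measurable_fun [set: T] (fun w => h n (Z w)) by exact: measurableT_comp.
have -> : \int[P]_(w in Z @^-1` D) (g (Z w))%:E =
    lim (\int[P]_(w in Z @^-1` D) (h n (Z w))%:E @[n --> \oo]).
  rewrite -monotone_convergence//.
  - by apply: eq_integral => x _; apply/esym/cvg_lim => //; exact: hcvg.
  - by move=> n; apply/measurable_EFinP; exact: measurable_funTS.
  - by move=> n x _; rewrite lee_fin.
  - by move=> x _ a b ab; rewrite lee_fin; exact/lefP/nd_nnsfun_approx.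
have -> : \int[P]_(w in Z @^-1` D) (g (Z w) * W w)%:E =
    lim (\int[P]_(w in Z @^-1` D) (h n (Z w) * W w)%:E @[n --> \oo]).
  rewrite -monotone_convergence//.
  - apply: eq_integral => x _; apply/esym/cvg_lim => //.
    rewrite EFinM; under eq_fun do rewrite EFinM.
    by apply: cvgeZr => //; exact: hcvg.
  - by move=> n; apply/measurable_EFinP; apply: measurable_funM; exact: measurable_funTS.
  - by move=> n x _; rewrite lee_fin mulr_ge0.
  - move=> x _ a b ab; rewrite lee_fin ler_wpM2r//; exact/lefP/nd_nnsfun_approx.
have indic_comp n r w : (\1_(h n @^-1` [set r]) (Z w) = \1_(Z @^-1` (h n @^-1` [set r])) w :> R)%R.
  by rewrite !indicE.
have suf n : \int[P]_(w in Z @^-1` D) (h n (Z w) * W w)%:E =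
    c%:E * \int[P]_(w in Z @^-1` D) (h n (Z w))%:E.
  have mpre r : measurable (Z @^-1` (h n @^-1` [set r])).
    by apply: measurable_preimage; exact: measurable_sfunP.
  have mind r : measurable_fun [set: T] (fun w => (\1_(h n @^-1` [set r]) (Z w) : R)).
    by apply: measurableT_comp.
  under eq_integral do rewrite fimfunE mulrC mulr_fsumr//.
  under [in RHS]eq_integral do rewrite fimfunE.
  under eq_integral do rewrite -fsumEFin//.
  under [in RHS]eq_integral do rewrite -fsumEFin//.
  rewrite ge0_integral_fsum//; last 2 first.
  - by move=> r; apply/measurable_EFinP; apply: measurable_funTS;
      apply: measurable_funM => //; apply: measurable_funM.
  - by move=> r w _; rewrite EFinM mule_ge0 ?lee_fin// ?nnfun_muleindic_ge0//
      -lee_fin nnfun_muleindic_ge0.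
  rewrite ge0_integral_fsum//; last 2 first.
  - by move=> r; apply/measurable_EFinP; apply: measurable_funTS;
      apply: measurable_funM.
  - by move=> r w _; rewrite nnfun_muleindic_ge0.
  rewrite ge0_mule_fsumr; last first.
    by move=> r; apply: integral_ge0 => w _; rewrite nnfun_muleindic_ge0.
  apply: eq_fsbigr => r /[1!inE] -[u _ ur].
  have r0 : (0 <= r)%R by rewrite -ur.
  under eq_integral do rewrite mulrCA indic_comp EFinM.
  under [in RHS]eq_integral do rewrite indic_comp EFinM.
  rewrite ge0_integralZl//; last 2 first.
  - by apply/measurable_EFinP; apply: measurable_funTS; apply: measurable_funM.
  - by move=> w _; rewrite lee_fin mulr_ge0.
  rewrite ge0_integralZl//; last first.
  - by apply/measurable_EFinP; apply: measurable_funTS.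
  rewrite muleCA; congr (_ * _).
  rewrite integral_indic// setIC -preimage_setI -HW; last 2 first.
  - by apply: measurableI => //; exact: measurable_sfunP.
  - by move=> ? [].
  rewrite preimage_setI integral_mkcondr; apply: eq_integral => w _.
  rewrite patchE indicE; case: ifP => _; by rewrite ?mulr1 ?mulr0.
under eq_fun do rewrite suf.
rewrite limeMl//.
apply: ereal_nondecreasing_is_cvgn => a b ab; apply: nonneg_integral_le => x _.
  by rewrite lee_fin.
by rewrite lee_fin; exact/lefP/nd_nnsfun_approx.
Qed.

End weight.

(** * Independent copies: exponential moments and counts *)

Section exponential_bounds.
Context {R : realType}.
Implicit Types y : R.

Lemma expR_le_quadratic y : y <= 2^-1 -> expR y <= 1 + y + 2 * y ^+ 2.
Proof.
move=> y2; have h : 1 - y <= expR (- y) by have := expR_ge1Dx (- y).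
have y1 : 0 < 1 - y by lra.
have : expR y <= (1 - y)^-1.
  by rewrite -[expR y]invrK -expRN lef_pV2// posrE ?expR_gt0.
move/le_trans; apply.
rewrite -(ler_pM2r y1) mulVf ?gt_eqF//.
have -> : (1 + y + 2 * y ^+ 2) * (1 - y) = 1 + y ^+ 2 * (1 - 2 * y) by ring.
by rewrite lerDl mulr_ge0 ?sqr_ge0//; lra.
Qed.

Lemma expR1_le4 : expR 1 <= 4 :> R.
Proof.
have h : 1 - 2^-1 <= expR (- 2^-1) :> R by have := expR_ge1Dx (- 2^-1 : R).
rewrite [X in expR X](_ : 1 = 2%:R * 2^-1); last by rewrite mulfV.
rewrite expRM_natl.
have h2 : expR 2^-1 <= 2 :> R.
  rewrite -[leRHS]invrK -[leLHS]invrK -expRN lef_pV2 ?posrE ?expR_gt0//.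
  by apply: le_trans h; lra.
have -> : 4 = 2 ^+ 2 :> R by ring.
by rewrite lerXn2r ?nnegrE ?expR_ge0.
Qed.

Lemma expRN1_le2 : expR (- 1) <= 2^-1 :> R.
Proof.
rewrite expRN lef_pV2 ?posrE ?expR_gt0//.
by have := expR_ge1Dx (1 : R); apply: le_trans; lra.
Qed.

End exponential_bounds.

Lemma markov_ereal {R : realType} d (T : measurableType d) (P : {measure set T -> \bar R})
    (f : T -> \bar R) (a : R) :
  measurable_fun setT f -> (forall w, 0 <= f w)%E -> 0 < a ->
  (P [set w | a%:E <= f w] <= (a^-1)%:E * \int[P]_w f w)%E.
Proof.
move=> mf f0 a0.
have := @le_integral_comp_abse _ _ _ P setT measurableT f a id.
move=> /(_ (@measurable_id _ _ _))/(_ (fun r r0 => r0)).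
have nd : {in `[0%E, +oo[%classic &, {homo (id : \bar R -> \bar R) : x y / (x <= y)%E}} by [].
move=> /(_ nd mf a0); rewrite setTI.
rewrite (_ : [set x | _] = [set w | a%:E <= f w]%E); last first.
  by apply/seteqP; split => w /=; rewrite gee0_abs.
under eq_integral do rewrite gee0_abs//.
by move=> h; rewrite lee_pdivlMl.
Qed.

Section iid.
Local Open Scope ereal_scope.
Context {R : realType} d1 d2 (T : measurableType d1) (U : measurableType d2).
Variables (P : probability T R) (Z : T -> U) (Zs : nat -> T -> U).
Hypothesis mZ : measurable_fun setT Z.
Hypothesis mZs : forall i, measurable_fun setT (Zs i).
Hypothesis iidZ : iid_copies P Z Zs.

Lemma iid_integral (g : U -> R) i :
  measurable_fun setT g -> (forall u, 0 <= g u)%R ->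
  \int[P]_w (g (Zs i w))%:E = \int[P]_w (g (Z w))%:E.
Proof.
move=> mg g0.
have mEg : measurable_fun [set: U] (fun u => (g u)%:E) by exact/measurable_EFinP.
transitivity (\int[pushforward P (Zs i)]_u (g u)%:E).
  by rewrite ge0_integral_pushforward// => u _; rewrite lee_fin.
transitivity (\int[pushforward P Z]_u (g u)%:E); last first.
  by rewrite ge0_integral_pushforward// => u _; rewrite lee_fin.
by apply: eq_measure_integral => A mA _; exact: iidZ.1.
Qed.

(** To peel off the last factor, the rest of the product must act as a weight that is
    independent of it; the induction therefore integrates over events S J B that depend on
    further variables of the family. *)
Lemma iid_integral_prod (g : U -> R) (e : R) (n : nat) :
  measurable_fun setT g -> (forall u, 0 <= g u)%R ->
  \int[P]_w (g (Z w))%:E = e%:E ->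
  \int[P]_w (\prod_(i < n) g (Zs i w))%:E = (e ^+ n)%:E.
Proof.
move=> mg g0 eE.
have e0 : (0 <= e)%R by rewrite -lee_fin -eE; apply: integral_ge0 => w _; rewrite lee_fin.
pose S (J : seq nat) (B : nat -> set U) := (\big[setI/setT]_(i <- J) (Zs i @^-1` B i)).
have mS J B : (forall i, measurable (B i)) -> measurable (S J B).
  move=> mB; apply: bigsetI_measurable => i _.
  by apply: (measurable_preimage (mZs i)).
suff H : forall J, uniq J -> all (fun i => n <= i)%N J ->
    forall B, (forall i, measurable (B i)) ->
    \int[P]_(w in S J B) (\prod_(i < n) g (Zs i w))%:E = (e ^+ n)%:E * P (S J B).
  have := H [::] isT isT (fun=> setT) (fun=> measurableT).
  by rewrite /S big_nil probability_setT mule1.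
elim: n => [|n IHn] J uJ aJ B mB.
  under eq_integral do rewrite big_ord0.
  by rewrite integral_cst ?mul1e// ?expr0 ?mul1e//; exact: mS.
have mprod m : measurable_fun [set: T] (fun w => \prod_(i < m) g (Zs i w))%R.
  by apply: measurable_prod => i _; exact: measurableT_comp.
pose W w : R := (\prod_(i < n) g (Zs i w) * \1_(S J B) w)%R.
have mW : measurable_fun [set: T] W.
  by apply: measurable_funM => //; apply: measurable_indic; exact: mS.
have W0 w : (0 <= W w)%R by rewrite mulr_ge0// prodr_ge0.
have c0 : (0 <= e ^+ n * fine (P (S J B)))%R by rewrite mulr_ge0 ?exprn_ge0// fine_ge0.
have HW C : measurable C -> C `<=` setT ->
    \int[P]_(w in Zs n @^-1` C) (W w)%:E =
    (e ^+ n * fine (P (S J B)))%:E * P (Zs n @^-1` C).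
  move=> mC _.
  pose B' i := if i == n then C else B i.
  have mB' i : measurable (B' i) by rewrite /B'; case: ifP.
  have nJ : n \notin J by apply/negP => /(allP aJ); rewrite ltnn.
  have SE : S (n :: J) B' = Zs n @^-1` C `&` S J B.
    rewrite /S big_cons /B' eqxx; congr (_ `&` _).
    apply: eq_big_seq => i iJ; case: eqP => // ii; by move: nJ; rewrite -ii iJ.
  have aJ' : all (fun i => n <= i)%N (n :: J).
    rewrite /= leqnn/=; apply: sub_all aJ => i; exact: ltnW.
  have := IHn (n :: J) _ aJ' B' mB'.
  rewrite SE /= nJ uJ => /(_ isT).
  rewrite integral_mkcondr => IH.
  transitivity ((e ^+ n)%:E * P (Zs n @^-1` C `&` S J B)).
    rewrite -IH; apply: eq_integral => w _; rewrite patchE /W indicE.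
    by case: ifP => _; rewrite ?mulr1 ?mulr0.
  rewrite EFinM -muleA; congr (_ * _).
  have := iidZ.2 (n :: J) B' _ mB'; rewrite /= nJ uJ => /(_ isT).
  rewrite -/(S (n :: J) B') SE big_cons.
  have -> : (\prod_(i <- J) fine (P (Zs i @^-1` B' i)) =
            \prod_(i <- J) fine (P (Zs i @^-1` B i)))%R.
    apply: eq_big_seq => i iJ; rewrite /B'; case: eqP => // ii.
    by move: nJ; rewrite -ii iJ.
  rewrite -(iidZ.2 J B uJ mB) -/(S J B) {1}/B' eqxx mulrC => PE.
  have mZC : measurable (Zs n @^-1` C) by exact: (measurable_preimage (mZs n)).
  rewrite -[LHS]fineK; last by apply: fin_num_measure; apply: measurableI => //; exact: mS.
  by rewrite PE EFinM !fineK//; apply: fin_num_measure => //; exact: mS.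
have := integral_weight (mZs n) mW W0 c0 measurableT HW mg g0.
rewrite preimage_setT (iid_integral n mg g0) eE => E1.
transitivity (\int[P]_w (g (Zs n w) * W w)%:E).
  rewrite integral_mkcond; apply: eq_integral => w _; rewrite patchE /W indicE.
  by rewrite big_ord_recr/=; case: ifP => _; rewrite ?mulr1 ?mulr0// mulrC.
rewrite E1 -EFinM mulrAC EFinM -exprSr fineK//.
by apply: fin_num_measure; exact: mS.
Qed.

Lemma measurable_sum_iid (g : U -> R) n : measurable_fun setT g ->
  measurable_fun setT (fun w => \sum_(i < n) g (Zs i w))%R.
Proof. by move=> mg; apply: measurable_sum => i; exact: measurableT_comp. Qed.

Lemma expR_sum_iid (g : U -> R) (a : R) n : measurable_fun setT g ->
  \int[P]_w (expR (g (Z w)))%:E <= (expR a)%:E ->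
  \int[P]_w (expR (\sum_(i < n) g (Zs i w)))%:E <= (expR (n%:R * a))%:E.
Proof.
move=> mg ga.
have meg : measurable_fun setT (fun u => expR (g u)) by exact: measurableT_comp.
have i0 : 0 <= \int[P]_w (expR (g (Z w)))%:E.
  by apply: integral_ge0 => w _; rewrite lee_fin expR_ge0.
have ifin : \int[P]_w (expR (g (Z w)))%:E \is a fin_num.
  by rewrite ge0_fin_numE//; apply: le_lt_trans ga _; rewrite ltry.
under eq_integral do rewrite expR_sum.
have eg0 u : (0 <= expR (g u))%R by exact: expR_ge0.
rewrite (iid_integral_prod n meg eg0 (esym (fineK ifin))).
rewrite lee_fin expRM_natl lerXn2r ?nnegrE ?fine_ge0 ?expR_ge0//.
by rewrite -lee_fin fineK.
Qed.

Lemma chernoff (g : U -> R) (a u : R) n : measurable_fun setT g ->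
  \int[P]_w (expR (g (Z w)))%:E <= (expR a)%:E ->
  P [set w | u <= \sum_(i < n) g (Zs i w)]%R <= (expR (n%:R * a - u))%:E.
Proof.
move=> mg ga; have eu := expR_gt0 u.
rewrite (_ : [set w | _] =
    [set w | (expR u)%:E <= (expR (\sum_(i < n) g (Zs i w))%R)%:E]); last first.
  by apply/seteqP; split => w /=; rewrite lee_fin ler_expR.
apply: (le_trans (markov_ereal P _ _ eu)).
- apply/measurable_EFinP; apply: measurableT_comp => //; exact: measurable_sum_iid.
- by move=> w; rewrite lee_fin expR_ge0.
rewrite expRD expRN mulrC EFinM lee_wpmul2l ?lee_fin ?invr_ge0 ?expR_ge0//.
exact: expR_sum_iid.
Qed.

(** The exponential moment of a Bernoulli variable is below that of the Poisson variable
    with the same mean. *)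
Lemma integral_expR_indic (A : set U) (l : R) : measurable A ->
  \int[P]_w (expR (l * \1_A (Z w)))%:E <=
  (expR ((expR l - 1) * fine (P (Z @^-1` A))))%:E.
Proof.
move=> mA; have mZA := measurable_preimage mZ mA.
have mZAc : measurable (~` (Z @^-1` A)) by exact: measurableC.
have PA := fin_num_measure P _ mZA.
apply: (@le_trans _ _ (\int[P]_w ((\1_(~` (Z @^-1` A)) w)%:E + (expR l)%:E * (\1_(Z @^-1` A) w)%:E))).
  apply: le_of_eq; apply: eq_integral => w _.
  rewrite -EFinM -EFinD !indicE in_setC; congr (_ %:E).
  rewrite (_ : (Z w \in A) = (w \in Z @^-1` A)); last by apply/idP/idP => /set_mem ?; exact/mem_set.
  by case: (w \in _) => /=; rewrite ?mulr1 ?mulr0 ?addr0 ?add0r ?expR0.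
have mI B : measurable B -> measurable_fun setT (fun w : T => (\1_B w : R)%:E).
  by move=> mB; apply/measurable_EFinP; exact: measurable_indic.
rewrite ge0_integralD//; last 2 first.
- exact: mI.
- by apply: measurable_funeM; exact: mI.
rewrite ge0_integralZl//; last exact: mI.
rewrite !integral_indic// !setIT.
rewrite [X in X + _](_ : _ = 1 - P (Z @^-1` A)); last exact: probability_setC.
set q := fine (P (Z @^-1` A)).
have PE : P (Z @^-1` A) = q%:E by rewrite fineK.
rewrite [X in 1 - X](_ : _ = q%:E)// [X in _ * X](_ : _ = q%:E)//.
rewrite -EFinM -EFinB -EFinD lee_fin.
by apply: le_trans (expR_ge1Dx _); rewrite mulrBl mul1r; lra.
Qed.

Definition cnt (A : set U) n w : R := (\sum_(i < n) \1_A (Zs i w))%R.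

Lemma measurable_cnt A n : measurable A -> measurable_fun setT (cnt A n).
Proof. by move=> mA; apply: measurable_sum_iid; exact: measurable_indic. Qed.

(** Tilting by e for the upper tail and by 1/e for the lower one; the factors 4 absorb
    e <= 4 and 1/e <= 1/2. *)
Lemma cnt_upper (A : set U) (p : R) n : measurable A ->
  P (Z @^-1` A) <= p%:E ->
  P [set w | 4 * n%:R * p <= cnt A n w]%R <= (expR (- (n%:R * p)))%:E.
Proof.
move=> mA Pp; have PA := fin_num_measure P _ (measurable_preimage mZ mA).
have q0 : (0 <= fine (P (Z @^-1` A)))%R by exact: fine_ge0.
have qp : (fine (P (Z @^-1` A)) <= p)%R by rewrite -lee_fin fineK.
have mI : measurable_fun setT (\1_A : U -> R) by exact: measurable_indic.
have := @chernoff (\1_A) (3 * p) (4 * n%:R * p) n mI.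
rewrite (_ : n%:R * (3 * p) - 4 * n%:R * p = - (n%:R * p))%R; last ring.
apply; have := integral_expR_indic 1 mA.
under eq_integral do rewrite mul1r.
move/le_trans; apply; rewrite lee_fin ler_expR.
apply: ler_pM => //; last by have := @expR1_le4 R; lra.
Qed.

Lemma cnt_lower (A : set U) (p : R) n : measurable A ->
  p%:E <= P (Z @^-1` A) ->
  P [set w | cnt A n w <= n%:R * p / 4]%R <= (expR (- (n%:R * p / 4)))%:E.
Proof.
move=> mA Pp; have PA := fin_num_measure P _ (measurable_preimage mZ mA).
have q0 : (0 <= fine (P (Z @^-1` A)))%R by exact: fine_ge0.
have qp : (p <= fine (P (Z @^-1` A)))%R by rewrite -lee_fin fineK.
have mg : measurable_fun setT (fun u => -1 * \1_A u : R)%R.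
  by apply: measurable_funM => //; exact: measurable_indic.
have := @chernoff _ (- (p / 2)) (- (n%:R * p / 4)) n mg.
rewrite (_ : n%:R * _ - _ = - (n%:R * p / 4))%R; last by field.
rewrite (_ : [set w | _] = [set w | cnt A n w <= n%:R * p / 4]%R); last first.
  by apply/seteqP; split => w /=; rewrite -mulr_sumr mulN1r lerN2.
apply; apply: (le_trans (integral_expR_indic _ mA)); rewrite lee_fin ler_expR.
apply: (@le_trans _ _ (- 2^-1 * fine (P (Z @^-1` A)))%R); last lra.
by rewrite ler_wpM2r//; have := @expRN1_le2 R; lra.
Qed.

End iid.

(** * Powers against logarithms *)

Section asymptotics.
Context {R : realType}.
Implicit Types (h s eps : R) (n : nat).

Lemma powR_small s eps : 0 < s -> 0 < eps ->
  exists2 del : R, 0 < del & forall h, 0 < h -> h <= del -> h `^ s <= eps.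
Proof.
move=> s0 e0; exists (eps `^ s^-1); first exact: powR_gt0.
move=> h h0 hd; have -> : eps = (eps `^ s^-1) `^ s.
  by rewrite -powRrM mulVf ?gt_eqF// powRr1// ltW.
apply: ge0_ler_powR; rewrite ?nnegrE ?powR_ge0//; exact: ltW.
Qed.

Lemma inv_powR_le h s n : 0 < h -> 0 < s -> (0 < n)%N -> n%:R^-1 <= h ->
  (h `^ s)^-1 <= n%:R ^+ (Num.truncn s).+1.
Proof.
move=> h0 s0 n0 nh; have n1 : 1 <= n%:R :> R by rewrite ler1n.
have n0R : 0 < n%:R :> R by rewrite ltr0n.
rewrite -powR_mulrn ?ler0n//.
apply: (@le_trans _ _ (n%:R `^ s)); last first.
  by apply: ler_powR => //; rewrite ltW// truncnS_gt.
have h0' := ltW h0; have hV0 : 0 <= h^-1 by rewrite invr_ge0.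
have hs0 : h `^ s != 0 by rewrite gt_eqF// powR_gt0.
have -> : (h `^ s)^-1 = h^-1 `^ s.
  by apply: (mulIf hs0); rewrite mulVf// -powRM// mulVf ?gt_eqF// powR1.
apply: ge0_ler_powR; rewrite ?nnegrE ?ler0n//; first exact: ltW.
by rewrite -[leRHS]invrK lef_pV2 ?posrE ?invr_gt0.
Qed.

(** The form in which union bounds over polynomially many events are used: n^a events of
    probability n^-(a+1). *)
Lemma poly_exp_small (c eps : R) (a : nat) : 0 < eps ->
  \forall n \near \oo, c * n%:R ^+ a * expR (- (a.+1%:R * ln n%:R)) <= eps.
Proof.
move=> e0; near=> n.
have n0 : 0 < n%:R :> R by near: n; exact: nbhs_infty_gtr.
have -> : expR (- (a.+1%:R * ln n%:R)) = (n%:R ^+ a.+1)^-1 :> R.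
  by rewrite expRN expRM_natl lnK// posrE.
rewrite exprS invfM mulrACA mulfV ?mulr1; last by rewrite expf_neq0// gt_eqF.
rewrite ler_pdivrMr// mulrC -ler_pdivrMr//; apply: ltW.
by near: n; exact: nbhs_infty_gtr.
Unshelve. all: by end_near. Qed.

Lemma ln_ge1 n : (4 <= n)%N -> 1 <= ln n%:R :> R.
Proof.
move=> n4; have n0 : 0 < n%:R :> R by rewrite ltr0n; lia.
rewrite -ler_expR lnK ?posrE//; apply: le_trans (@expR1_le4 R) _.
by rewrite (ler_nat R 4).
Qed.

End asymptotics.

(** * Lipschitz kernels with bounded support *)

Section kernel.
Context {R : realType} {d : nat}.
Implicit Types (z : 'rV[R]_d) (f g : 'rV[R]_d -> R) (A : set 'rV[R]_d).

Lemma enorm_le z (e : R) : 0 <= e -> (forall i, `|z 0 i| <= e) ->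
  enorm z <= d%:R * e.
Proof.
move=> e0 ze; rewrite /enorm -[leRHS]ger0_norm ?mulr_ge0//.
rewrite -sqrtr_sqr ler_wsqrtr// exprMn.
apply: (@le_trans _ _ (\sum_(i < d) e ^+ 2)).
  by apply: ler_sum => i _; rewrite -real_normK ?num_real// lerXn2r ?nnegrE.
rewrite sumr_const card_ord -[leLHS]mulr_natl ler_wpM2r ?sqr_ge0//.
by rewrite -natrX ler_nat; nia.
Qed.

Lemma compact_coord_bounded A : compact A ->
  exists2 B : R, 0 < B & A `<=` box 0 B.
Proof.
move=> /compact_bounded[M [Mreal MA]].
exists (`|M| + 1); first by rewrite ltr_pwDr.
move=> z Az i; rewrite mxE subr0.
have := MA (`|M| + 1) _ z Az.
rewrite (le_lt_trans (ler_norm M)) ?ltrDl// => /(_ isT).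
apply: le_trans; rewrite -[in leRHS]/(mx_norm z) mx_normrE.
by apply: (le_bigmax _ (fun k : 'I_1 * 'I_d => `|z k.1 k.2|) (0, i)).
Qed.

(** Bounded and Lipschitz on every box; both properties are needed for products
    to inherit the second one. *)
Definition box_lipschitz f := forall B : R, exists2 C : R, 0 <= C &
  (forall z, box 0 B z -> `|f z| <= C) /\
  (forall z z' (e : R), box 0 B z -> box 0 B z' -> box z' e z -> 0 <= e ->
     `|f z - f z'| <= C * e).

Lemma box_lipschitz_cst (a : R) : box_lipschitz (fun=> a).
Proof.
move=> B; exists `|a| => //; split => // z z' e _ _ _ e0.
by rewrite subrr normr0 mulr_ge0.
Qed.

Lemma box_lipschitz_coord i : box_lipschitz (fun z => z 0 i).
Proof.
move=> B; exists (Num.max B 1); first by rewrite le_max ler01 orbT.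
split=> [z zB|z z' e _ _ zz' e0].
  by have := zB i; rewrite mxE subr0 => /le_trans; apply; rewrite le_max lexx.
by apply: le_trans (zz' i) _; rewrite ler_peMl// le_max lexx orbT.
Qed.

Lemma box_lipschitzM f g :
  box_lipschitz f -> box_lipschitz g -> box_lipschitz (fun z => f z * g z).
Proof.
move=> lf lg B; have [C C0 [Cb Cl]] := lf B; have [D D0 [Db Dl]] := lg B.
exists (2 * (C * D)); first by rewrite !mulr_ge0.
split=> [z zB|z z' e zB z'B zz' e0].
  rewrite normrM (le_trans (ler_pM _ _ (Cb _ zB) (Db _ zB)))//.
  by have := mulr_ge0 C0 D0; lra.
have -> : f z * g z - f z' * g z' = f z * (g z - g z') + (f z - f z') * g z' by ring.
rewrite (le_trans (ler_normD _ _))// !normrM.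
have h1 := ler_pM (normr_ge0 _) (normr_ge0 _) (Cb _ zB) (Dl _ _ _ zB z'B zz' e0).
have h2 := ler_pM (normr_ge0 _) (normr_ge0 _) (Cl _ _ _ zB z'B zz' e0) (Db _ z'B).
by apply: le_trans (lerD h1 h2) _; apply: le_of_eq; ring.
Qed.

Lemma box_lipschitz_prod (I : Type) (r : seq I) (F : I -> 'rV[R]_d -> R) :
  (forall i, box_lipschitz (F i)) ->
  box_lipschitz (fun z => \prod_(i <- r) F i z).
Proof.
move=> lF; elim: r => [|i r IHr].
  under [X in box_lipschitz X]eq_fun do rewrite big_nil.
  exact: box_lipschitz_cst.
under [X in box_lipschitz X]eq_fun do rewrite big_cons.
exact: box_lipschitzM.
Qed.

Lemma box_lipschitz_mi_pow v : box_lipschitz (fun z => mi_pow z v).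
Proof.
apply: box_lipschitz_prod => i; rewrite /mi_pow.
elim: (v i) => [|n IHn].
  under [X in box_lipschitz X]eq_fun do rewrite expr0.
  exact: box_lipschitz_cst.
under [X in box_lipschitz X]eq_fun do rewrite exprS.
by apply: box_lipschitzM => //; exact: box_lipschitz_coord.
Qed.

(** Boundedness comes from the Lipschitz condition and a point outside the support, which
    exists because d is positive. *)
Lemma assumption_K_bounded (K : 'rV[R]_d -> R) : (0 < d)%N -> assumption_K K ->
  exists B KM : R, [/\ 0 < B, 0 < KM, (forall z, K z != 0 -> box 0 B z),
    (forall z, K z <= KM) & box_lipschitz K].
Proof.
move=> d0 [K0 [LK LKK] cK _ _].
have [B B0 KB] := compact_coord_bounded cK.
have {}KB z : K z != 0 -> box 0 B z.
  by move=> Kz; apply: KB; exact: subset_closure.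
pose z0 : 'rV[R]_d := const_mx (B + 1).
have Kz0 : K z0 = 0.
  apply/eqP/negPn/negP => /KB/(_ (Ordinal d0)).
  by rewrite !mxE subr0 ger0_norm; lra.
have LK0 (z z' : 'rV[R]_d) (e : R) : 0 <= e -> box z' e z ->
    `|K z - K z'| <= `|LK| * d%:R * e.
  move=> e0 zz'; apply: le_trans (LKK z z') _; rewrite -mulrA.
  apply: (@le_trans _ _ (`|LK| * enorm (z - z'))).
    by rewrite ler_wpM2r ?sqrtr_ge0// ler_norm.
  by rewrite ler_wpM2l// enorm_le// => i; rewrite !mxE.
have LK1 : 0 <= `|LK| * d%:R by rewrite mulr_ge0.
pose KM := `|LK| * d%:R * (2 * B + 1) + 1.
have KM0 : 0 < KM by rewrite ltr_pwDr// mulr_ge0// addr_ge0// mulr_ge0// ltW.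
have KKM z : K z <= KM.
  have [->|/KB zB] := eqVneq (K z) 0; first exact: ltW.
  rewrite -[K z]subr0 -Kz0 (le_trans (ler_norm _))//.
  rewrite (@le_trans _ _ (`|LK| * d%:R * (2 * B + 1)))//; last by rewrite lerDl.
  apply: LK0; first by lra.
  move=> i; have := zB i; rewrite !mxE subr0 !ler_norml => /andP[h1 h2].
  by apply/andP; split; lra.
exists B, KM; split => // B'.
exists (KM + `|LK| * d%:R); first by rewrite addr_ge0// ltW.
split=> [z _|z z' e _ _ zz' e0].
  by rewrite ger0_norm// (le_trans (KKM z))// lerDl.
apply: le_trans (LK0 _ _ _ e0 zz') _.
by rewrite ler_wpM2r// lerDr ltW.
Qed.

(** Close to the support the estimate on a larger box applies; elsewhere both values
    vanish. *)
Lemma box_lipschitz_support f (B : R) : 0 < B -> box_lipschitz f ->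
  (forall z, f z != 0 -> box 0 B z) ->
  exists2 C : R, 0 < C & (forall z, `|f z| <= C) /\
   (forall z z' (e : R), 0 <= e -> e <= 1 -> box z' e z -> `|f z - f z'| <= C * e).
Proof.
move=> B0 lf fB; have [C C0 [Cb Cl]] := lf (B + 1).
have sub : box (0 : 'rV[R]_d) B `<=` box 0 (B + 1).
  by apply: subset_box => i; rewrite subrr normr0 add0r lerDl.
have f0 z : ~ box 0 B z -> f z = 0.
  by move=> zB; apply/eqP/negPn/negP => /fB.
exists (C + 1); first by rewrite ltr_pwDr.
split=> [z|z z' e e0 e1 zz'].
  have [zB|/f0 ->] := pselect (box 0 B z); last by rewrite normr0 addr_ge0.
  by apply: le_trans (Cb _ (sub _ zB)) _; rewrite lerDl.
have zz'i i : `|z' 0 i - z 0 i| <= 1 by rewrite distrC (le_trans (zz' i)).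
have step (x y : 'rV[R]_d) : (forall i, `|y 0 i - x 0 i| <= 1) -> box 0 B x -> box 0 (B + 1) y.
  move=> xy xB i; have := xB i; have := xy i; rewrite !mxE !subr0.
  rewrite !ler_norml => /andP[h1 h2] /andP[h3 h4]; apply/andP; split; lra.
have fin : box 0 (B + 1) z -> box 0 (B + 1) z' -> `|f z - f z'| <= (C + 1) * e.
  by move=> zB z'B; rewrite (le_trans (Cl _ _ _ zB z'B zz' e0))// ler_wpM2r// lerDl.
have [zB|zB] := pselect (box 0 B z).
  by apply: fin; [exact: sub|exact: step zB].
have [z'B|z'B] := pselect (box 0 B z').
  by apply: fin; [apply: step z'B => i; rewrite distrC|exact: sub].
by rewrite !f0// subrr normr0 mulr_ge0// addr_ge0.
Qed.

End kernel.

(** * Mean value inequality along the axes *)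

Section line_derivative.
Context {R : realType} {d : nat}.
Implicit Types (x z : 'rV[R]_d) (f : 'rV[R]_d -> R).

(** Directional derivatives are derivatives of a function of one real variable, to which
    the mean value theorem applies. *)
Lemma is_derive_line f z v (t l : R) :
  is_derive (t *: v + z) v f l <-> is_derive t 1 (fun u : R => f (u *: v + z)) l.
Proof.
have E : (fun h : R => h^-1 *: ((f \o shift (t *: v + z)) (h *: v) - f (t *: v + z))) =
         (fun h : R => h^-1 *: (((fun u : R => f (u *: v + z)) \o shift t) (h *: 1) -
            f (t *: v + z))).
  apply/funext => h /=; congr (_ *: (f _ - _)).
  by rewrite addrA -scalerDl [h *: 1]mulr1.
split=> -[D1 D2]; split.
- by move: D1; rewrite /derivable E.
- by rewrite -D2 /derive E.
- by rewrite /derivable E.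
- by rewrite -D2 /derive E.
Qed.

Lemma coord_mean_value f f' x z i (r M : R) (a : R) :
  (forall y, box x r y -> is_derive y (basis_vec i) f (f' y)) ->
  (forall y, box x r y -> `|f' y| <= M) ->
  box x r z -> box x r (a *: basis_vec i + z) ->
  `|f (a *: basis_vec i + z) - f z| <= M * `|a|.
Proof.
move=> df f'M zr ar.
have seg (t : R) : t \in `[Num.min 0 a, Num.max 0 a] -> box x r (t *: basis_vec i + z).
  move=> tI j; have := zr j; have := ar j; rewrite !mxE eqxx/=.
  case: (j == i) => /=; last by rewrite !mulr0.
  move: tI; rewrite in_itv/= !mulr1 !ler_norml.
  case: (leP 0 a) => a0 /andP[t1 t2] /andP[h1 h2] /andP[h3 h4]; apply/andP; split; lra.
have dphi (t : R) : t \in `[Num.min 0 a, Num.max 0 a] ->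
    is_derive t 1 (fun u : R => f (u *: basis_vec i + z)) (f' (t *: basis_vec i + z)).
  by move=> tI; apply/is_derive_line/df/seg.
have main : forall b c : R, b <= c -> `[b, c] `<=` `[Num.min 0 a, Num.max 0 a] ->
   `|f (c *: basis_vec i + z) - f (b *: basis_vec i + z)| <= M * `|c - b|.
  move=> b c bc sub.
  have d1 t : t \in `]b, c[ ->
      is_derive t 1 (fun u : R => f (u *: basis_vec i + z)) (f' (t *: basis_vec i + z)).
    move=> tI; apply: dphi; apply: sub; move: tI.
    by rewrite /= !in_itv/= => /andP[/ltW -> /ltW ->].
  have c1 : {within `[b, c], continuous (fun u : R => f (u *: basis_vec i + z))}.
    apply: derivable_within_continuous => t tI.
    by have [] := dphi t (sub _ tI).
  have [y yI ->] := MVT_segment bc d1 c1.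
  by rewrite normrM ler_wpM2r// f'M//; apply: seg; exact: sub.
have [a0|a0] := leP 0 a.
  have := main 0 a a0; rewrite scale0r add0r subr0; apply.
  by rewrite (min_idPl a0) (max_idPr a0).
have := main a 0 (ltW a0); rewrite scale0r add0r sub0r normrN distrC; apply.
by rewrite (min_idPr (ltW a0)) (max_idPl (ltW a0)).
Qed.

(** Moving from the center of a box to one of its points one coordinate at a
    time: only partial derivatives are involved, never a total differential. *)
Lemma box_mean_value f (f' : 'I_d -> 'rV[R]_d -> R) x z (r M : R) : 0 <= r ->
  (forall i y, box x r y -> is_derive y (basis_vec i) f (f' i y)) ->
  (forall i y, box x r y -> `|f' i y| <= M) ->
  box x r z -> `|f z - f x| <= d%:R * r * M.
Proof.
move=> r0 df f'M zr.
pose y (n : nat) : 'rV[R]_d := \row_j (if (j < n)%N then z 0 j else x 0 j).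
have yr n : box x r (y n).
  by move=> j; rewrite mxE; case: ifP => _; [exact: zr|rewrite subrr normr0].
have y0 : y 0%N = x by apply/rowP => j; rewrite mxE ltn0.
have yd : y d = z by apply/rowP => j; rewrite mxE ltn_ord.
suff H n : (n <= d)%N -> `|f (y n) - f x| <= n%:R * r * M.
  by have := H d (leqnn d); rewrite yd.
elim: n => [_|n IHn nd]; first by rewrite y0 subrr normr0 !mul0r.
pose i := Ordinal nd.
have yS : y n.+1 = (z 0 i - x 0 i) *: basis_vec i + y n.
  apply/rowP => j; rewrite !mxE eqxx/= ltnS.
  have [ji|ji] := eqVneq j i.
    by rewrite ji/= leqnn ltnn mulr1 subrK.
  rewrite mulr0 add0r leq_eqVlt (_ : (j == n :> nat) = false)//.
  by apply/negbTE; move: ji; apply: contraNN => /eqP ?; apply/eqP/val_inj.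
have -> : f (y n.+1) - f x = (f (y n.+1) - f (y n)) + (f (y n) - f x) by ring.
have h1 : `|f (y n.+1) - f (y n)| <= M * `|z 0 i - x 0 i|.
  have := @coord_mean_value f (f' i) x (y n) i r M (z 0 i - x 0 i).
  by rewrite -yS; apply => //; exact: f'M.
have M0 : 0 <= M by apply: le_trans (f'M i x _) => // j; rewrite subrr normr0.
have h2 : M * `|z 0 i - x 0 i| <= M * r by rewrite ler_wpM2l// zr.
rewrite (le_trans (ler_normD _ _))// -natr1.
by have := IHn (ltnW nd); lra.
Qed.

End line_derivative.

(** * Taylor polynomials with a Hoelder remainder *)

Section multi_index_lemmas.
Context {d p : nat}.
Implicit Types (w : {ffun 'I_d -> nat}) (u : mindex d p).

Lemma mi0_subproof :
  (\sum_(i < d) ([ffun=> ord0] : {ffun 'I_d -> 'I_p.+1}) i <= p)%N.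
Proof. by rewrite big1// => i _; rewrite ffunE. Qed.

(** A total inverse of mi_of, with the default value zero on multi-indices of size larger
    than p. *)
Definition mi_mk w : mindex d p :=
  let u0 : mindex d p := Sub [ffun=> ord0] mi0_subproof in
  if (mi_size w <= p)%N then insubd u0 [ffun i => inord (w i)] else u0.

Lemma mi_size_coord w i : (w i <= mi_size w)%N.
Proof. by rewrite /mi_size (bigD1 i)//= leq_addr. Qed.

Lemma mi_of_mk w : (mi_size w <= p)%N -> mi_of (mi_mk w) = w.
Proof.
move=> wp; rewrite /mi_mk wp; have wi i : (w i < p.+1)%N.
  by rewrite ltnS (leq_trans (mi_size_coord w i)).
apply/ffunP => i; rewrite ffunE val_insubd ifT; first by rewrite ffunE inordK.
by under eq_bigr => j _ do rewrite ffunE inordK//.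
Qed.

Lemma mi_of_mk_large w : (p < mi_size w)%N -> mi_of (mi_mk w) = mi0.
Proof. by move=> pw; apply/ffunP => i; rewrite /mi_mk leqNgt pw/= !ffunE. Qed.

Lemma mi_size_of u : (mi_size (mi_of u) <= p)%N.
Proof.
rewrite /mi_size; apply: leq_trans (valP u).
by apply: leq_sum => i _; rewrite ffunE.
Qed.

Lemma mi_of_inj : injective (@mi_of d p).
Proof.
move=> u u' uu'; apply/val_inj/ffunP => i; apply/val_inj.
by have /ffunP/(_ i) := uu'; rewrite !ffunE.
Qed.

Lemma mi_mk_of u : mi_mk (mi_of u) = u.
Proof. by apply: mi_of_inj; rewrite mi_of_mk// mi_size_of. Qed.

Lemma mi_size_succ w i : mi_size (mi_succ w i) = (mi_size w).+1.
Proof.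
rewrite /mi_size; under eq_bigr do rewrite ffunE.
rewrite big_split/= -addn1; congr (_ + _)%N.
by rewrite (bigD1 i)//= eqxx big1// => j /negbTE ->.
Qed.

Definition mi_add w w' : {ffun 'I_d -> nat} := [ffun i => (w i + w' i)%N].

Lemma mi_addS w w' i : mi_add (mi_succ w i) w' = mi_add w (mi_succ w' i).
Proof. by apply/ffunP => j; rewrite !ffunE; lia. Qed.

Lemma mi_add0 w : mi_add w mi0 = w.
Proof. by apply/ffunP => j; rewrite !ffunE addn0. Qed.

Lemma mi_add0l w : mi_add mi0 w = w.
Proof. by apply/ffunP => j; rewrite !ffunE add0n. Qed.

Definition mi_pred w i : {ffun 'I_d -> nat} := [ffun j => (w j - (j == i))%N].

Lemma mi_succK w i : mi_pred (mi_succ w i) i = w.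
Proof. by apply/ffunP => j; rewrite !ffunE addnK. Qed.

Lemma mi_predK w i : (0 < w i)%N -> mi_succ (mi_pred w i) i = w.
Proof.
move=> wi; apply/ffunP => j; rewrite !ffunE; case: eqP => [->|_] /=; lia.
Qed.

Lemma mi_size_eq0 w : (mi_size w == 0%N) = (w == mi0).
Proof.
apply/eqP/eqP => [w0|->]; last by rewrite /mi_size big1// => i _; rewrite ffunE.
apply/ffunP => i; have := mi_size_coord w i; rewrite w0 ffunE leqn0; exact: eqP.
Qed.

End multi_index_lemmas.

Section taylor.
Context {R : realType} {d : nat}.
Implicit Types (x z : 'rV[R]_d) (v w : {ffun 'I_d -> nat}).

Definition monomial x w z : R := mi_pow (z - x) w / (mi_fact w)%:R.

Lemma monomial0 x z : monomial x mi0 z = 1.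
Proof.
rewrite /monomial /mi_pow /mi_fact !big1 ?divr1// => i _; by rewrite ffunE ?expr0.
Qed.

Lemma monomial_center x w : w != mi0 -> monomial x w x = 0.
Proof.
move=> w0; have [i wi] : exists i, w i != 0%N.
  apply/existsP; apply: contraNT w0; rewrite negb_exists => /forallP w0.
  by apply/eqP/ffunP => i; rewrite ffunE; apply/eqP; have := w0 i; rewrite negbK.
by rewrite /monomial /mi_pow (bigD1 i)//= !mxE subrr expr0n (negbTE wi) !mul0r.
Qed.

Lemma mi_fact_neq0 w : (mi_fact w)%:R != 0 :> R.
Proof.
rewrite pnatr_eq0 -lt0n /mi_fact; apply: prodn_gt0 => i; exact: fact_gt0.
Qed.

Lemma is_derive_monomial x w i z :
  is_derive z (basis_vec i) (monomial x w)
    (if (0 < w i)%N then monomial x (mi_pred w i) z else 0).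
Proof.
pose c := (\prod_(j < d | j != i) (z 0 j - x 0 j) ^+ w j) / (mi_fact w)%:R.
have lineE : (fun u : R => monomial x w (u *: basis_vec i + z)) =
             (fun u : R => c * (u + (z 0 i - x 0 i)) ^+ w i).
  apply/funext => u; rewrite /monomial /mi_pow (bigD1 i)//=.
  have -> : \prod_(j < d | j != i) (u *: basis_vec i + z - x) 0 j ^+ w j =
            \prod_(j < d | j != i) (z 0 j - x 0 j) ^+ w j.
    by apply: eq_bigr => j ji; rewrite !mxE (negbTE ji) mulr0 add0r.
  by rewrite !mxE !eqxx mulr1 -addrA -mulrA mulrC.
have E0 : 0 *: basis_vec i + z = z by rewrite scale0r add0r.
suff : is_derive (0 *: basis_vec i + z) (basis_vec i) (monomial x w)
    (if (0 < w i)%N then monomial x (mi_pred w i) z else 0) by rewrite E0.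
apply/is_derive_line; rewrite lineE.
have der : is_derive (0 : R) 1 (fun u : R => c * (u + (z 0 i - x 0 i)) ^+ w i)
    (c * ((w i)%:R * (z 0 i - x 0 i) ^+ (w i).-1)).
  have h1 : is_derive (0 : R) 1 (fun u : R => u + (z 0 i - x 0 i)) 1.
    by apply: is_derive_eq; rewrite addr0.
  have h2 := is_deriveX (w i) h1.
  rewrite exprfctE in h2.
  have h3 := is_deriveZ c h2.
  apply: (is_derive_eq h3); congr (_ * _).
  by rewrite /GRing.scale/= mulr1 add0r.
apply: (is_derive_eq der).
case: ifP => wi; last by rewrite (_ : w i = 0%N) ?mul0r ?mulr0//; lia.
have wiS : w i = (w i).-1.+1 by lia.
rewrite /monomial /mi_pow (bigD1 i)//= ffunE eqxx subn1 !mxE.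
have -> : \prod_(j < d | j != i) (z - x) 0 j ^+ mi_pred w i j =
          \prod_(j < d | j != i) (z 0 j - x 0 j) ^+ w j.
  by apply: eq_bigr => j /negbTE ji; rewrite !mxE ffunE ji subn0.
have fE : (mi_fact w)%:R = (w i)%:R * (mi_fact (mi_pred w i))%:R :> R.
  rewrite -natrM; congr (_%:R); rewrite /mi_fact (bigD1 i)//= [in RHS](bigD1 i)//=.
  rewrite mulnA ffunE eqxx subn1 {1}wiS factS -wiS; congr (_ * _)%N.
  by apply: eq_bigr => j /negbTE ji; rewrite ffunE ji subn0.
have w0 : (w i)%:R != 0 :> R by rewrite pnatr_eq0; lia.
by rewrite /c fE; field; rewrite w0 mi_fact_neq0.
Qed.

Variables (p k : nat) (kp : (k <= p)%N).

(** The Taylor polynomial at x of the v-th derivative; the coefficients c are the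
    derivatives at x.  Having all v at hand makes the induction on derivatives possible. *)
Definition taylor_poly (c : {ffun 'I_d -> nat} -> R) x v z : R :=
  \sum_(u : mindex d p | (mi_size (mi_of u) + mi_size v <= k)%N)
     monomial x (mi_of u) z * c (mi_add v (mi_of u)).

Lemma is_derive_bigsum (I : Type) (r : seq I) (Q : pred I)
    (f : I -> 'rV[R]_d -> R) (df : I -> R) z e :
  (forall i, is_derive z e (f i) (df i)) ->
  is_derive z e (fun y => \sum_(i <- r | Q i) f i y) (\sum_(i <- r | Q i) df i).
Proof.
move=> fdf; elim: r => [|i r IHr].
  rewrite big_nil; under [X in is_derive _ _ X _]eq_fun do rewrite big_nil.
  exact: is_derive_cst.
rewrite big_cons; under [X in is_derive _ _ X _]eq_fun do rewrite big_cons.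
by case: ifP => // _; exact: is_deriveD.
Qed.

(** Differentiation lowers the i-th exponent of every monomial; reindexing the sum by the
    lowered exponents gives the polynomial of the next derivative. *)
Lemma is_derive_taylor_poly c x v i z :
  is_derive z (basis_vec i) (taylor_poly c x v) (taylor_poly c x (mi_succ v i) z).
Proof.
have H : is_derive z (basis_vec i) (taylor_poly c x v) (\sum_(u : mindex d p |
    (mi_size (mi_of u) + mi_size v <= k)%N)
    (if (0 < mi_of u i)%N then monomial x (mi_pred (mi_of u) i) z else 0) *
      c (mi_add v (mi_of u))).
  apply: is_derive_bigsum => u.
  under [X in is_derive _ _ X _]eq_fun do rewrite mulrC.
  rewrite mulrC; exact: (is_deriveZ _ (is_derive_monomial _ _ _ _)).
apply: (is_derive_eq H).
under eq_bigr do rewrite (fun_if (fun t => t * _)) mul0r.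
rewrite -big_mkcondr/=.
rewrite (reindex_onto (fun u : mindex d p => @mi_mk d p (mi_succ (mi_of u) i))
  (fun u : mindex d p => @mi_mk d p (mi_pred (mi_of u) i)))/=; last first.
  move=> u /andP[_ ui]; rewrite [X in mi_succ X _]mi_of_mk ?mi_predK ?mi_mk_of//.
  by have := mi_size_succ (mi_pred (mi_of u) i) i; rewrite mi_predK//; have := mi_size_of u; lia.
rewrite /taylor_poly; apply: eq_big => u.
  have := mi_size_of u; rewrite leq_eqVlt => /orP[/eqP up|up].
    rewrite mi_of_mk_large; last by rewrite mi_size_succ up.
    by rewrite mi_size_succ ffunE ltnn andbF/= up; apply/esym/negbTE; lia.
  rewrite mi_of_mk ?mi_size_succ// mi_succK mi_mk_of eqxx andbT ffunE eqxx.
  by rewrite addn1 andbT addnS addSn.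
move=> /andP[/andP[_ +] _].
have [up|up] := leqP (mi_size (mi_succ (mi_of u) i)) p; last first.
  by rewrite mi_of_mk_large// ffunE.
by rewrite mi_of_mk// mi_succK mi_addS.
Qed.

Lemma taylor_poly_center c x v : (mi_size v <= k)%N -> taylor_poly c x v x = c v.
Proof.
move=> vk; rewrite /taylor_poly (bigD1 (@mi_mk d p mi0))/=; last first.
  rewrite mi_of_mk; first by rewrite (eqP (_ : mi_size mi0 == 0%N)) ?mi_size_eq0.
  by rewrite (eqP (_ : mi_size mi0 == 0%N)) ?mi_size_eq0.
rewrite mi_of_mk; last by rewrite (eqP (_ : mi_size mi0 == 0%N)) ?mi_size_eq0.
rewrite monomial0 mul1r mi_add0 big1 ?addr0// => u /andP[_ u0].
rewrite monomial_center ?mul0r//; apply: contraNneq u0 => u0.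
by rewrite -[u in u == _](@mi_mk_of d p) u0.
Qed.

Lemma taylor_poly_top c x v z : mi_size v = k -> taylor_poly c x v z = c v.
Proof.
move=> vk; rewrite -[RHS](@taylor_poly_center c x) ?vk//.
rewrite /taylor_poly; apply: eq_bigr => u.
rewrite vk -{2}[k]add0n leq_add2r leqn0 mi_size_eq0 => /eqP ->.
by rewrite !monomial0.
Qed.

(** Taylor's formula with Hoelder remainder.  The remainder of order |v| has the
    remainders of order |v| + 1 for its partial derivatives, and those of top order
    are controlled by the Hoelder condition; descending induction on |v| only uses the
    mean value inequality along the axes. *)
Lemma taylor_remainder (A : set 'rV[R]_d) g G (L s : R) :
  derivatives_on A k g G -> 0 <= L -> k%:R < s ->
  (forall v x x', mi_size v = k -> A x -> A x' ->
    `|G v x - G v x'| <= L * enorm (x - x') `^ (s - k%:R)) ->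
  exists2 C : R, 0 <= C & forall x z r, 0 < r -> box x r `<=` interior A ->
   box x r z -> `|g z - taylor_poly (fun w => G w x) x mi0 z| <= C * r `^ s.
Proof.
move=> [Gg Gc Gd] L0 ks GH.
exists (L * d%:R `^ (s - k%:R) * d%:R ^+ k).
  by rewrite !mulr_ge0// ?powR_ge0 ?exprn_ge0.
move=> x z r r0 xrA; pose D v y := G v y - taylor_poly (fun w => G w x) x v y.
have boxA y : box x r y -> A y by move/xrA; exact: interior_subset.
have xx : box x r x by move=> i; rewrite subrr normr0 ltW.
suff H j v : (j <= k)%N -> mi_size v = (k - j)%N -> forall y, box x r y ->
    `|D v y| <= L * d%:R `^ (s - k%:R) * d%:R ^+ j * r `^ (s - k%:R + j%:R).
  move=> zr; have := H k mi0 (leqnn k); rewrite subnn subrK.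
  rewrite (eqP (_ : mi_size mi0 == 0%N)) ?mi_size_eq0// => /(_ erefl z zr).
  by rewrite /D Gg//; exact: boxA.
elim: j v => [|j IHj] v jk vj y yr.
  rewrite subn0 in vj; rewrite /D taylor_poly_top// addr0 expr0 mulr1.
  apply: le_trans (GH _ _ _ vj (boxA _ yr) (boxA _ xx)) _.
  rewrite -mulrA ler_wpM2l// -powRM ?ler0n ?(ltW r0)//.
  apply: ge0_ler_powR.
  - by rewrite subr_ge0 ltW.
  - by rewrite nnegrE sqrtr_ge0.
  - by rewrite nnegrE mulr_ge0// ltW.
  - by apply: enorm_le => [|i]; [exact: ltW|have := yr i; rewrite !mxE].
have vk : (mi_size v < k)%N by rewrite vj; lia.
have -> : D v y = D v y - D v x.
  by rewrite {3}/D taylor_poly_center ?subrr ?subr0// ltnW.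
set M := L * d%:R `^ (s - k%:R) * d%:R ^+ j * r `^ (s - k%:R + j%:R).
have := @box_mean_value R d (D v) (fun i => D (mi_succ v i)) x y r M (ltW r0).
move=> h; apply: le_trans (h _ _ yr) _.
- move=> i u ur; apply: is_deriveB; first by apply: Gd => //; exact: xrA.
  exact: is_derive_taylor_poly.
- by move=> i u ur; apply: IHj => //; [exact: ltnW|rewrite mi_size_succ vj; lia].
rewrite /M exprSr -[j.+1%:R]natr1 addrA [r `^ (_ + 1)]powRD; last first.
  by apply/implyP => _; rewrite gt_eqF.
rewrite powRr1 ?(ltW r0)//; apply: le_of_eq; ring.
Qed.

End taylor.

(** * Lower bounds for polynomials *)

Lemma box0_coord (R : realType) d (z : 'rV[R]_d) r : box 0 r z ->
  forall i, `|z 0 i| <= r.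
Proof. by move=> zr i; have := zr i; rewrite [(0 : 'rV[R]_d) 0 i]mxE subr0. Qed.

Section unisolvence.
Context {R : realType} {d p : nat}.
Implicit Types (z : 'rV[R]_d) (theta : {ffun mindex d p -> R}).

Definition lp_value theta z : R := \sum_(v : mindex d p) lp_basis z v * theta v.

(** The rows of the inverse Vandermonde matrix recover the coefficients of a univariate
    polynomial from its values at p + 1 equidistant points. *)
Lemma vandermonde_dual (tau : R) : tau != 0 ->
  exists l : 'I_p.+1 -> 'I_p.+1 -> R, forall k m : 'I_p.+1,
    \sum_(j < p.+1) l k j * (tau * j%:R) ^+ m = (k == m)%:R.
Proof.
move=> tau0; pose a : 'rV[R]_p.+1 := \row_j (tau * j%:R).
have Vu : Vandermonde p.+1 a \in unitmx.
  rewrite unitmxE det_Vandermonde unitfE; apply/prodf_neq0 => i _.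
  apply/prodf_neq0 => j ij; rewrite !mxE -mulrBr mulf_neq0// subr_eq0 eqr_nat.
  by rewrite gtn_eqF.
exists (fun k j => invmx (Vandermonde p.+1 a)^T k j) => k m.
have Vtu : (Vandermonde p.+1 a)^T \in unitmx by rewrite unitmx_tr.
have /matrixP/(_ k m) := mulVmx Vtu; rewrite !mxE => <-.
by apply: eq_bigr => j _; rewrite !mxE.
Qed.

Definition grid_point (tau : R) (a : {ffun 'I_d -> 'I_p.+1}) : 'rV[R]_d :=
  \row_i (tau * (a i)%:R).

(** The dual basis of the monomials on a grid is the tensor product of the
    univariate ones, which come from the inverse of a Vandermonde matrix. *)
Lemma grid_dual (tau : R) : tau != 0 ->
  exists l : mindex d p -> {ffun 'I_d -> 'I_p.+1} -> R, forall theta v,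
   theta v = \sum_a l v a * lp_value theta (grid_point tau a).
Proof.
move=> /vandermonde_dual[l lP].
exists (fun v a => (mi_fact (mi_of v))%:R * \prod_(i < d) l (val v i) (a i)) => theta v.
under eq_bigr do rewrite mulr_sumr; rewrite exchange_big/=.
have E u : \sum_(a : {ffun 'I_d -> 'I_p.+1}) \prod_(i < d) l (val v i) (a i) *
    mi_pow (grid_point tau a) (mi_of u) = (u == v)%:R.
  transitivity (\prod_(i < d) \sum_(j < p.+1) l (val v i) j * (tau * j%:R) ^+ (mi_of u) i).
    rewrite bigA_distr_bigA/=; apply: eq_bigr => a _.
    by rewrite /mi_pow -big_split/=; apply: eq_bigr => i _; rewrite !mxE.
  have [->|uv] := eqVneq u v.
    by rewrite big1// => i _; rewrite ffunE lP eqxx.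
  have [i ui] : exists i, val v i != val u i.
    apply/existsP; apply: contraNT uv; rewrite negb_exists => /forallP H.
    by apply/eqP/val_inj/ffunP => i; apply/eqP; rewrite eq_sym; have := H i; rewrite negbK.
  by rewrite (bigD1 i)//= ffunE lP (negbTE ui) mul0r.
rewrite (bigD1 v)//= [X in _ + X]big1 ?addr0 => [|u uv].
  transitivity (theta v * \sum_(a : {ffun 'I_d -> 'I_p.+1})
     \prod_(i < d) l (val v i) (a i) * mi_pow (grid_point tau a) (mi_of v)).
    by rewrite E eqxx mulr1.
  rewrite mulr_sumr; apply: eq_bigr => a _; rewrite ffunE.
  by field; exact: mi_fact_neq0.
transitivity ((mi_fact (mi_of v))%:R / (mi_fact (mi_of u))%:R * theta u *
   \sum_(a : {ffun 'I_d -> 'I_p.+1})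
     \prod_(i < d) l (val v i) (a i) * mi_pow (grid_point tau a) (mi_of u)).
  by rewrite mulr_sumr; apply: eq_bigr => a _; rewrite ffunE; ring.
by rewrite E (negbTE uv) mulr0.
Qed.

Lemma box_lipschitz_lp_basis (v : mindex d p) :
  box_lipschitz (fun z : 'rV[R]_d => lp_basis z v).
Proof.
under [X in box_lipschitz X]eq_fun do rewrite ffunE.
by apply: box_lipschitzM; [exact: box_lipschitz_mi_pow|exact: box_lipschitz_cst].
Qed.

Definition separating_boxes (I : finType) (pt : I -> 'rV[R]_d) (c e : R) : Prop :=
  forall theta (N : R) (v0 : mindex d p),
  `|theta v0| = N -> (forall v, `|theta v| <= N) ->
  exists a, (forall z, box (pt a) e z -> c * N <= lp_value theta z) \/
            (forall z, box (pt a) e z -> lp_value theta z <= - (c * N)).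

(** The points of a grid determine the coefficients, so the polynomial is large at one of
    them; polynomials with bounded coefficients are uniformly Lipschitz, so it keeps its
    sign on a box of fixed size around that point. *)
Lemma lp_value_lower (rho : R) : 0 < rho ->
  exists (I : finType) (pt : I -> 'rV[R]_d) (c e : R),
  [/\ 0 < c, 0 < e, e <= rho, forall a, box 0 rho (pt a) & separating_boxes pt c e].
Proof.
move=> rho0; pose tau := rho / p.+1%:R.
have tau0 : 0 < tau by rewrite divr_gt0.
have [l lP] := grid_dual (lt0r_neq0 tau0).
pose M := 1 + \sum_(v : mindex d p) \sum_a `|l v a|.
have sum0 v : 0 <= \sum_a `|l v a| by apply: sumr_ge0.
have M0 : 1 <= M by rewrite lerDl; apply: sumr_ge0.
have Mv v : \sum_a `|l v a| < M.
  rewrite /M (bigD1 v)//= addrCA ltrDl ltr_wpDr//; apply: sumr_ge0 => ? _; exact: sum0.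
have lip (v : mindex d p) : {C : R | 0 <= C & forall z z' (e : R),
     box 0 (2 * rho) z -> box 0 (2 * rho) z' -> box z' e z -> 0 <= e ->
     `|lp_basis z v - lp_basis z' v| <= C * e}.
  by apply: cid2; have [C C0 [_ Cl]] := box_lipschitz_lp_basis v (2 * rho); exists C.
pose S := 1 + \sum_(v : mindex d p) s2val (lip v).
have C0 v : 0 <= s2val (lip v) by exact: (s2valP (lip v)).
have S0 : 0 < S by rewrite ltr_pwDl// sumr_ge0.
pose c := (2 * M)^-1.
have c0 : 0 < c by rewrite invr_gt0; lra.
pose e := Num.min rho (c / S).
have e0 : 0 < e by rewrite lt_min rho0 divr_gt0.
have eS : e * S <= c by rewrite -ler_pdivlMr// ge_min lexx orbT.
have ptB a : box 0 rho (grid_point tau a).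
  have rho0' := ltW rho0; have tau0' := ltW tau0.
  move=> i; rewrite !mxE subr0 ger0_norm; last exact: mulr_ge0.
  by rewrite /tau mulrAC ler_pdivrMr// ler_wpM2l// ler_nat; exact: ltnW (ltn_ord _).
have sub (r : R) (x : 'rV[R]_d) : (forall i, `|x 0 i| + r <= 2 * rho) -> box x r `<=` box (0 : 'rV[R]_d) (2 * rho).
  by move=> h; apply: subset_box => i; rewrite mxE subr0.
exists {ffun 'I_d -> 'I_p.+1}, (grid_point tau), c, e; split => //.
  by rewrite ge_min lexx.
move=> theta N v0 tN tv.
have N0 : 0 <= N by rewrite -tN.
have [a aN] : exists a, 2 * c * N <= `|lp_value theta (grid_point tau a)|.
  apply: contrapT => H.
  have {}H a : `|lp_value theta (grid_point tau a)| < 2 * c * N.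
    by rewrite ltNge; apply/negP => h; apply: H; exists a.
  have cM : 2 * c * M = 1 by rewrite /c; field; lra.
  have : N <= 2 * c * N * \sum_a `|l v0 a|.
    rewrite -{1}tN lP (le_trans (ler_norm_sum _ _ _))// mulr_sumr.
    by apply: ler_sum => a _; rewrite normrM mulrC ler_wpM2r// ltW.
  have N1 : 0 < 2 * c * N.
    by apply: le_lt_trans (H [ffun=> ord0]).
  have : 2 * c * N * \sum_a `|l v0 a| < 2 * c * N * M by rewrite ltr_pM2l.
  have -> : 2 * c * N * M = N by rewrite mulrAC cM mul1r.
  by move=> h1 h2; move: (le_lt_trans h2 h1); rewrite ltxx.
have var z : box (grid_point tau a) e z ->
    `|lp_value theta z - lp_value theta (grid_point tau a)| <= c * N.
  move=> za; rewrite /lp_value -sumrB.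
  under eq_bigr do rewrite -mulrBl.
  have zB : box 0 (2 * rho) z.
    apply: sub za => i; have := box0_coord (ptB a) i.
    by have : e <= rho; [rewrite ge_min lexx|lra].
  have aB : box 0 (2 * rho) (grid_point tau a).
    apply: (sub 0 (grid_point tau a)) => i; last by rewrite subrr normr0.
    by have := box0_coord (ptB a) i; lra.
  apply: le_trans (ler_norm_sum _ _ _) _.
  apply: (@le_trans _ _ (\sum_(v : mindex d p) s2val (lip v) * e * N)).
    apply: ler_sum => v _; rewrite normrM ler_pM//.
    exact: (s2valP' (lip v)) (ltW e0).
  rewrite -!mulr_suml ler_wpM2r// (le_trans _ eS)// mulrC ler_wpM2l ?(ltW e0)//.
  by rewrite lerDr.
exists a; have [h|h] := leP 0 (lp_value theta (grid_point tau a)).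
  left=> z /var; rewrite ler_norml => /andP[h1 _].
  by move: aN; rewrite ger0_norm//; lra.
right=> z /var; rewrite ler_norml => /andP[_ h1].
by move: aN; rewrite ltr0_norm//; lra.
Qed.

End unisolvence.

(** * The error of a minimizer, given the empirical counts *)

Section knight.
Context {R : realType}.
Implicit Types a q t s : R.

Definition quantile_score a q : R := a - (q <= 0)%R%:R.

(** The curvature term of Knight's identity, 2 int_0^t (1(q <= u) - 1(q <= 0)) du. *)
Definition knight q t : R := `|q - t| - `|q| + t - 2 * t * (q <= 0)%R%:R.

Lemma knight_identity a q t :
  check_loss a (q - t) = check_loss a q - 2 * t * quantile_score a q + knight q t.
Proof. by rewrite /check_loss /knight /quantile_score; ring. Qed.

Lemma knight_ge0 q t : 0 <= knight q t.
Proof.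
rewrite /knight; case: (leP q 0) => q0 /=.
  by rewrite (ler0_norm q0); have := ler_norm (t - q); rewrite distrC; lra.
by rewrite (gtr0_norm q0) mulr0; have := ler_norm (q - t); lra.
Qed.

Lemma knight_le q t : knight q t <= 2 * `|t| * (`|q| <= `|t|)%R%:R.
Proof.
rewrite /knight; have t1 := ler_norm t; have t2 : - t <= `|t| by rewrite -normrN ler_norm.
case: (lerP `|q| `|t|) => qt /=; rewrite ?mulr1 ?mulr0.
  have := ler_normB q t; case: (leP q 0) => q0 /=; lra.
case: (leP q 0) => q0 /=.
  by move: qt; rewrite (ler0_norm q0) => qt; rewrite ler0_norm; lra.
by move: qt; rewrite (gtr0_norm q0) => qt; rewrite ger0_norm; lra.
Qed.

(** Residuals lying between 0 and t/2 contribute at least t/2 to the integral. *)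
Lemma knight_lower_pos q t : 0 < q -> 2 * q <= t -> t <= knight q t.
Proof.
by move=> q0 qt; rewrite /knight (gtr0_norm q0) (lt_geF q0)/= ler0_norm; lra.
Qed.

Lemma knight_lower_neg q t : q <= 0 -> t <= 2 * q -> - t <= knight q t.
Proof.
by move=> q0 qt; rewrite /knight (ler0_norm q0) q0/= ger0_norm; lra.
Qed.

Lemma check_loss_convex a s t (l : R) : 0 <= l <= 1 ->
  check_loss a ((1 - l) * s + l * t) <=
  (1 - l) * check_loss a s + l * check_loss a t.
Proof.
move=> /andP[l0 l1]; rewrite /check_loss.
have := ler_normD ((1 - l) * s) (l * t).
rewrite !normrM (ger0_norm l0) (@ger0_norm _ (1 - l)) ?subr_ge0//; lra.
Qed.

End knight.

Section cells.
Context {R : realType} {d : nat} (Q : 'rV[R]_d -> R).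
Implicit Types (x : 'rV[R]_d) (r t : R).

Definition cell_pos x r t : set ('rV[R]_d * R) :=
  [set u | box x r u.1 /\ 0 < u.2 - Q u.1 <= t].
Definition cell_neg x r t : set ('rV[R]_d * R) :=
  [set u | box x r u.1 /\ - t < u.2 - Q u.1 <= 0].
Definition cell_abs x r t : set ('rV[R]_d * R) :=
  [set u | box x r u.1 /\ `|u.2 - Q u.1| <= t].

Lemma cell_posE x r t :
  cell_pos x r t = [set u | box x r u.1 /\ `]0, t]%classic (u.2 - Q u.1)].
Proof. by apply/seteqP; split => u /=; rewrite in_itv. Qed.

Lemma cell_negE x r t :
  cell_neg x r t = [set u | box x r u.1 /\ `](- t), 0]%classic (u.2 - Q u.1)].
Proof. by apply/seteqP; split => u /=; rewrite in_itv. Qed.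

Lemma cell_absE x r t :
  cell_abs x r t = [set u | box x r u.1 /\ `[(- t), t]%classic (u.2 - Q u.1)].
Proof. by apply/seteqP; split => u /=; rewrite /cell_abs/= in_itv/= ler_norml. Qed.

Definition cell_law_bounds {dT : measure_display} {T : measurableType dT}
    (P : probability T R) (X : T -> 'rV[R]_d) (Y : T -> R) (A : set 'rV[R]_d)
    (cl cu : R) : Prop :=
  forall x r, 0 < r -> box x r `<=` A ->
  [/\ (P (X @^-1` box x r) <= (cu * r ^+ d)%:E)%E,
    (forall t, 0 < t -> t <= 1 ->
      ((cl * r ^+ d * t)%:E <= P ((fun w => (X w, Y w)) @^-1` cell_pos x r t))%E /\
      ((cl * r ^+ d * t)%:E <= P ((fun w => (X w, Y w)) @^-1` cell_neg x r t))%E) &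
    forall t, 0 < t -> t <= 1 ->
      (P ((fun w => (X w, Y w)) @^-1` cell_abs x r t) <= (cu * r ^+ d * t)%:E)%E].

End cells.

Lemma lp_basis_scale (R : realType) d p (h : R) (z : 'rV[R]_d) (v : mindex d p) :
  lp_basis (h *: z) v = h ^+ mi_size (mi_of v) * lp_basis z v.
Proof.
rewrite !ffunE mulrA; congr (_ / _).
rewrite /mi_pow /mi_size -prodrXr -big_split/=.
by apply: eq_bigr => i _; rewrite mxE exprMn.
Qed.

Section core.
Context {R : realType} {d p : nat}.
Variables (K Q : 'rV[R]_d -> R) (B KM K0 : R).
Hypothesis K_ge0 : forall z, 0 <= K z.
Hypothesis K_le : forall z, K z <= KM.
Hypothesis K_supp : forall z, K z != 0 -> box 0 B z.
Hypothesis K0_gt0 : 0 < K0.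
Hypothesis K_ge : forall z, K0 * (enorm z <= 1)%R%:R <= K z.
Variables (I : finType) (pt : I -> 'rV[R]_d) (c e : R).
Hypothesis c_gt0 : 0 < c.
Hypothesis pt_unit : forall a z, box (pt a) e z -> enorm z <= 1.
Hypothesis pt_sep : separating_boxes (p := p) pt c e.
Variables (n : nat) (xs : nat -> 'rV[R]_d) (ys : nat -> R).
Variables (alpha h : R) (x : 'rV[R]_d) (bh bs : {ffun mindex d p -> R}).
Hypothesis n_gt0 : (0 < n)%N.
Hypothesis h_gt0 : 0 < h.
Hypothesis bh_min : forall b : {ffun mindex d p -> R}, lp_criterion K n xs ys alpha h x bh <=
  lp_criterion K n xs ys alpha h x b.

Let z i := h^-1 *: (xs i - x).
Let q i := ys i - Q (xs i).

Definition lp_score (v : mindex d p) : R :=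
  \sum_(i < n) K (z i) * lp_basis (z i) v * quantile_score alpha (q i).

Variables (beta t m c1 c2 c3 : R).
Hypothesis beta_ge0 : 0 <= beta.
Hypothesis bias : forall i : 'I_n, K (z i) != 0 ->
  `|Q (xs i) - lp_value bs (xs i - x)| <= beta.
Hypothesis t_gt0 : 0 < t.
Hypothesis m_gt0 : 0 < m.
Hypothesis beta_t : 2 * beta <= c * t.
Hypothesis count_pos : forall a,
  m * c1 * t <= \sum_(i < n) \1_(cell_pos Q (x + h *: pt a) (h * e) (c * t / 4)) (xs i, ys i).
Hypothesis count_neg : forall a,
  m * c1 * t <= \sum_(i < n) \1_(cell_neg Q (x + h *: pt a) (h * e) (c * t / 4)) (xs i, ys i).
Hypothesis count_abs :
  \sum_(i < n) \1_(cell_abs Q x (h * B) beta) (xs i, ys i) <= m * c2 * beta.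
Hypothesis score_le : forall v, `|lp_score v| <= m * c3 * t.
Hypothesis balance : 2 * #|{: mindex d p}|%:R * c3 * t ^+ 2 + 2 * KM * c2 * beta ^+ 2 <
  K0 * c / 2 * c1 * t ^+ 2.

Let zE i : xs i - x = h *: z i.
Proof. by rewrite /z scalerA mulfV ?gt_eqF// scale1r. Qed.

Lemma lp_score_bound (theta : {ffun mindex d p -> R}) :
  (forall v, `|theta v| <= t) ->
  \sum_(i < n) K (z i) * lp_value theta (z i) * quantile_score alpha (q i) <=
  m * (#|{: mindex d p}|%:R * c3 * t ^+ 2).
Proof.
move=> th.
have -> : \sum_(i < n) K (z i) * lp_value theta (z i) * quantile_score alpha (q i) =
          \sum_v theta v * lp_score v.
  under eq_bigr do rewrite /lp_value mulr_sumr mulr_suml.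
  rewrite exchange_big/=; apply: eq_bigr => v _.
  by rewrite /lp_score mulr_sumr; apply: eq_bigr => i _; ring.
apply: (@le_trans _ _ (\sum_(v : mindex d p) t * (m * c3 * t))).
  apply: ler_sum => v _; rewrite (le_trans (ler_norm _))// normrM.
  by apply: ler_pM.
rewrite sumr_const -mulr_natl; apply: le_of_eq; ring.
Qed.

(** On a box where the polynomial exceeds c t, it still exceeds c t/2 after the bias is
    subtracted, and the observations there with residual in ]0, c t/4] have curvature at
    least c t/2; the other sign is symmetric. *)
Lemma knight_count_lower (theta : {ffun mindex d p -> R}) (v0 : mindex d p) (s : 'I_n -> R) :
  `|theta v0| = t -> (forall v, `|theta v| <= t) ->
  (forall i : 'I_n, K (z i) != 0 -> `|s i| <= beta) ->
  m * (K0 * c / 2 * c1 * t ^+ 2) <=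
  \sum_(i < n) K (z i) * knight (q i) (lp_value theta (z i) + s i).
Proof.
move=> th0 th sb; have [a aP] := pt_sep th0 th.
have KC0 : 0 <= K0 * (c * t / 2).
  by rewrite !mulr_ge0// ltW.
have inbox i : box (x + h *: pt a) (h * e) (xs i) -> box (pt a) e (z i).
  move=> H k; have := H k; rewrite !mxE => {}H.
  rewrite -(ler_pM2l h_gt0) -{1}(gtr0_norm h_gt0) -normrM.
  rewrite (_ : h * _ = xs i 0 k - (x 0 k + h * pt a 0 k))//.
  by rewrite mulrBr mulrA mulfV ?gt_eqF// mul1r opprD addrA.
have Kz i : box (x + h *: pt a) (h * e) (xs i) -> K0 <= K (z i).
  by move=> /inbox/pt_unit E; have := K_ge (z i); rewrite E mulr1.
have fact (i : 'I_n) (w : R) : 0 <= w -> K0 <= K (z i) -> c * t / 2 <= w ->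
    K0 * (c * t / 2) <= K (z i) * w.
  by move=> w0 Ki tw; apply: ler_pM => //; [exact: ltW|rewrite !mulr_ge0// ltW].
have sum_le (A : set ('rV[R]_d * R)) :
    m * c1 * t <= \sum_(i < n) \1_A (xs i, ys i) ->
    (forall i : 'I_n, A (xs i, ys i) ->
      K0 * (c * t / 2) <= K (z i) * knight (q i) (lp_value theta (z i) + s i)) ->
    m * (K0 * c / 2 * c1 * t ^+ 2) <=
      \sum_(i < n) K (z i) * knight (q i) (lp_value theta (z i) + s i).
  move=> cA HA.
  rewrite (_ : m * _ = K0 * (c * t / 2) * (m * c1 * t)); last by field.
  apply: (le_trans (ler_wpM2l KC0 cA)).
  rewrite mulr_sumr; apply: ler_sum => i _; rewrite indicE.
  case: (boolP (_ \in A)) => [/set_mem/HA|_]; first by rewrite mulr1.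
  by rewrite mulr0 mulr_ge0// knight_ge0.
have Kn0 i : K0 <= K (z i) -> K (z i) != 0.
  by move=> h1; rewrite gt_eqF// (lt_le_trans K0_gt0).
case: aP => aP; [apply: (sum_le _ (count_pos a))|apply: (sum_le _ (count_neg a))] =>
    i [/= bi /andP[q1 q2]]; apply: fact => //; try exact: knight_ge0; try exact: Kz.
- have u1 := aP _ (inbox _ bi).
  have := sb i (Kn0 _ (Kz _ bi)); rewrite ler_norml => /andP[s1 s2].
  have us : c * t / 2 <= lp_value theta (z i) + s i.
    by have bt := beta_t; lra.
  apply: (le_trans us); apply: knight_lower_pos => //.
  by move: q2 => /=; rewrite /q; lra.
- have u1 := aP _ (inbox _ bi).
  have := sb i (Kn0 _ (Kz _ bi)); rewrite ler_norml => /andP[s1 s2].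
  have us : lp_value theta (z i) + s i <= - (c * t / 2).
    by have bt := beta_t; lra.
  apply: (@le_trans _ _ (- (lp_value theta (z i) + s i))); first by lra.
  apply: knight_lower_neg => //.
  by move: q1 => /=; rewrite /q; lra.
Qed.

(** The curvature created by the bias vanishes unless the residual is smaller than the
    bias. *)
Lemma knight_count_upper (s : 'I_n -> R) :
  (forall i : 'I_n, K (z i) != 0 -> `|s i| <= beta) ->
  \sum_(i < n) K (z i) * knight (q i) (s i) <= m * (2 * KM * c2 * beta ^+ 2).
Proof.
move=> sb; have KM0 : 0 <= KM by apply: le_trans (K_ge0 0) (K_le 0).
rewrite (_ : m * _ = KM * (2 * beta) * (m * c2 * beta)); last ring.
have KB0 : 0 <= KM * (2 * beta) by rewrite !mulr_ge0.
apply: le_trans _ (ler_wpM2l KB0 count_abs).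
rewrite mulr_sumr; apply: ler_sum => i _.
have [->|Kz] := eqVneq (K (z i)) 0; first by rewrite mul0r mulr_ge0.
rewrite -mulrA; apply: ler_pM => //; first exact: knight_ge0.
apply: le_trans (knight_le _ _) _; rewrite -!mulrA ler_wpM2l//.
have si := sb i Kz.
case: (leP `|q i| `|s i|) => [qs|_] /=; last by rewrite mulr0 mulr_ge0.
rewrite mulr1 indicE mem_set ?mulr1//; split => /=; last exact: le_trans si.
move=> k; have := box0_coord (K_supp Kz) k.
rewrite !mxE normrM (gtr0_norm (_ : 0 < h^-1)) ?invr_gt0//.
by rewrite ler_pdivrMl.
Qed.

(** If the scaled error were larger than t, convexity would give a point of norm
    exactly t at which the criterion is not above its value at bs; there the
    quadratic part of Knight's expansion beats the score and the bias. *)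
Lemma lp_error_bound v : `|h ^+ mi_size (mi_of v) * (bh v - bs v)| <= t.
Proof.
rewrite leNgt; apply/negP => tv.
pose th (w : mindex d p) := h ^+ mi_size (mi_of w) * (bh w - bs w).
have [v0 _ v0max] : exists2 v0, true & forall w, `|th w| <= `|th v0|.
  exists [arg max_(w > v) `|th w|]%O => //.
  by case: arg_maxP => // w _ wmax u; exact: wmax.
pose N := `|th v0|.
have tN : t < N by exact: lt_le_trans tv (v0max v).
have N0 : 0 < N by exact: lt_trans t_gt0 tN.
pose l := t / N.
have l01 : 0 <= l <= 1.
  by rewrite divr_ge0 ?(ltW t_gt0) ?(ltW N0)//= ler_pdivrMr// mul1r ltW.
pose bt : {ffun mindex d p -> R} := [ffun w => (1 - l) * bs w + l * bh w].
pose theta : {ffun mindex d p -> R} := [ffun w => l * th w].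
have btE i : lp_value bt (xs i - x) =
    (1 - l) * lp_value bs (xs i - x) + l * lp_value bh (xs i - x).
  rewrite /lp_value !mulr_sumr -big_split/=; apply: eq_bigr => w _.
  by rewrite !ffunE; ring.
have btE' i : lp_value bt (xs i - x) = lp_value bs (xs i - x) + lp_value theta (z i).
  rewrite /lp_value -big_split/=; apply: eq_bigr => w _.
  by rewrite zE lp_basis_scale [theta w]ffunE [bt w]ffunE /th; ring.
have nh0 : 0 < (n%:R * h ^+ d)^-1.
  by rewrite invr_gt0 mulr_gt0 ?ltr0n// exprn_gt0.
pose S (b : {ffun mindex d p -> R}) := \sum_(i < n) check_loss alpha (ys i - lp_value b (xs i - x)) * K (z i).
have critE (b : {ffun mindex d p -> R}) : lp_criterion K n xs ys alpha h x b = (n%:R * h ^+ d)^-1 * S b by [].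
have Sh : S bh <= S bs by have := bh_min bs; rewrite !critE ler_pM2l.
have St : S bt <= S bs.
  apply: (@le_trans _ _ ((1 - l) * S bs + l * S bh)); last first.
    by have /andP[l0 l1] := l01; have := ler_wpM2l l0 Sh; lra.
  rewrite /S !mulr_sumr -big_split/=; apply: ler_sum => i _.
  rewrite !mulrA -mulrDl ler_wpM2r// btE.
  have := @check_loss_convex _ alpha (ys i - lp_value bs (xs i - x))
    (ys i - lp_value bh (xs i - x)) l l01.
  by apply: le_trans; apply: le_of_eq; congr check_loss; ring.
pose s i := lp_value bs (xs i - x) - Q (xs i).
have sb (i : 'I_n) : K (z i) != 0 -> `|s i| <= beta.
  by move=> Kz; rewrite /s distrC; exact: bias.
have th0 : `|theta v0| = t.
  rewrite ffunE normrM ger0_norm; last by have /andP[] := l01.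
  by rewrite -/N /l divfK ?gt_eqF.
have thle w : `|theta w| <= t.
  rewrite -[leRHS]th0 !ffunE (normrM l (th w)) (normrM l (th v0)) ler_wpM2l//; exact: v0max.
have diff : S bt - S bs =
    - 2 * (\sum_(i < n) K (z i) * lp_value theta (z i) * quantile_score alpha (q i))
    + (\sum_(i < n) K (z i) * knight (q i) (lp_value theta (z i) + s i)
       - \sum_(i < n) K (z i) * knight (q i) (s i)).
  rewrite /S mulr_sumr -!sumrB -big_split/=; apply: eq_bigr => i _.
  rewrite (_ : ys i - lp_value bt _ = q i - (lp_value theta (z i) + s i)); last first.
    by rewrite btE' /q /s; ring.
  rewrite (_ : ys i - lp_value bs _ = q i - s i); last by rewrite /q /s; ring.
  by rewrite !knight_identity; ring.
have b1 := lp_score_bound thle.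
have b2 := knight_count_lower th0 thle sb.
have b3 := knight_count_upper sb.
have b4 := balance; rewrite -(ltr_pM2l m_gt0) in b4.
have : S bt - S bs <= 0 by rewrite subr_le0.
rewrite diff; lra.
Qed.

End core.

(** * The joint law as a mixture of conditional laws *)

Section disintegration.
Local Open Scope ereal_scope.
Context {R : realType} {d : nat} {dT : measure_display} {T : measurableType dT}.
Variables (P : probability T R) (X : {RV P >-> 'rV[R]_d}) (Y : {RV P >-> R}).
Variable kappa : R.-pker 'rV[R]_d ~> R.

(** The mixture of the conditional laws, as a measure on the product: the cells around the
    graph of the quantile function are not rectangles, on which alone the conditional law
    is specified. *)
Definition joint_law (S : set ('rV[R]_d * R)) : \bar R :=
  \int[pushforward P X]_x kappa x (xsection S x).

Let mk (S : set ('rV[R]_d * R)) : measurable S ->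
  measurable_fun setT (fun x => kappa x (xsection S x)).
Proof. by move=> mS; apply: measurable_fun_xsection_finite_kernel; exact: mem_set. Qed.

Let joint_law0 : joint_law set0 = 0.
Proof. by rewrite /joint_law integral0_eq// => x _; rewrite xsection0 measure0. Qed.

Let joint_law_ge0 S : 0 <= joint_law S.
Proof. by rewrite /joint_law; apply: integral_ge0. Qed.

Let joint_law_sigma_additive : semi_sigma_additive joint_law.
Proof.
move=> F mF tF mUF.
have -> : joint_law (\bigcup_n F n) = \sum_(n <oo) joint_law (F n).
  rewrite /joint_law -integral_nneseries//; last by move=> n; exact: mk.
  apply: eq_integral => x _; rewrite xsection_bigcup measure_semi_bigcup//.
  - by move=> n; apply: measurable_xsection; exact: mF.
  - exact: trivIset_xsection.
  - by rewrite -xsection_bigcup; apply: measurable_xsection.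
by apply: is_cvg_ereal_nneg_natsum => n _; exact: joint_law_ge0.
Qed.

HB.instance Definition _ := isMeasure.Build _ _ _ joint_law
  joint_law0 joint_law_ge0 joint_law_sigma_additive.

Let XY w := (X w, Y w).

Let mXY : measurable_fun setT XY.
Proof. exact: measurable_fun_pair. Qed.

(** Both sides are finite measures which agree on rectangles. *)
Lemma joint_lawE : is_cond_law P X Y kappa ->
  forall S, measurable S -> P (XY @^-1` S) = joint_law S.
Proof.
move=> cl S mS.
pose C : set (set ('rV[R]_d * R)) :=
  [set A `*` B | A in measurable & B in measurable].
have CI : setI_closed C.
  move=> _ _ [X1 mX1 [X2 mX2 <-]] [Y1 mY1 [Y2 mY2 <-]].
  exists (X1 `&` Y1); first exact: measurableI.
  by exists (X2 `&` Y2); [exact: measurableI|rewrite setXI].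
have CT : C setT by exists setT => //; exists setT => //; rewrite setXTT.
apply: (measure_unique C (fun=> setT) _ _ _ _ (pushforward P XY) joint_law) => //.
- by rewrite measurable_prod_measurableType.
- by rewrite bigcup_const.
- move=> _ [A mA [B mB <-]]; rewrite /= /pushforward.
  transitivity (P (X @^-1` A `&` Y @^-1` B)); first by congr (P _).
  rewrite (cl A B mA mB) /joint_law integral_mkcond; apply: eq_integral => x _.
  rewrite patchE; case: ifPn => xA; first by rewrite in_xsectionX.
  by rewrite notin_xsectionX// measure0.
- by move=> _; rewrite [X in X < _](_ : _ = 1) ?ltry//; exact: (probability_setT P).
Qed.

End disintegration.

(** * Quantiles of a law with a Lipschitz density *)

Section density_line.
Local Open Scope ereal_scope.
Context {R : realType}.
Variables (mu : {measure set R -> \bar R}) (g : R -> R) (L0 : R).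
Hypothesis mu1 : mu setT = 1.
Hypothesis g_ge0 : forall t, (0 <= g t)%R.
Hypothesis g_lip : forall s t, (`|g s - g t| <= L0 * `|s - t|)%R.
Hypothesis mu_g : forall y,
  mu `]-oo, y]%classic = \int[lebesgue_measure]_(t in `]-oo, y]) (g t)%:E.

Let L0_ge0 : (0 <= L0)%R.
Proof.
have := g_lip 1 0; rewrite subr0 normr1 mulr1; apply: le_trans; exact: normr_ge0.
Qed.

Lemma density_measurable : measurable_fun setT g.
Proof.
apply: continuous_measurable_fun => y; apply/cvgrPdist_le => e e0.
near=> t; apply: le_trans (g_lip _ _) _.
have h : (`|y - t| <= e / (L0 + 1))%R.
  near: t; apply: cvgr_dist_le; first exact: cvg_id.
  by rewrite divr_gt0// ltr_pwDr.
apply: (@le_trans _ _ ((L0 + 1) * (e / (L0 + 1)))%R).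
  by apply: ler_pM => //; rewrite lerDl.
by rewrite mulrC divfK// gt_eqF// ltr_pwDr.
Unshelve. all: by end_near. Qed.

Let itv_setU a b : (a <= b)%R ->
  `]-oo, b]%classic = `]-oo, a]%classic `|` `]a, b]%classic :> set R.
Proof.
move=> ab; apply/seteqP; split => t /=; rewrite !in_itv/=.
  by case: (leP t a) => ta tb; [left|right].
by case=> [ta|/andP[]//]; exact: le_trans ab.
Qed.

Let F_fin y : mu `]-oo, y]%classic \is a fin_num.
Proof.
rewrite ge0_fin_numE//; apply: (@le_lt_trans _ _ (mu setT)).
  by apply: le_measure => //; rewrite inE.
by rewrite mu1 ltry.
Qed.

Lemma measure_itv_density a b : (a <= b)%R ->
  mu `]a, b]%classic = \int[lebesgue_measure]_(t in `]a, b]) (g t)%:E.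
Proof.
move=> ab.
have mg : measurable_fun setT (fun t => (g t)%:E).
  by apply/measurable_EFinP; exact: density_measurable.
have U := itv_setU ab.
have D0 : `]-oo, a]%classic `&` `]a, b]%classic = set0 :> set R.
  apply/seteqP; split => // t [] /=; rewrite !in_itv/= => ta /andP[].
  by rewrite ltNge ta.
have D : [disjoint `]-oo, a]%classic & `]a, b]%classic : set R].
  exact/disj_set2P.
have E1 : mu `]-oo, b]%classic = mu `]-oo, a]%classic + mu `]a, b]%classic.
  by rewrite U measureU.
have E2 : mu `]-oo, b]%classic = mu `]-oo, a]%classic +
    \int[lebesgue_measure]_(t in `]a, b]) (g t)%:E.
  rewrite !mu_g U ge0_integral_setU//.
  - exact: measurable_funTS.
  - by move=> t _; rewrite lee_fin.
by rewrite -[LHS](addeK _ (F_fin a)) [X in X - _]addeC -E1 E2 [X in X - _]addeC addeK.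
Qed.

Lemma measure_itv_le a b (M : R) : (a <= b)%R ->
  (forall t, (a <= t <= b)%R -> (g t <= M)%R) ->
  mu `]a, b]%classic <= (M * (b - a))%:E.
Proof.
move=> ab gM; rewrite measure_itv_density//.
apply: (@le_trans _ _ (\int[lebesgue_measure]_(t in `]a, b]) (cst M%:E t))).
  apply: nonneg_integral_le => t /=; rewrite lee_fin// in_itv/= => /andP[ta tb].
  by rewrite gM// (ltW ta).
by rewrite integral_cst// [X in _ * X]lebesgue_measure_itv/= lte_fin; case: ltP => h;
  rewrite ?EFinM// mule0 lee_fin (_ : b - a = 0)%R ?mulr0//; lra.
Qed.

Lemma measure_itv_ge a b (M : R) : (a <= b)%R -> (0 <= M)%R ->
  (forall t, (a <= t <= b)%R -> (M <= g t)%R) ->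
  (M * (b - a))%:E <= mu `]a, b]%classic.
Proof.
move=> ab M0 gM; rewrite measure_itv_density//.
apply: (@le_trans _ _ (\int[lebesgue_measure]_(t in `]a, b]) (cst M%:E t))); last first.
  apply: nonneg_integral_le => t /=; rewrite lee_fin// in_itv/= => /andP[ta tb].
  by rewrite gM// (ltW ta).
by rewrite integral_cst// [X in _ * X]lebesgue_measure_itv/= lte_fin; case: ltP => h;
  rewrite ?EFinM// mule0 lee_fin (_ : b - a = 0)%R ?mulr0//; lra.
Qed.

Let F y : R := fine (mu `]-oo, y]%classic).

Let F_nd : {homo F : x y / (x <= y)%R}.
Proof.
move=> x y xy; rewrite fine_le//; apply: le_measure; rewrite ?inE//.
by move=> t /=; rewrite !in_itv/= => /le_trans; exact.
Qed.

Let F_diff a b : (a <= b)%R -> (b <= a + 1)%R ->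
  (F b <= F a + (g a + L0) * (b - a))%R.
Proof.
move=> ab ba.
have U := itv_setU ab.
rewrite -lee_fin EFinD /F !fineK// U.
apply: (le_trans (measureU2 _ _ _)) => //; apply: leeD2l; apply: measure_itv_le => // t /andP[ta tb].
have := g_lip t a; rewrite ler_norml => /andP[_ h].
have : (L0 * `|t - a| <= L0 * 1)%R by rewrite ler_wpM2l// ger0_norm; lra.
by have := L0_ge0; lra.
Qed.

(** A law with a locally bounded density has a continuous distribution function, which
    therefore takes the value a at the infimum defining the quantile. *)
Lemma cdf_quantile (a : R) : (0 < a < 1)%R ->
  mu `]-oo, (inf [set y | a <= F y]%R)]%classic = a%:E.
Proof.
move=> /andP[a0 a1]; set S := [set y | (a <= F y)%R].
have S0 : S !=set0.
  have cvg1 : (mu \o (fun n : nat => `]-oo, n%:R]%classic : set R)) n @[n --> \oo] --> mu setT.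
    have -> : setT = \bigcup_(n : nat) (`]-oo, n%:R]%classic : set R).
      apply/seteqP; split => // t _; exists (Num.truncn `|t|).+1 => //=.
      by rewrite in_itv/= (le_trans (ler_norm _))// ltW// truncnS_gt.
    apply: nondecreasing_cvg_mu => //; first exact: bigcup_measurable.
    move=> m n mn; apply/subsetPset => t /=; rewrite !in_itv/= => /le_trans; apply.
    by rewrite ler_nat.
  rewrite mu1 in cvg1.
  have : \forall n \near \oo, a%:E < mu (`]-oo, n%:R]%classic : set R).
    by apply: (cvg1 _ (open_ereal_gt' _)); rewrite lte_fin.
  by move=> [n _ /(_ n (leqnn n))] h; exists n%:R; rewrite /S/= -lee_fin /F fineK// ltW.
have Slb : has_lbound S.
  have cvg0 : (mu \o (fun n : nat => `]-oo, (- n%:R)%R]%classic : set R)) n @[n --> \oo] --> mu set0.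
    have -> : set0 = \bigcap_(n : nat) (`]-oo, (- n%:R)%R]%classic : set R).
      apply/seteqP; split => // t /(_ (Num.truncn `|t|).+1 I) /=.
      rewrite in_itv/= lerNr leNgt => /negP; apply.
      by rewrite (le_lt_trans (ler_norm _))// normrN truncnS_gt.
    apply: nonincreasing_cvg_mu => //.
    - apply: (@le_lt_trans _ _ (mu setT)); last by rewrite mu1 ltry.
      by apply: le_measure => //; rewrite inE.
    - exact: bigcap_measurable.
    - move=> m n mn; apply/subsetPset => t /=; rewrite !in_itv/= => /le_trans; apply.
      by rewrite lerN2 ler_nat.
  rewrite measure0 in cvg0.
  have : \forall n \near \oo, mu (`]-oo, (- n%:R)%R]%classic : set R) < a%:E.
    by apply: (cvg0 _ (open_ereal_lt' _)); rewrite lte_fin.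
  move=> [n _ /(_ n (leqnn n))] h; exists (- n%:R)%R => y; rewrite /S/= => ay.
  rewrite leNgt; apply/negP => yn; move: ay; apply/negP; rewrite -ltNge.
  by apply: le_lt_trans (F_nd (ltW yn)) _; rewrite -lte_fin /F fineK.
have Sinf : has_inf S by split.
set q := inf S.
suff Fq : (F q = a)%R by rewrite -Fq /F fineK.
pose D := (g q + L0 * 2 + 1)%R.
have D0 : (0 < D)%R by rewrite ltr_pwDr// addr_ge0// mulr_ge0.
have step u v : (q - 1 <= u <= q + 1)%R -> (u <= v)%R -> (v <= u + 1)%R ->
    (F v <= F u + D * (v - u))%R.
  move=> /andP[qu uq] uv vu; apply: le_trans (F_diff uv vu) _.
  rewrite lerD2l ler_wpM2r ?subr_ge0//.
  have := g_lip u q; rewrite ler_norml => /andP[_ h1].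
  have : (L0 * `|u - q| <= L0 * 1)%R.
    by rewrite ler_wpM2l// ler_norml; apply/andP; split; lra.
  by rewrite /D; lra.
have small e : (0 < e)%R -> exists r, [/\ (0 < r)%R, (r <= 1)%R & (D * r <= e)%R].
  move=> e0; exists (Num.min 1 (e / D))%R; split.
  - by rewrite lt_min ltr01 divr_gt0.
  - by rewrite ge_min lexx.
  - by rewrite mulrC -ler_pdivlMr// ge_min lexx orbT.
apply/eqP; rewrite eq_le; apply/andP; split; apply/ler_addgt0Pr => e /small[r [r0 r1 rD]].
- have Fqr : (F (q - r) < a)%R.
    rewrite ltNge; apply/negP => h.
    have : (q <= q - r)%R by apply: ge_inf.
    lra.
  have : (F q <= F (q - r) + D * (q - (q - r)))%R.
    by apply: step; [apply/andP; split|..]; lra.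
  by rewrite (_ : q - (q - r) = r)%R; lra.
- have [y Sy yq] := inf_adherent r0 Sinf; rewrite -/q in yq.
  have qy : (q <= y)%R by apply: ge_inf.
  have : (F y <= F q + D * (y - q))%R.
    by apply: step; [apply/andP; split|..]; lra.
  have : (D * (y - q) <= D * r)%R by rewrite ler_wpM2l ?(ltW D0)//; lra.
  by move: Sy; rewrite /S/= => Sy; lra.
Qed.

End density_line.

(** * Local bounds for the law of the observations *)

Lemma compact_pos_bounds (R : realType) (V : topologicalType) (A : set V) (f : V -> R) :
  compact A -> {within A, continuous f} -> (forall x, A x -> 0 < f x) ->
  exists lo hi : R, [/\ 0 < lo, 0 < hi & forall x, A x -> lo <= f x <= hi].
Proof.
move=> cA cf f0; have [A0|A0] := pselect (A !=set0); last first.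
  by exists 1, 1; split => // x Ax; exfalso; apply: A0; exists x.
have [a aA amin] := compact_EVT_min A0 cA cf.
have [b bA bmax] := compact_EVT_max A0 cA cf.
exists (f a), (f b); split.
- by apply: f0; exact: set_mem.
- by apply: f0; exact: set_mem.
- by move=> x Ax; rewrite amin ?bmax//; exact: mem_set.
Qed.

Lemma compact_abs_bound (R : realType) (V : topologicalType) (A : set V) (f : V -> R) :
  compact A -> {within A, continuous f} ->
  exists2 B : R, 0 < B & forall x, A x -> `|f x| <= B.
Proof.
move=> cA cf; have [A0|A0] := pselect (A !=set0); last first.
  by exists 1 => // x Ax; exfalso; apply: A0; exists x.
have [a aA amin] := compact_EVT_min A0 cA cf.
have [b bA bmax] := compact_EVT_max A0 cA cf.
exists (`|f a| + `|f b| + 1); first by rewrite ltr_wpDl.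
move=> x Ax; have h1 := amin x (mem_set Ax); have h2 := bmax x (mem_set Ax).
have h3 := ler_norm (- f a); have h4 := ler_norm (f b); rewrite normrN in h3.
have h5 := normr_ge0 (f a); have h6 := normr_ge0 (f b).
by rewrite ler_norml; apply/andP; split; lra.
Qed.

Lemma msupport_closed (R : realType) d (mu : set 'rV[R]_d -> \bar R) :
  closed (msupport mu).
Proof.
rewrite closedE => x H U oU Ux; apply: contrapT => nU; apply: H.
have : nbhs x U by exact: open_nbhs_nbhs.
by apply: filterS => y Uy /(_ U oU Uy).
Qed.

Section joint_law_bounds.
Local Open Scope ereal_scope.
Context {R : realType} {d : nat} {dT : measure_display} {T : measurableType dT}.
Variables (P : probability T R) (X : {RV P >-> 'rV[R]_d}).
Variable kappa : R.-pker 'rV[R]_d ~> R.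
Let PX := distribution P X.

Let mk (S : set ('rV[R]_d * R)) : measurable S ->
  measurable_fun setT (fun x => kappa x (xsection S x)).
Proof. by move=> mS; apply: measurable_fun_xsection_finite_kernel; exact: mem_set. Qed.

Lemma joint_law_ge S (A : set 'rV[R]_d) (a : R) : measurable S -> measurable A ->
  (0 <= a)%R -> (forall x, A x -> a%:E <= kappa x (xsection S x)) ->
  a%:E * PX A <= joint_law X kappa S.
Proof.
move=> mS mA a0 aS.
apply: (@le_trans _ _ (\int[PX]_(x in A) kappa x (xsection S x))).
  rewrite -(integral_cst PX mA); apply: ge0_le_integral => //.
  by apply: measurable_funTS; exact: mk.
by rewrite /joint_law; apply: ge0_subset_integral => //; exact: mk.
Qed.

Lemma joint_law_le S (A : set 'rV[R]_d) (a : R) : measurable S -> measurable A ->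
  (forall u, S u -> A u.1) -> (forall x, A x -> kappa x (xsection S x) <= a%:E) ->
  joint_law X kappa S <= a%:E * PX A.
Proof.
move=> mS mA SA aS.
apply: (@le_trans _ _ (\int[PX]_(x in A) kappa x (xsection S x))); last first.
  rewrite -(integral_cst PX mA); apply: ge0_le_integral => //.
  by apply: measurable_funTS; exact: mk.
rewrite /joint_law [leRHS]integral_mkcond.
rewrite (_ : _ \_ A = (fun x => kappa x (xsection S x)))//.
apply/funext => x; rewrite patchE; case: ifPn => // xA.
rewrite (_ : xsection S x = set0) ?measure0//.
apply/seteqP; split => // y /xsectionP /SA /= Ax.
by move: xA; rewrite notin_setE.
Qed.

End joint_law_bounds.

Section model.
Context {R : realType} {d : nat} {dT : measure_display} {T : measurableType dT}.
Variables (P : probability T R) (X : {RV P >-> 'rV[R]_d}) (Y : {RV P >-> R}).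
Variable kappa : R.-pker 'rV[R]_d ~> R.
Variables (alpha : R) (X0 : set 'rV[R]_d).
Let supp := msupport (distribution P X).
Let Q := cquantile kappa alpha.
Hypothesis alpha01 : 0 < alpha < 1.
Hypothesis XYcond : is_cond_law P X Y kappa.
Hypothesis aX : assumption_X (distribution P X) X0.
Hypothesis aF : assumption_F kappa supp.
Hypothesis cQ : {within supp, continuous Q}.

Let XY w := (X w, Y w).

Lemma supp_measurable : measurable supp.
Proof. by apply: closed_measurable_rV; exact: msupport_closed. Qed.

Lemma cell_measurable (q : 'rV[R]_d -> R) y r (J : set R) :
  measurable_fun setT q -> measurable J ->
  measurable [set u : 'rV[R]_d * R | box y r u.1 /\ J (u.2 - q u.1)].
Proof.
move=> mq mJ.
rewrite (_ : [set u | _] = fst @^-1` box y r `&` (fun u => u.2 - q u.1) @^-1` J)//.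
apply: measurableI.
  by rewrite -[X in measurable X]setTI; apply: measurable_fst => //; exact: measurable_box.
rewrite -[X in measurable X]setTI; apply: measurable_funB => //.
exact: measurableT_comp.
Qed.

(** The estimation argument sees the law of (X, Y) only through these bounds, which come
    from integrating the conditional law over the cells: on compact sets the densities of X
    and of Y given X are bounded away from zero and infinity.  The quantile function is
    replaced by q, extended by zero outside the support, to have a measurable function on
    the whole space. *)
Lemma conditional_law_facts : exists (q : 'rV[R]_d -> R) (cl cu : R),
  [/\ 0 < cl /\ 0 < cu, measurable_fun setT q, (forall x, supp x -> q x = Q x),
     (forall A, measurable A -> A `<=` supp ->
       P (X @^-1` A `&` [set w | Y w <= q (X w)]) = (alpha%:E * P (X @^-1` A))%E) &
     cell_law_bounds q P X Y supp cl cu].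
Proof.
have [csupp [f [mf f0 fE fpos [G [Gf Gc _]]]] _ _] := aX.
have msupp := supp_measurable.
have cf : {within supp, continuous f}.
  have := Gc mi0; rewrite (eqP (_ : mi_size mi0 == 0%N)) ?mi_size_eq0// => /(_ isT).
  by apply: subspace_eq_continuous => x /set_mem; exact: Gf.
have [fl [fu [fl0 fu0 fb]]] := compact_pos_bounds csupp cf fpos.
have [g [gF cg gpos _ [L0 L00 gL]]] := aF.
have [B B0 QB] := compact_abs_bound csupp cQ.
have [gl [gu [gl0 gu0 gb]]] : exists lo hi : R, [/\ 0 < lo, 0 < hi &
    forall u, (`[- (B + 2), B + 2]%classic `*` supp) u -> lo <= g u.1 u.2 <= hi].
  apply: compact_pos_bounds.
  - by apply: compact_setX => //; exact: segment_compact.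
  - by apply: continuous_subspaceW cg => u [].
  - by move=> u [_]; exact: gpos.
have k1 x : kappa x setT = 1%E by exact: prob_kernel.
have kg x : supp x -> forall y, kappa x `]-oo, y]%classic =
    (\int[lebesgue_measure]_(t in `]-oo, y]) (g t x)%:E)%E.
  move=> sx y; rewrite -gF// /ccdf fineK//.
  rewrite ge0_fin_numE//; apply: (@le_lt_trans _ _ (kappa x setT)).
    by apply: le_measure => //; rewrite inE.
  by rewrite k1 ltry.
have glip x : supp x -> forall s t, `|g s x - g t x| <= L0 * `|s - t|.
  move=> sx s t; have := gL x x s t sx sx; rewrite subrr /enorm_pair.
  rewrite (_ : enorm 0 = 0) ?expr0n ?add0r ?sqrtr_sqr//.
  by rewrite /enorm big1 ?sqrtr0// => i _; rewrite mxE expr0n.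
have gge x : supp x -> forall t, 0 <= g t x by move=> sx t; exact: ltW (gpos t x sx).
have kQ x : supp x -> kappa x `]-oo, Q x]%classic = alpha%:E.
  by move=> sx; exact: (cdf_quantile (k1 x) (gge x sx) (glip x sx) (kg x sx) alpha01).
have near x (a b t : R) : supp x -> - 2 <= a -> b <= 2 -> Q x + a <= t <= Q x + b ->
    gl <= g t x <= gu.
  move=> sx a2 b2 /andP[t1 t2]; apply: (gb (t, x)); split => //=.
  have := QB x sx; rewrite in_itv/= ler_norml => /andP[q1 q2].
  by apply/andP; split; lra.
have kup x (a b : R) : supp x -> - 2 <= a -> a <= b -> b <= 2 ->
    (kappa x `](Q x + a)%R, (Q x + b)%R]%classic <= (gu * (b - a))%:E)%E.
  move=> sx a2 ab b2.
  have ab' : Q x + a <= Q x + b by rewrite lerD2l.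
  have := measure_itv_le (k1 x) (gge x sx) (glip x sx) (kg x sx) ab' (M := gu).
  rewrite (_ : Q x + b - (Q x + a) = b - a); last lra.
  by apply => t /(near _ _ _ _ sx a2 b2)/andP[].
have klo x (a b : R) : supp x -> - 2 <= a -> a <= b -> b <= 2 ->
    ((gl * (b - a))%:E <= kappa x `](Q x + a)%R, (Q x + b)%R]%classic)%E.
  move=> sx a2 ab b2.
  have ab' : Q x + a <= Q x + b by rewrite lerD2l.
  have := measure_itv_ge (k1 x) (gge x sx) (glip x sx) (kg x sx) ab' (ltW gl0).
  rewrite (_ : Q x + b - (Q x + a) = b - a); last lra.
  by apply => t /(near _ _ _ _ sx a2 b2)/andP[].
pose q := Q \_ supp.
have qE x : supp x -> q x = Q x by move=> sx; rewrite /q patchE mem_set.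
have mq : measurable_fun setT q.
  apply/(measurable_restrictT _ msupp).
  by apply: within_continuous_measurable_rV cQ; exact: msupport_closed.
have PXb y r : 0 < r -> box y r `<=` supp ->
    ((fl * (2 * r) ^+ d)%:E <= distribution P X (box y r) <= (fu * (2 * r) ^+ d)%:E)%E.
  move=> r0 ys; have mb := measurable_box y r.
  rewrite fE// !EFinM -(leb_box y (ltW r0)) -!integral_cst//.
  apply/andP; split; apply: nonneg_integral_le => x yx; rewrite /= lee_fin ?(ltW fl0)//;
    by have /andP[] := fb x (ys x yx).
pose D2 : R := 2 ^+ d.
have D20 : 0 < D2 by rewrite exprn_gt0.
have rE r : (2 * r) ^+ d = D2 * r ^+ d by rewrite exprMn.
have cell_sec (J : set R) y r x : box y r x ->
    xsection [set u : 'rV[R]_d * R | box y r u.1 /\ J (u.2 - q u.1)] x =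
    [set v | J (v - q x)].
  by move=> yx; apply/seteqP; split => v; rewrite /xsection/= inE/=; [case|].
have lowcell a b y r : 0 < r -> box y r `<=` supp -> - 2 <= a -> a <= b -> b <= 2 ->
    ((fl * gl * D2 * r ^+ d * (b - a))%:E <=
     P (XY @^-1` [set u | box y r u.1 /\ `]a, b]%classic (u.2 - q u.1)%R]))%E.
  move=> r0 ys a2 ab b2; have mS := cell_measurable y r mq (measurable_itv `]a, b]).
  have gab : 0 <= gl * (b - a) by rewrite mulr_ge0 ?subr_ge0// ltW.
  rewrite [leRHS](joint_lawE XYcond)//.
  apply: (le_trans _ (@joint_law_ge _ _ _ _ P X kappa _ (box y r) _ mS _ gab _)) => //.
  - rewrite (_ : _ * (b - a) = gl * (b - a) * (fl * (2 * r) ^+ d)); last by rewrite rE; ring.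
    rewrite EFinM lee_wpmul2l ?lee_fin//; have /andP[+ _] := PXb _ _ r0 ys; exact.
  - exact: measurable_box.
  move=> x yx; rewrite cell_sec//; apply: le_trans (klo _ _ _ (ys _ yx) a2 ab b2) _.
  apply: le_of_eq; congr (kappa x _); apply/seteqP; split => v /=;
    rewrite !in_itv/= (qE _ (ys _ yx)) => /andP[h1 h2]; apply/andP; split; lra.
exists q, (fl * gl * D2), (fu * (1 + 3 * gu) * D2); split => //.
- split; first by rewrite !mulr_gt0.
  by rewrite !mulr_gt0// ltr_wpDr// mulr_ge0// ltW.
- move=> A mA As.
  have mS : measurable [set u : 'rV[R]_d * R | A u.1 /\ u.2 <= q u.1].
    rewrite (_ : [set u | _] = fst @^-1` A `&` [set u | u.2 <= q u.1])//.
    apply: measurableI.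
      by rewrite -[X in measurable X]setTI; exact: measurable_fst.
    rewrite -[X in measurable X]setTI; apply: measurable_fun_le => //.
    exact: measurableT_comp.
  transitivity (joint_law X kappa [set u | A u.1 /\ u.2 <= q u.1]).
    by rewrite -(joint_lawE XYcond).
  have sec x : A x -> xsection [set u : 'rV[R]_d * R | A u.1 /\ u.2 <= q u.1] x =
      `]-oo, Q x]%classic.
    move=> Ax; apply/seteqP; split => v; rewrite /xsection/= inE/= in_itv/= (qE _ (As _ Ax)); last by [].
    by case.
  apply/eqP; rewrite eq_le; apply/andP; split.
  + apply: joint_law_le => //; first by move=> u [].
    by move=> x Ax; rewrite sec// kQ//; exact: As.
  + apply: joint_law_ge => //; first by case/andP: alpha01 => /ltW.
    by move=> x Ax; rewrite sec// kQ//; exact: As.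
- move=> y r r0 ys; have mb := measurable_box y r; split.
  + have /andP[_ /le_trans] := PXb _ _ r0 ys; apply; rewrite rE lee_fin mulrA.
    rewrite ler_wpM2r ?exprn_ge0 ?(ltW r0)// ler_wpM2r ?(ltW D20)//.
    by rewrite ler_peMr ?(ltW fu0)// lerDl mulr_ge0// ltW.
  + move=> t t0 t1; have t2 : t <= 2 by lra.
    have tN : - 2 <= - t by lra.
    rewrite cell_posE cell_negE; split.
      by have := @lowcell 0 t y r r0 ys _ (ltW t0) t2; rewrite subr0; apply; rewrite oppr_le0.
    by have := @lowcell (- t) 0 y r r0 ys tN; rewrite sub0r opprK; apply; rewrite ?oppr_le0 ?(ltW t0).
  + move=> t t0 t1; have t2 : t <= 2 by lra.
    rewrite cell_absE.
    rewrite [leLHS](joint_lawE XYcond); last exact: cell_measurable.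
    apply: le_trans (@joint_law_le _ _ _ _ P X kappa _ (box y r) (gu * (3 * t)) _ _ _ _) _ => //.
    * exact: cell_measurable.
    * by move=> u [].
    * move=> x yx; rewrite cell_sec//.
      have := @kup x (- (2 * t)) t (ys _ yx); rewrite (_ : t - - (2 * t) = 3 * t); last ring.
      have h1 : - 2 <= - (2 * t) by lra.
      have h2 : - (2 * t) <= t by lra.
      move=> h; apply: (le_trans _ (h h1 h2 t2)).
      apply: le_measure; rewrite ?inE//.
        rewrite (_ : [set v | _] = `[(q x - t), (q x + t)]%classic)//.
        by apply/seteqP; split => v /=; rewrite !in_itv/= => /andP[g1 g2];
          apply/andP; split; lra.
      move=> v /=; rewrite !in_itv/= (qE _ (ys _ yx)) => /andP[g1 g2].
      by apply/andP; split; lra.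
    * apply: (@le_trans _ _ ((gu * (3 * t))%:E * (fu * (2 * r) ^+ d)%:E)%E).
        rewrite lee_wpmul2l//; last by have /andP[] := PXb _ _ r0 ys.
        by rewrite lee_fin !mulr_ge0// ltW.
      rewrite -EFinM lee_fin rE.
      rewrite (_ : fu * (1 + 3 * gu) * D2 * r ^+ d * t =
        gu * (3 * t) * (fu * (D2 * r ^+ d)) + fu * D2 * r ^+ d * t); last ring.
      by rewrite lerDl !mulr_ge0// ?exprn_ge0// ltW.
Qed.

End model.

(** * Exponential moments of a centered score *)

(** The variable a - 1_A takes the values a - 1 and a and has mean zero, so the terms of
    first order cancel. *)
Lemma two_point_mgf (R : realType) (a y : R) : 0 <= a <= 1 -> `|y| <= 2^-1 ->
  a * expR (y * (a - 1)) + (1 - a) * expR (y * a) <= 1 + 2 * y ^+ 2.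
Proof.
move=> /andP[a0 a1] y2.
have bnd t : `|t| <= 1 -> y * t <= 2^-1.
  move=> t1; apply: le_trans (ler_norm _) _; rewrite normrM.
  by rewrite -[leRHS]mulr1; apply: ler_pM.
have h1 : expR (y * (a - 1)) <= 1 + y * (a - 1) + 2 * (y * (a - 1)) ^+ 2.
  by apply: expR_le_quadratic; apply: bnd; rewrite ler_norml; apply/andP; split; lra.
have h2 : expR (y * a) <= 1 + y * a + 2 * (y * a) ^+ 2.
  by apply: expR_le_quadratic; apply: bnd; rewrite ger0_norm.
have b0 : 0 <= 1 - a by rewrite subr_ge0.
apply: le_trans (lerD (ler_wpM2l a0 h1) (ler_wpM2l b0 h2)) _.
have -> : a * (1 + y * (a - 1) + 2 * (y * (a - 1)) ^+ 2) +
   (1 - a) * (1 + y * a + 2 * (y * a) ^+ 2) = 1 + 2 * y ^+ 2 * (a * (1 - a)) by ring.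
have y0 : 0 <= 2 * y ^+ 2 by rewrite mulr_ge0// sqr_ge0.
have h3 : a * (1 - a) <= 1 * 1 by apply: ler_pM => //; lra.
by rewrite lerD2l -[leRHS]mulr1 ler_wpM2l// -[leRHS]mulr1.
Qed.

Section score_mgf.
Local Open Scope ereal_scope.
Context {R : realType} d1 d2 (T : measurableType d1) (U : measurableType d2).
Variables (P : probability T R) (X : T -> U).
Hypothesis mX : measurable_fun setT X.
Variables (D : set U) (A : set T) (a : R).
Hypothesis mD : measurable D.
Hypothesis mA : measurable A.
Hypothesis a01 : (0 <= a <= 1)%R.
Hypothesis PA : forall B, measurable B -> B `<=` D ->
  P (X @^-1` B `&` A) = a%:E * P (X @^-1` B).

(** The score is centered given X on D, so that only the second moment remains. *)
Lemma score_mgf (Phi : U -> R) (b p : R) :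
  measurable_fun setT Phi -> (forall u, ~ D u -> Phi u = 0%R) ->
  (forall u, `|Phi u| <= b)%R -> (b <= 2^-1)%R -> P (X @^-1` D) <= p%:E ->
  \int[P]_w (expR (Phi (X w) * (a - \1_A w)))%:E <= (expR (2 * b ^+ 2 * p))%:E.
Proof.
move=> mPhi Phi0 Phib b2 PD; have /andP[a0 a1] := a01.
have mXD := measurable_preimage mX mD.
have mXDc : measurable (~` (X @^-1` D)) by exact: measurableC.
have mAc : measurable (~` A) by exact: measurableC.
have b0 : (0 <= b)%R by exact: le_trans (normr_ge0 _) (Phib (X point)).
have PAc B : measurable B -> B `<=` D ->
    P (X @^-1` B `&` ~` A) = (1 - a)%:E * P (X @^-1` B).
  move=> mB BD; have mXB := measurable_preimage mX mB.
  have fB : P (X @^-1` B) \is a fin_num by exact: fin_num_measure.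
  rewrite -setDE measureD//; last by rewrite -ge0_fin_numE.
  have PE : P (X @^-1` B) = (fine (P (X @^-1` B)))%:E by rewrite fineK.
  rewrite [X in _ - X](_ : _ = a%:E * (fine (P (X @^-1` B)))%:E); last by rewrite -PE -PA.
  rewrite [X in X - _](_ : _ = (fine (P (X @^-1` B)))%:E)// [RHS](_ : _ =
    (1 - a)%:E * (fine (P (X @^-1` B)))%:E); last by rewrite -PE.
  by rewrite -!EFinM -EFinB mulrBl mul1r.
have me (c : R) : measurable_fun setT (fun u => expR (Phi u * c)).
  by apply: measurableT_comp => //; exact: measurable_funM.
have mI (S : set T) : measurable S -> measurable_fun setT (\1_S : T -> R).
  by move=> mS; exact: measurable_indic.
have W1 : \int[P]_(w in X @^-1` D) (expR (Phi (X w) * (a - 1)) * \1_A w)%:E =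
    a%:E * \int[P]_(w in X @^-1` D) (expR (Phi (X w) * (a - 1)))%:E.
  apply: (integral_weight mX (mI _ mA) _ a0 mD _ (me _)) => //.
  move=> B mB BD; rewrite -PA// setIC.
  by rewrite integral_indic//; exact: measurable_preimage.
have a10 : (0 <= 1 - a)%R by rewrite subr_ge0.
have W2 : \int[P]_(w in X @^-1` D) (expR (Phi (X w) * a) * \1_(~` A) w)%:E =
    (1 - a)%:E * \int[P]_(w in X @^-1` D) (expR (Phi (X w) * a))%:E.
  apply: (integral_weight mX (mI _ mAc) _ a10 mD _ (me _)) => //.
  move=> B mB BD; rewrite -PAc// setIC.
  by rewrite integral_indic//; exact: measurable_preimage.
have meX (c : R) : measurable_fun setT (fun w => expR (Phi (X w) * c)).
  exact: (measurableT_comp (me c)).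
have mE (S : set T) (f : T -> R) : measurable_fun setT f ->
    measurable_fun S (fun w => (f w)%:E).
  by move=> mf; apply/measurable_EFinP; exact: measurable_funTS.
have mall : measurable_fun setT (fun w => expR (Phi (X w) * (a - \1_A w))).
  apply: measurableT_comp => //; apply: measurable_funM; first exact: measurableT_comp.
  by apply: measurable_funB => //; exact: mI.
have onD : \int[P]_(w in X @^-1` D) (expR (Phi (X w) * (a - \1_A w)))%:E <=
    (1 + 2 * b ^+ 2)%:E * P (X @^-1` D).
  have -> : \int[P]_(w in X @^-1` D) (expR (Phi (X w) * (a - \1_A w)))%:E =
      \int[P]_(w in X @^-1` D) ((expR (Phi (X w) * (a - 1)) * \1_A w)%:E +
         (expR (Phi (X w) * a) * \1_(~` A) w)%:E).
    apply: eq_integral => w _; rewrite -EFinD !indicE in_setC; congr (_ %:E).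
    by case: (w \in A) => /=; rewrite ?mulr1 ?mulr0 ?addr0 ?add0r ?subr0.
  have pos (c : R) (S : set T) w : 0 <= (expR (Phi (X w) * c) * \1_S w)%:E.
    by rewrite lee_fin mulr_ge0// expR_ge0.
  rewrite ge0_integralD//; last 2 first.
  - by apply: mE; apply: measurable_funM => //; exact: mI.
  - by apply: mE; apply: measurable_funM => //; exact: mI.
  have e0 (c : R) w : 0 <= (expR (Phi (X w) * c))%:E by rewrite lee_fin expR_ge0.
  rewrite W1 W2 -!ge0_integralZl//; [|exact: mE..].
  rewrite -ge0_integralD//; first last.
  - by apply: measurable_funeM; exact: mE.
  - by move=> w _; rewrite mule_ge0// lee_fin.
  - by apply: measurable_funeM; exact: mE.
  - by move=> w _; rewrite mule_ge0// lee_fin.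
  rewrite -integral_cst//; apply: nonneg_integral_le => w _.
    by rewrite -!EFinM -EFinD lee_fin addr_ge0// mulr_ge0// expR_ge0.
  rewrite -!EFinM -EFinD lee_fin.
  apply: le_trans (two_point_mgf a01 (le_trans (Phib _) b2)) _.
  rewrite lerD2l ler_wpM2l// -real_normK ?num_real// lerXn2r ?nnegrE//.
have offD : \int[P]_(w in ~` (X @^-1` D)) (expR (Phi (X w) * (a - \1_A w)))%:E =
    P (~` (X @^-1` D)).
  rewrite -[RHS]mul1e -integral_cst//; apply: eq_integral => w.
  by rewrite inE/= => /Phi0 ->; rewrite mul0r expR0.
rewrite -(setvU (X @^-1` D)) ge0_integral_setU//; last 2 first.
- exact: mE.
- by apply/disj_set2P; rewrite setICl.
rewrite offD.
have fD : P (X @^-1` D) \is a fin_num by exact: fin_num_measure.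
apply: le_trans (leeD2l _ onD) _.
rewrite [X in X + _](_ : _ = 1 - P (X @^-1` D)); last exact: probability_setC.
have PE : P (X @^-1` D) = (fine (P (X @^-1` D)))%:E by rewrite fineK.
rewrite [X in 1 - X](_ : _ = (fine (P (X @^-1` D)))%:E)//.
rewrite [X in _ + X](_ : _ = ((1 + 2 * b ^+ 2) * fine (P (X @^-1` D)))%:E); last first.
  by rewrite EFinM -PE.
rewrite -EFinB -EFinD lee_fin.
have pD : (fine (P (X @^-1` D)) <= p)%R by rewrite -lee_fin fineK.
apply: le_trans (expR_ge1Dx _).
have := ler_wpM2l (mulr_ge0 (ler0n R 2) (sqr_ge0 b)) pD; lra.
Qed.

End score_mgf.

(** * Uniform bounds for the counts *)

(** One point of A is chosen in each grid cell that meets A, so that the net stays inside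
    A. *)
Lemma net_exists (R : realType) d (A : set 'rV[R]_d) (B e : R) : 0 < B -> 0 < e ->
  A `<=` box 0 B -> exists (J : finType) (g : J -> 'rV[R]_d),
  [/\ #|J|%:R <= (2 * B / e + 1) ^+ d, forall j, A (g j) &
      forall x, A x -> exists j, box (g j) e x].
Proof.
move=> B0 e0 AB; have [[x0 Ax0]|A0] := pselect (A !=set0); last first.
  exists void, (fun j : void => match j with end); split => //.
    by rewrite card_void exprn_ge0// addr_ge0// divr_ge0 ?mulr_ge0// ltW.
  by move=> x Ax; exfalso; apply: A0; exists x.
pose N := Num.truncn (2 * B / e).
pose cell (x : 'rV[R]_d) : {ffun 'I_d -> 'I_N.+1} :=
  [ffun i => inord (Num.truncn ((x 0 i + B) / e))].
have gP a : exists y, A y /\ ((exists x, A x /\ cell x = a) -> cell y = a).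
  have [[x [Ax xa]]|nx] := pselect (exists x, A x /\ cell x = a).
    by exists x.
  by exists x0.
exists {ffun 'I_d -> 'I_N.+1}, (fun a => projT1 (cid (gP a))); split.
- have Be0 : 0 <= 2 * B / e by rewrite divr_ge0 ?mulr_ge0// ltW.
  rewrite card_ffun !card_ord natrX lerXn2r ?nnegrE ?addr_ge0//.
  by rewrite -[leLHS]natr1 lerD2r truncn_le.
- by move=> a; case: (cid (gP a)) => y [].
move=> x Ax; exists (cell x); case: (cid (gP (cell x))) => y /= [Ay /(_ (ex_intro _ x (conj Ax erefl))) yx] i.
have key z : A z -> ((cell z i)%:R <= (z 0 i + B) / e < (cell z i).+1%:R).
  move=> Az; have := box0_coord (AB _ Az) i; rewrite ler_norml => /andP[z1 z2].
  have z0 : 0 <= (z 0 i + B) / e by apply: divr_ge0; [lra|exact: ltW].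
  rewrite ffunE inordK ?truncn_itv//.
  rewrite ltnS; apply: le_truncn.
  by rewrite ler_pM2r ?invr_gt0//; lra.
have /andP[] := key x Ax; have /andP[] := key y Ay; rewrite yx -natr1.
rewrite !ler_pdivlMr// !ltr_pdivrMr// mulrDl mul1r => h1 h2 h3 h4.
by rewrite ler_norml; apply/andP; split; lra.
Qed.

Lemma union_bound (R : realType) d (T : measurableType d) (P : {measure set T -> \bar R})
    (J : finType) (E : J -> set T) (b : R) :
  (forall j, measurable (E j)) -> (forall j, (P (E j) <= b%:E)%E) ->
  exists F, [/\ measurable F, forall j, E j `<=` F & (P F <= (#|J|%:R * b)%:E)%E].
Proof.
move=> mE Eb.
suff H (r : seq J) : exists F, [/\ measurable F, forall j, j \in r -> E j `<=` F &
    (P F <= ((size r)%:R * b)%:E)%E].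
  have [F [mF EF PF]] := H (enum J); exists F; split => //.
    by move=> j; apply: EF; rewrite mem_enum.
  by rewrite cardE.
elim: r => [|j r [F [mF EF PF]]].
  by exists set0; split => //; rewrite measure0 mul0r.
exists (E j `|` F); split; first exact: measurableU.
  move=> k; rewrite inE => /orP[/eqP ->|kr]; first exact: subsetUl.
  by move=> w /(EF k kr); right.
apply: (le_trans (measureU2 _ _ _)) => //.
by rewrite /= -natr1 mulrDl mul1r addrC EFinD leeD.
Qed.

Section events.
Context {R : realType} {d : nat} {dT : measure_display} {T : measurableType dT}.
Variables (P : probability T R).
Variables (X : {RV P >-> 'rV[R]_d}) (Y : {RV P >-> R}).
Variables (Xs : nat -> {RV P >-> 'rV[R]_d}) (Ys : nat -> {RV P >-> R}).
Let XY w := (X w, Y w).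
Let XYs i w := (Xs i w, Ys i w).
Hypothesis iidXY : iid_copies P XY XYs.
Variables (supp X0 : set 'rV[R]_d) (q : 'rV[R]_d -> R) (cl cu BX : R).
Hypothesis mq : measurable_fun setT q.
Hypothesis cl0 : 0 < cl.
Hypothesis BX0 : 0 < BX.
Hypothesis X0B : X0 `<=` box 0 BX.
Hypothesis cells : cell_law_bounds q P X Y supp cl cu.

Lemma measurable_XY : measurable_fun setT XY.
Proof. exact: measurable_fun_pair. Qed.

Lemma measurable_XYs i : measurable_fun setT (XYs i).
Proof. exact: measurable_fun_pair. Qed.

Lemma cnt_mono (A B : set ('rV[R]_d * R)) n w : A `<=` B ->
  cnt XYs A n w <= cnt XYs B n w :> R.
Proof.
move=> AB; apply: ler_sum => i _; rewrite !indicE ler_nat.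
by case: (boolP (_ \in A)) => [/set_mem/AB/mem_set ->|].
Qed.

Lemma measurable_cell_pos y r t : measurable (cell_pos q y r t).
Proof. by rewrite cell_posE; exact: cell_measurable. Qed.

Lemma measurable_cell_neg y r t : measurable (cell_neg q y r t).
Proof. by rewrite cell_negE; exact: cell_measurable. Qed.

Lemma measurable_cell_abs y r t : measurable (cell_abs q y r t).
Proof. by rewrite cell_absE; exact: cell_measurable. Qed.

(** A cell of radius h e around a point of X0 contains a cell of half that radius around a
    point of a net of step h e/2; Chernoff's bound is applied to the cells around the
    net. *)
Lemma lower_event (I : finType) (pt : I -> 'rV[R]_d) (e c h : R) (n J : nat)
    (t : nat -> R) (tmin : R) :
  0 < e -> 0 < c -> 0 < h -> 0 <= tmin ->
  (forall j, (j < J)%N -> 0 < c * t j / 4 /\ c * t j / 4 <= 1 /\ tmin <= t j) ->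
  (forall a x, X0 x -> box (x + h *: pt a) (h * e / 2) `<=` supp) ->
  exists E, [/\ measurable E,
    (P E <= ((2 * #|I|%:R * J%:R * (2 * BX / (h * e / 2) + 1) ^+ d) *
       expR (- (n%:R * (cl * (h * e / 2) ^+ d * (c * tmin / 4)) / 4)))%:E)%E &
    forall w, ~ E w -> forall x a j, X0 x -> (j < J)%N ->
     n%:R * (cl * (h * e / 2) ^+ d * (c * t j / 4)) / 4 <=
       cnt XYs (cell_pos q (x + h *: pt a) (h * e) (c * t j / 4)) n w /\
     n%:R * (cl * (h * e / 2) ^+ d * (c * t j / 4)) / 4 <=
       cnt XYs (cell_neg q (x + h *: pt a) (h * e) (c * t j / 4)) n w].
Proof.
move=> e0 c0 h0 tmin0 tP inS; set r := h * e / 2.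
have r0 : 0 < r by rewrite !divr_gt0 ?mulr_gt0.
have [G [g [Gcard gX0 gcov]]] := net_exists BX0 r0 X0B.
pose cel (b : bool) := if b then @cell_pos R d q else @cell_neg R d q.
have mcel b y r' t' : measurable (cel b y r' t').
  by case: b; [exact: measurable_cell_pos|exact: measurable_cell_neg].
pose bad (k : G * I * 'I_J * bool) : set T :=
  let: (i, a, j, b) := k in
  [set w | cnt XYs (cel b (g i + h *: pt a) r (c * t j / 4)) n w <=
     n%:R * (cl * r ^+ d * (c * t j / 4)) / 4].
have mbad k : measurable (bad k).
  case: k => -[[i a] j] b; rewrite /bad.
  rewrite -[X in measurable X]setTI; apply: measurable_fun_le => //.
  exact: (measurable_cnt measurable_XYs).
have Pbad k : (P (bad k) <= (expR (- (n%:R * (cl * r ^+ d * (c * tmin / 4)) / 4)))%:E)%E.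
  case: k => -[[i a] j] b; have [t0 [t1 tm]] := tP j (ltn_ord j).
  have [_ /(_ _ t0 t1)[cp cn] _] := cells r0 (inS a (g i) (gX0 i)).
  have cb : ((cl * r ^+ d * (c * t j / 4))%:E <=
      P (XY @^-1` cel b (g i + h *: pt a)%R r (c * t j / 4)%R))%E by case: b.
  apply: le_trans (cnt_lower measurable_XY measurable_XYs iidXY n (mcel _ _ _ _) cb) _.
  rewrite lee_fin ler_expR lerN2 ler_pM2r ?invr_gt0// ler_wpM2l//.
  rewrite ler_wpM2l//; first by rewrite mulr_ge0 ?exprn_ge0 ?ltW.
  by rewrite ler_pM2r ?invr_gt0// ler_wpM2l// ltW.
have [E [mE bE PE]] := union_bound mbad Pbad.
exists E; split => //.
  apply: le_trans PE _; rewrite lee_fin ler_wpM2r ?expR_ge0//.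
  rewrite !card_prod card_bool card_ord !natrM.
  rewrite [leLHS](_ : _ = 2 * #|I|%:R * J%:R * #|G|%:R); last by ring.
  by rewrite ler_wpM2l.
move=> w Ew x a j Xx jJ.
have [i ix] := gcov x Xx.
have sub : box (g i + h *: pt a) r `<=` box (x + h *: pt a) (h * e).
  apply: subset_box => k; have := ix k; rewrite !mxE distrC => ixk.
  rewrite (_ : g i 0 k + h * pt a 0 k - (x 0 k + h * pt a 0 k) = g i 0 k - x 0 k); last ring.
  by rewrite (_ : h * e = r + r) ?lerD2r//; rewrite /r; field.
have good b : n%:R * (cl * r ^+ d * (c * t j / 4)) / 4 <=
    cnt XYs (cel b (g i + h *: pt a) r (c * t j / 4)) n w.
  rewrite leNgt; apply/negP => /ltW h1; apply: Ew.
  by apply: (bE (i, a, Ordinal jJ, b)).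
split.
  by apply: le_trans (good true) _; apply: cnt_mono => u [/sub].
by apply: le_trans (good false) _; apply: cnt_mono => u [/sub].
Qed.

(** As for the lower bound, with cells enlarged by the step h of the net. *)
Lemma upper_event (B h beta : R) (n : nat) :
  0 < B -> 0 < h -> 0 < beta -> beta <= 1 ->
  (forall x, X0 x -> box x (h * (B + 1)) `<=` supp) ->
  exists E, [/\ measurable E,
    (P E <= ((2 * BX / h + 1) ^+ d *
       expR (- (n%:R * (cu * (h * (B + 1)) ^+ d * beta))))%:E)%E &
    forall w, ~ E w -> forall x, X0 x ->
      cnt XYs (cell_abs q x (h * B) beta) n w <=
      4 * n%:R * (cu * (h * (B + 1)) ^+ d * beta)].
Proof.
move=> B0 h0 b0 b1 inS.
have r0 : 0 < h * (B + 1) by rewrite mulr_gt0// addr_gt0.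
have [G [g [Gcard gX0 gcov]]] := net_exists BX0 h0 X0B.
pose bad (i : G) : set T := [set w |
  4 * n%:R * (cu * (h * (B + 1)) ^+ d * beta) <=
  cnt XYs (cell_abs q (g i) (h * (B + 1)) beta) n w].
have mbad k : measurable (bad k).
  rewrite -[X in measurable X]setTI; apply: measurable_fun_le => //.
  by apply: (measurable_cnt measurable_XYs); exact: measurable_cell_abs.
have Pbad k : (P (bad k) <=
    (expR (- (n%:R * (cu * (h * (B + 1)) ^+ d * beta))))%:E)%E.
  have [_ _ /(_ _ b0 b1) ca] := cells r0 (inS (g k) (gX0 k)).
  exact: (cnt_upper measurable_XY measurable_XYs iidXY n (measurable_cell_abs _ _ _) ca).
have [E [mE bE PE]] := union_bound mbad Pbad.
exists E; split => //.
  by apply: le_trans PE _; rewrite lee_fin ler_wpM2r ?expR_ge0.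
move=> w Ew x Xx; have [i ix] := gcov x Xx.
have sub : box x (h * B) `<=` box (g i) (h * (B + 1)).
  apply: subset_box => k; have := ix k => ixk.
  by rewrite mulrDr mulr1 addrC lerD2l.
rewrite leNgt; apply/negP => h1; apply: Ew; apply: (bE i); rewrite /bad/=.
by apply: le_trans (ltW h1) _; apply: cnt_mono => u [/sub].
Qed.

End events.

(** * Integrals outside a small event *)

Section nonneg_integrals.
Local Open Scope ereal_scope.
Context {R : realType}.

(** Tonelli's theorem bounds the expectation of the integral, and Markov's inequality turns
    this into a bound outside a small event. *)
Lemma integral_event d1 d2 (T : measurableType d1) (U : measurableType d2)
    (P : probability T R) (mu : {sigma_finite_measure set U -> \bar R})
    (g : T * U -> R) (D : set U) (b V eps : R) :
  measurable_fun setT g -> (forall z, (0 <= g z)%R) -> measurable D ->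
  (0 < b)%R -> (0 < V)%R -> (0 < eps)%R -> mu D <= V%:E ->
  (forall x, D x -> \int[P]_w (g (w, x))%:E <= b%:E) ->
  exists E, [/\ measurable E, P E <= eps%:E &
    forall w, ~ E w -> \int[mu]_(x in D) (g (w, x))%:E <= (b * V / eps)%:E].
Proof.
move=> mg g0 mD b0 V0 e0 muD gb.
pose G (z : T * U) : \bar R := (g z * \1_D z.2)%:E.
have G0 z : 0 <= G z by rewrite lee_fin mulr_ge0.
have mG : measurable_fun setT G.
  apply/measurable_EFinP; apply: measurable_funM => //.
  by apply: measurableT_comp => //; exact: measurable_indic.
pose F w := \int[mu]_x G (w, x).
have FE w : F w = \int[mu]_(x in D) (g (w, x))%:E.
  rewrite /F [RHS]integral_mkcond; apply: eq_integral => x _.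
  rewrite /G patchE indicE /=; case: (x \in D); by rewrite ?mulr1 ?mulr0.
have F0 w : 0 <= F w by apply: integral_ge0.
have mF : measurable_fun setT F.
  by have := @measurable_fun_fubini_tonelli_F _ _ T U R mu G mG G0.
have bV0 : (0 < b * V / eps)%R by apply: divr_gt0 => //; exact: mulr_gt0.
have intF : \int[P]_w F w <= (b * V)%:E.
  rewrite /F (fubini_tonelli G mG G0).
  apply: (@le_trans _ _ (\int[mu]_(x in D) b%:E)).
    rewrite [leRHS]integral_mkcond; apply: nonneg_integral_le => x _.
      exact: integral_ge0.
    rewrite patchE /G /= indicE; case: (boolP (x \in D)) => [/set_mem Dx|_].
      under eq_integral do rewrite mulr1; exact: gb.
    by under eq_integral do rewrite mulr0; rewrite integral0.
  by rewrite integral_cst// EFinM lee_pmul2l// lte_fin.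
exists [set w | (b * V / eps)%:E <= F w]; split.
- by rewrite -[X in measurable X]setTI; apply: emeasurable_fun_c_infty.
- apply: le_trans (markov_ereal P mF F0 bV0) _.
  apply: (@le_trans _ _ (((b * V / eps)^-1)%:E * (b * V)%:E)).
    by apply: lee_wpmul2l => //; rewrite lee_fin invr_ge0 ltW.
  rewrite -EFinM lee_fin; apply: le_of_eq.
  by field; rewrite !gt_eqF.
- by move=> w /negP; rewrite -ltNge -FE => /ltW.
Qed.

End nonneg_integrals.

(** From |y| <= m exp(|y|/m): each |y_v|, and also 1, is at most a multiple of the m-th
    root of the sum of exponentials. *)
Lemma powR_sum_le {R : realType} (V : finType) (m : R) (y : V -> R) : 0 < m ->
  (0 < #|V|)%N ->
  (1 + \sum_v `|y v|) `^ m <=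
  (1 + #|V|%:R * m) `^ m * \sum_v (expR (y v) + expR (- y v)).
Proof.
move=> m0 V0; set a := \sum_v (_ + _).
have ev v : expR `|y v| <= expR (y v) + expR (- y v).
  by case: (ger0P (y v)) => _; rewrite ?lerDl ?lerDr expR_ge0.
have av v : expR `|y v| <= a.
  apply: le_trans (ev v) _; rewrite /a (bigD1 v)//= lerDl.
  by apply: sumr_ge0 => u _; rewrite addr_ge0// expR_ge0.
have [v0 _] := card_gt0P V0.
have a1 : 1 <= a by apply: le_trans (av v0); rewrite -expR0 ler_expR.
have a0 : 0 <= a by exact: le_trans a1.
have b1 : 1 <= a `^ m^-1.
  rewrite -(powRr0 a); apply: ler_powR => //; by rewrite invr_ge0 ltW.
have yv v : `|y v| <= m * a `^ m^-1.
  rewrite -ler_pdivrMl//; apply: (@le_trans _ _ (expR (m^-1 * `|y v|))).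
    by apply: le_trans (expR_ge1Dx _); rewrite lerDr.
  rewrite mulrC expRM; apply: ge0_ler_powR; rewrite ?nnegrE ?invr_ge0 ?expR_ge0 ?(ltW m0)//.
have aE : a = (a `^ m^-1) `^ m.
  by rewrite -powRrM mulVf ?gt_eqF// powRr1.
rewrite [X in _ <= _ * X]aE.
have c0 : 0 <= 1 + #|V|%:R * m by rewrite addr_ge0// mulr_ge0// ltW.
rewrite -powRM ?powR_ge0//; apply: ge0_ler_powR; rewrite ?nnegrE ?(ltW m0)//.
- by rewrite addr_ge0// sumr_ge0.
- by rewrite mulr_ge0// powR_ge0.
rewrite mulrDl mul1r; apply: lerD => //.
apply: (@le_trans _ _ (\sum_(v : V) m * a `^ m^-1)); first exact: ler_sum.
by rewrite sumr_const -[leLHS]mulr_natl mulrA.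
Qed.

(** * Uniform and integrated bounds for the scores *)

Section score.
Context {R : realType} {d : nat} {dT : measure_display} {T : measurableType dT}.
Variables (P : probability T R).
Variables (X : {RV P >-> 'rV[R]_d}) (Y : {RV P >-> R}).
Variables (Xs : nat -> {RV P >-> 'rV[R]_d}) (Ys : nat -> {RV P >-> R}).
Let XY w := (X w, Y w).
Let XYs i w := (Xs i w, Ys i w).
Hypothesis iidXY : iid_copies P XY XYs.
Variables (supp X0 : set 'rV[R]_d) (q : 'rV[R]_d -> R) (cu BX alpha : R).
Hypothesis mq : measurable_fun setT q.
Hypothesis BX0 : 0 < BX.
Hypothesis X0B : X0 `<=` box 0 BX.
Hypothesis alpha01 : 0 <= alpha <= 1.
Hypothesis PXbox : forall y r, 0 < r -> box y r `<=` supp ->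
  (P (X @^-1` box y r) <= (cu * r ^+ d)%:E)%E.
Hypothesis Pq : forall A, measurable A -> A `<=` supp ->
  P (X @^-1` A `&` [set w | Y w <= q (X w)]) = (alpha%:E * P (X @^-1` A))%E.
Variables (V : finType) (W : V -> 'rV[R]_d -> R) (B CW : R).
Hypothesis B0 : 0 < B.
Hypothesis mW : forall v, measurable_fun setT (W v).
Hypothesis W_le : forall v z, `|W v z| <= CW.
Hypothesis W_supp : forall v z, W v z != 0 -> box 0 B z.
Hypothesis W_lip : forall v z z' e, 0 <= e -> e <= 1 -> box z' e z ->
  `|W v z - W v z'| <= CW * e.

Definition score_term h v x (u : 'rV[R]_d * R) : R :=
  W v (h^-1 *: (u.1 - x)) * quantile_score alpha (u.2 - q u.1).

Definition score n h v x w : R := \sum_(i < n) score_term h v x (XYs i w).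

Lemma measurable_rescaled h v x : measurable_fun setT (fun y : 'rV[R]_d => W v (h^-1 *: (y - x))).
Proof.
apply: measurableT_comp => //; apply: measurable_fun_rV => i.
under [X in measurable_fun _ X]eq_fun do rewrite !mxE.
apply: measurable_funM => //; apply: measurable_funB => //.
exact: measurable_coord.
Qed.

Lemma measurable_quantile_score :
  measurable_fun setT (fun u : 'rV[R]_d * R => quantile_score alpha (u.2 - q u.1)).
Proof.
have mA : measurable [set u : 'rV[R]_d * R | u.2 - q u.1 <= 0].
  rewrite -[X in measurable X]setTI; apply: measurable_fun_le => //.
  by apply: measurable_funB => //; exact: measurableT_comp.
rewrite (_ : (fun u => _) = (fun u => alpha - \1_[set u : 'rV[R]_d * R | u.2 - q u.1 <= 0] u)).
  by apply: measurable_funB => //; exact: measurable_indic.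
apply/funext => u; rewrite /quantile_score indicE; congr (_ - _%:R).
by case: (boolP (u.2 - q u.1 <= 0)%R) => h; [rewrite mem_set|rewrite memNset//; exact/negP].
Qed.

Lemma measurable_score_term h v x : measurable_fun setT (score_term h v x).
Proof.
apply: measurable_funM; last exact: measurable_quantile_score.
exact: (measurableT_comp (measurable_rescaled h v x)).
Qed.

Lemma quantile_score_le1 t : `|quantile_score alpha t| <= 1.
Proof.
have /andP[a0 a1] := alpha01.
by rewrite /quantile_score ler_norml; case: (t <= 0) => /=; apply/andP; split; lra.
Qed.

Lemma rescaled_box h v x y : 0 < h -> ~ box x (h * B) y -> W v (h^-1 *: (y - x)) = 0.
Proof.
move=> h0 yx; apply/eqP/negPn/negP => /W_supp H; apply: yx => i.
have := box0_coord H i; rewrite !mxE normrM gtr0_norm ?invr_gt0//.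
by rewrite ler_pdivrMl.
Qed.

Lemma score_term_mgf h v x l : 0 < h -> box x (h * B) `<=` supp ->
  `|l| * CW <= 2^-1 ->
  (\int[P]_w (expR (l * score_term h v x (XY w)))%:E <=
   (expR (2 * (l * CW) ^+ 2 * (cu * (h * B) ^+ d)))%:E)%E.
Proof.
move=> h0 xs l2; pose A := [set w | Y w <= q (X w)].
have mA : measurable A.
  rewrite -[X in measurable X]setTI; apply: measurable_fun_le => //.
  exact: (measurableT_comp mq).
have hB : 0 < h * B by rewrite mulr_gt0.
have mPhi : measurable_fun setT (fun y : 'rV[R]_d => l * W v (h^-1 *: (y - x))).
  by apply: measurable_funM => //; exact: measurable_rescaled.
have PD := PXbox hB xs.
have PA C : measurable C -> C `<=` box x (h * B) ->
    P (X @^-1` C `&` A) = (alpha%:E * P (X @^-1` C))%E.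
  by move=> mC Cx; apply: Pq => //; exact: subset_trans xs.
have Phi0 y : ~ box x (h * B) y -> l * W v (h^-1 *: (y - x)) = 0.
  by move=> /(@rescaled_box _ v _ _ h0) ->; rewrite mulr0.
have Phib y : `|l * W v (h^-1 *: (y - x))| <= `|l| * CW.
  by rewrite normrM ler_wpM2l.
have := score_mgf (measurable_funP X) (measurable_box _ _) mA alpha01 PA mPhi Phi0 Phib l2 PD.
rewrite (_ : (`|l| * CW) ^+ 2 = (l * CW) ^+ 2); last first.
  by rewrite !exprMn real_normK ?num_real.
apply: le_trans; apply: le_of_eq.
apply: eq_integral => w _; congr (expR _)%:E.
rewrite /score_term /quantile_score /= mulrA; congr (_ * (_ - _)).
rewrite indicE subr_le0; congr (_%:R).
by case: (boolP (Y w <= q (X w))%R) => hw; [rewrite mem_set|rewrite memNset//; exact/negP].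
Qed.

Lemma score_mgf_iid n h v x l : 0 < h -> box x (h * B) `<=` supp ->
  `|l| * CW <= 2^-1 ->
  (\int[P]_w (expR (l * score n h v x w))%:E <=
   (expR (n%:R * (2 * (l * CW) ^+ 2 * (cu * (h * B) ^+ d))))%:E)%E.
Proof.
move=> h0 xs l2.
have mg : measurable_fun setT (fun u => l * score_term h v x u).
  by apply: measurable_funM => //; exact: measurable_score_term.
have := expR_sum_iid (measurable_XY X Y) (measurable_XYs Xs Ys) iidXY n mg
  (score_term_mgf v h0 xs l2).
by under eq_integral do rewrite -mulr_sumr.
Qed.

Lemma score_lip n h v x x' w e : 0 < h -> 0 <= e -> e <= h -> box x' e x ->
  `|score n h v x w - score n h v x' w| <= n%:R * (CW * (e / h)).
Proof.
move=> h0 e0 eh xx'; rewrite /score -sumrB.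
apply: le_trans (ler_norm_sum _ _ _) _.
apply: (@le_trans _ _ (\sum_(i < n) CW * (e / h))); last first.
  by rewrite sumr_const card_ord -[leLHS]mulr_natl.
apply: ler_sum => i _; rewrite /score_term -mulrBl normrM -[leRHS]mulr1.
apply: ler_pM => //; last exact: quantile_score_le1.
apply: W_lip; first by rewrite divr_ge0// ltW.
  by rewrite ler_pdivrMr// mul1r.
move=> k; have := xx' k; rewrite !mxE -mulrBr normrM gtr0_norm ?invr_gt0//.
move=> xk; rewrite [leRHS]mulrC ler_pM2l ?invr_gt0//.
by rewrite (_ : _ - _ = - (x 0 k - x' 0 k)) ?normrN//; ring.
Qed.

(** Chernoff's bound with parameter eta at the points of a net of step delta; between these
    points the scores vary slowly because the kernel is Lipschitz. *)
Lemma score_event n h M delta eta : 0 < h -> 0 < delta -> delta <= h -> 0 < eta ->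
  eta * CW <= 2^-1 -> (forall x, X0 x -> box x (h * B) `<=` supp) ->
  exists E, [/\ measurable E,
    (P E <= (2 * #|V|%:R * (2 * BX / delta + 1) ^+ d *
      expR (- ((M - 2 * CW ^+ 2 * (cu * B ^+ d)) * (eta ^+ 2 * (n%:R * h ^+ d)))))%:E)%E &
    forall w, ~ E w -> forall x v, X0 x ->
      `|score n h v x w| <= M * eta * (n%:R * h ^+ d) + n%:R * (CW * (delta / h))].
Proof.
move=> h0 de0 deh eta0 etaC inS; set m := n%:R * h ^+ d.
have [G [g [Gcard gX0 gcov]]] := net_exists BX0 de0 X0B.
pose sg (b : bool) : R := if b then 1 else -1.
pose bad (k : G * V * bool) : set T := let: (i, v, b) := k in
  [set w | M * eta ^+ 2 * m <= \sum_(j < n) (sg b * eta) * score_term h v (g i) (XYs j w)].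
have mterm v i b : measurable_fun setT
    (fun u => (sg b * eta) * score_term h v (g i) u).
  by apply: measurable_funM => //; exact: measurable_score_term.
have mbad k : measurable (bad k).
  case: k => -[i v] b; rewrite /bad -[X in measurable X]setTI.
  apply: measurable_fun_le => //.
  exact: (measurable_sum_iid (measurable_XYs Xs Ys) n (mterm v i b)).
have Pbad k : (P (bad k) <=
    (expR (- ((M - 2 * CW ^+ 2 * (cu * B ^+ d)) * (eta ^+ 2 * m))))%:E)%E.
  case: k => -[i v] b; rewrite /bad.
  have sgn : `|sg b * eta| * CW <= 2^-1.
    have sg1 : `|sg b| = 1 by rewrite /sg; case: (b); rewrite ?normrN1 ?normr1.
    by rewrite normrM sg1 mul1r gtr0_norm.
  have := chernoff (measurable_XY X Y) (measurable_XYs Xs Ys) iidXY (M * eta ^+ 2 * m) n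
    (mterm v i b) (score_term_mgf v h0 (inS _ (gX0 i)) sgn).
  move=> /le_trans; apply; rewrite lee_fin ler_expR.
  rewrite (_ : (sg b * eta * CW) ^+ 2 = eta ^+ 2 * CW ^+ 2); last first.
    by rewrite !exprMn (_ : sg b ^+ 2 = 1) ?mul1r// /sg; case: (b); rewrite ?sqrrN expr1n.
  by rewrite /m; apply: le_of_eq; rewrite exprMn; ring.
have [E [mE bE PE]] := union_bound mbad Pbad.
exists E; split => //.
  apply: le_trans PE _; rewrite lee_fin ler_wpM2r ?expR_ge0//.
  rewrite !card_prod card_bool !natrM.
  rewrite [leLHS](_ : _ = 2 * #|V|%:R * #|G|%:R); last by ring.
  by rewrite ler_wpM2l.
move=> w Ew x v Xx; have [i ix] := gcov x Xx.
have good b : sg b * score n h v (g i) w <= M * eta * m.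
  rewrite leNgt; apply/negP => h1; apply: Ew; apply: (bE (i, v, b)); rewrite /bad/=.
  rewrite -mulr_sumr -/(score n h v (g i) w).
  rewrite (_ : M * eta ^+ 2 * m = eta * (M * eta * m)); last ring.
  rewrite (_ : sg b * eta * _ = eta * (sg b * score n h v (g i) w)); last ring.
  by apply: ler_wpM2l; exact: ltW.
have gl : `|score n h v (g i) w| <= M * eta * m.
  have := good true; have := good false; rewrite /sg mul1r mulN1r => h1 h2.
  by rewrite ler_norml; apply/andP; split; lra.
rewrite (_ : score n h v x w = score n h v (g i) w + (score n h v x w - score n h v (g i) w)); last ring.
apply: le_trans (ler_normD _ _) _; apply: lerD => //.
by apply: score_lip => //; exact: ltW.
Qed.

Hypothesis mX0 : measurable X0.
Hypothesis V0 : (0 < #|V|)%N.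

Lemma measurable_score n h v :
  measurable_fun setT (fun z : T * 'rV[R]_d => score n h v z.2 z.1).
Proof.
apply: measurable_sum => i; apply: measurable_funM.
  apply: (measurableT_comp (mW v)); apply: measurable_fun_rV => j.
  under [X in measurable_fun _ X]eq_fun do rewrite !mxE.
  apply: measurable_funM => //; apply: measurable_funB.
    apply: (measurableT_comp (@measurable_coord R d j)).
    exact: (measurableT_comp (measurable_funP (Xs i))).
  exact: (measurableT_comp (@measurable_coord R d j)).
apply: (measurableT_comp measurable_quantile_score).
exact: (measurableT_comp (measurable_XYs Xs Ys i)).
Qed.

(** With l of order 1/sqrt(n h^d) the bound does not depend on n. *)
Lemma score_moments n h l eps : 0 < h -> 0 < eps ->
  (forall x, X0 x -> box x (h * B) `<=` supp) -> `|l| * CW <= 2^-1 ->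
  exists E, [/\ measurable E, (P E <= eps%:E)%E & forall w, ~ E w ->
   (\int[leb d]_(x in X0) (\sum_v (expR (l * score n h v x w) +
      expR (- (l * score n h v x w))))%:E <=
    (#|V|%:R * (2 * expR (n%:R * (2 * (l * CW) ^+ 2 * (cu * (h * B) ^+ d)))) *
     (2 * BX) ^+ d / eps)%:E)%E].
Proof.
move=> h0 e0 inS lW.
pose g (z : T * 'rV[R]_d) : R := \sum_v
  (expR (l * score n h v z.2 z.1) +
   expR (- (l * score n h v z.2 z.1))).
set b : R := #|V|%:R * _.
have mexp v k : measurable_fun setT (fun z : T * 'rV[R]_d =>
    expR (k * score n h v z.2 z.1)).
  apply: measurableT_comp => //; apply: measurable_funM => //; exact: measurable_score.
have mexpw v k x : measurable_fun setT (fun w : T =>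
    expR (k * score n h v x w)).
  apply: measurableT_comp => //; apply: measurable_funM => //.
  exact: (measurable_sum_iid (measurable_XYs Xs Ys) n (measurable_score_term h v x)).
have mg : measurable_fun setT g.
  apply: measurable_sum => v; apply: measurable_funD; first exact: mexp.
  by under [X in measurable_fun _ X]eq_fun do rewrite -mulNr; exact: mexp.
have g0 z : 0 <= g z by apply: sumr_ge0 => v _; rewrite addr_ge0// expR_ge0.
have b0 : 0 < b by rewrite /b mulr_gt0 ?ltr0n// mulr_gt0// expR_gt0.
have BXd : 0 < (2 * BX) ^+ d by rewrite exprn_gt0// mulr_gt0.
have mu0 : (leb d X0 <= ((2 * BX) ^+ d)%:E)%E.
  rewrite -(@leb_box R d 0 BX) ?(ltW BX0)//; apply: le_measure => //; rewrite ?inE//.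
  exact: measurable_box.
apply: (integral_event mg g0 mX0 b0 BXd e0 mu0) => x Xx.
rewrite /g /=; under eq_integral do rewrite -sumEFin.
rewrite ge0_integral_sum//; last first.
  move=> v; apply/measurable_EFinP; apply: measurable_funD; first exact: mexpw.
  by under [X in measurable_fun _ X]eq_fun do rewrite -mulNr; exact: mexpw.
rewrite /b mulr_natl -sumr_const -sumEFin; apply: lee_sum => v _.
under eq_integral do rewrite EFinD -mulNr.
rewrite ge0_integralD//; [|by apply/measurable_EFinP; exact: mexpw..].
rewrite mulrDl mul1r EFinD; apply: leeD.
  by apply: score_mgf_iid => //; exact: inS.
rewrite -[in leRHS](sqrrN (l * CW)) -mulNr.
apply: score_mgf_iid => //; first exact: inS.
by rewrite normrN.
Qed.

End score.

(** * Uniform bounds for the estimator *)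

Section estimation.
Context {R : realType} {d p : nat} {dT : measure_display} {T : measurableType dT}.
Variables (P : probability T R).
Variables (X : {RV P >-> 'rV[R]_d}) (Y : {RV P >-> R}).
Variables (Xs : nat -> {RV P >-> 'rV[R]_d}) (Ys : nat -> {RV P >-> R}).
Let XY w := (X w, Y w).
Let XYs i w := (Xs i w, Ys i w).
Hypothesis iidXY : iid_copies P XY XYs.
Variables (supp X0 : set 'rV[R]_d) (q : 'rV[R]_d -> R) (cl cu BX rho alpha : R).
Hypothesis mq : measurable_fun setT q.
Hypothesis cl0 : 0 < cl.
Hypothesis cu0 : 0 < cu.
Hypothesis BX0 : 0 < BX.
Hypothesis rho0 : 0 < rho.
Hypothesis X0B : X0 `<=` box 0 BX.
Hypothesis X0rho : forall x, X0 x -> box x rho `<=` supp.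
Hypothesis alpha01 : 0 <= alpha <= 1.
Hypothesis cells : cell_law_bounds q P X Y supp cl cu.
Hypothesis Pq : forall A, measurable A -> A `<=` supp ->
  P (X @^-1` A `&` [set w | Y w <= q (X w)]) = (alpha%:E * P (X @^-1` A))%E.
Variables (K : 'rV[R]_d -> R) (B KM K0 CW : R).
Hypothesis K_ge0 : forall z, 0 <= K z.
Hypothesis K_le : forall z, K z <= KM.
Hypothesis K_supp : forall z, K z != 0 -> box 0 B z.
Hypothesis K0_gt0 : 0 < K0.
Hypothesis K_ge : forall z, K0 * (enorm z <= 1)%R%:R <= K z.
Hypothesis B0 : 0 < B.
Definition moment_kernel (v : mindex d p) (z : 'rV[R]_d) : R := K z * lp_basis z v.
Hypothesis CW1 : 1 <= CW.
Hypothesis mW : forall v, measurable_fun setT (moment_kernel v).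
Hypothesis W_le : forall v z, `|moment_kernel v z| <= CW.
Hypothesis W_lip : forall v z z' e, 0 <= e -> e <= 1 -> box z' e z ->
  `|moment_kernel v z - moment_kernel v z'| <= CW * e.
(* Boxes inside the unit ball, where K is bounded below, that detect large coefficients. *)
Variables (I : finType) (pt : I -> 'rV[R]_d) (c e : R).
Hypothesis c_gt0 : 0 < c.
Hypothesis e_gt0 : 0 < e.
Hypothesis e_le1 : e <= 1.
Hypothesis pt1 : forall a, box 0 1 (pt a).
Hypothesis pt_unit : forall a z, box (pt a) e z -> enorm z <= 1.
Hypothesis pt_sep : separating_boxes (p := p) pt c e.
Variables (s CT : R) (bs : 'rV[R]_d -> {ffun mindex d p -> R}).
Hypothesis s_gt0 : 0 < s.
Hypothesis CT_ge0 : 0 <= CT.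
Hypothesis bias : forall x z r, X0 x -> 0 < r -> r <= rho -> box x r z ->
  `|q z - lp_value (bs x) (z - x)| <= CT * r `^ s.
Variable bhat : nat -> T -> R -> 'rV[R]_d -> {ffun mindex d p -> R}.
Hypothesis bhat_min : forall n w h x, 0 < h -> forall b : {ffun mindex d p -> R},
  lp_criterion K n (Xs ^~ w) (Ys ^~ w) alpha h x (bhat n w h x) <=
  lp_criterion K n (Xs ^~ w) (Ys ^~ w) alpha h x b.

Definition scores n h v x w : R := score Xs Ys q alpha moment_kernel n h v x w.

(* Cb h^s bounds the bias on the window of the kernel; n h^d c1 t and n h^d c2 t bound the
   counts in cells of height of order t; tau makes the curvature beat the bias from the
   level t = tau h^s on, see tau_balance. *)
Let Cb : R := CT * B `^ s + 1.
Let Pn : R := #|{: mindex d p}|%:R.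
Let c1 : R := cl * (e / 2) ^+ d * c / 16.
Let c2 : R := 4 * cu * (B + 1) ^+ d.
Let c3 : R := K0 * c * c1 / (8 * Pn).
Let tau : R := 1 + 2 * Cb / c + 8 * KM * c2 * Cb ^+ 2 / (K0 * c * c1).

Let KM0 : 0 < KM.
Proof.
apply: lt_le_trans K0_gt0 _; apply: le_trans (K_le 0); have := K_ge 0.
rewrite (_ : enorm 0 <= 1) ?mulr1//.
by rewrite /enorm big1 ?sqrtr0// => i _; rewrite mxE expr0n.
Qed.
Let Cb1 : 1 <= Cb.
Proof. by rewrite /Cb lerDr mulr_ge0// powR_ge0. Qed.
Let Cb0 : 0 < Cb.
Proof. exact: lt_le_trans ltr01 Cb1. Qed.
Let Pn0 : 0 < Pn.
Proof. by rewrite ltr0n; apply/card_gt0P; exists (mi_mk mi0). Qed.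
Let c10 : 0 < c1.
Proof. by apply: divr_gt0 => //; apply: mulr_gt0 => //; apply: mulr_gt0 => //; rewrite exprn_gt0// divr_gt0. Qed.
Let c20 : 0 < c2.
Proof. by rewrite !mulr_gt0// exprn_gt0// addr_gt0. Qed.
Let c30 : 0 < c3.
Proof. by apply: divr_gt0; apply: mulr_gt0 => //; apply: mulr_gt0. Qed.
Let D0 : 0 < K0 * c * c1.
Proof. by apply: mulr_gt0 => //; exact: mulr_gt0. Qed.
Let N0 : 0 < 8 * KM * c2 * Cb ^+ 2.
Proof.
by apply: mulr_gt0; [apply: mulr_gt0 => //; exact: mulr_gt0|exact: exprn_gt0].
Qed.
Let Cbc0 : 0 < 2 * Cb / c.
Proof. by apply: divr_gt0 => //; exact: mulr_gt0. Qed.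
Let tau1 : 1 <= tau.
Proof.
by rewrite /tau -addrA lerDl; apply/ltW/addr_gt0 => //; exact: divr_gt0.
Qed.
Let tau_beta : 2 * Cb <= c * tau.
Proof.
rewrite mulrC [leRHS]mulrC -ler_pdivrMr// mulrC /tau -addrA addrCA lerDl.
by apply/ltW/addr_gt0 => //; exact: divr_gt0.
Qed.
Let tau_balance : 2 * KM * c2 * Cb ^+ 2 < K0 * c / 4 * c1 * tau ^+ 2.
Proof.
have h1 : 8 * KM * c2 * Cb ^+ 2 / (K0 * c * c1) < tau.
  by rewrite /tau ltrDr; exact: addr_gt0.
have h2 : tau <= tau ^+ 2 by rewrite expr2 ler_peMl// (le_trans ler01 tau1).
have := lt_le_trans h1 h2; rewrite ltr_pdivrMr// => h3.
rewrite (_ : K0 * c / 4 * c1 * tau ^+ 2 = tau ^+ 2 * (K0 * c * c1) / 4); last by field.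
by rewrite ltr_pdivlMr//; apply: le_lt_trans h3; apply: le_of_eq; ring.
Qed.

Let c_ge0 := ltW c_gt0.

(* The levels t = (j + 1) tau h^s are cut at 4 / c, where the cells reach height 1. *)
Let low_counts n h w x : Prop := forall a j,
  (j < Num.truncn (4 / (c * (tau * h `^ s))))%N -> let t := j.+1%:R * (tau * h `^ s) in
  n%:R * h ^+ d * c1 * t <=
    cnt XYs (cell_pos q (x + h *: pt a) (h * e) (c * t / 4)) n w /\
  n%:R * h ^+ d * c1 * t <=
    cnt XYs (cell_neg q (x + h *: pt a) (h * e) (c * t / 4)) n w.

(** The counts are available only at the finitely many levels t which are multiples of
    tau h^s; the error is bounded by the first such level above r, which is at most
    r + tau h^s. *)
Lemma error_bound_on_counts n h w x r : (0 < n)%N -> 0 < h -> h * B <= rho ->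
  X0 x -> 0 <= r -> r + tau * h `^ s <= 4 / c ->
  (forall v, `|scores n h v x w| <= n%:R * h ^+ d * c3 * r) ->
  low_counts n h w x ->
  cnt XYs (cell_abs q x (h * B) (Cb * h `^ s)) n w <= n%:R * h ^+ d * c2 * (Cb * h `^ s) ->
  forall v, `|h ^+ mi_size (mi_of v) * (bhat n w h x v - bs x v)| <= r + tau * h `^ s.
Proof.
move=> n0 h0 hB X0x r0 rs Sr low up v.
set H := h `^ s in rs low up *; have H0 : 0 < H by rewrite powR_gt0.
have tH : 0 < tau * H by rewrite mulr_gt0// (lt_le_trans ltr01 tau1).
pose j := Num.truncn (r / (tau * H)).
have /andP[j1 j2] : j%:R <= r / (tau * H) < j.+1%:R.
  by apply: truncn_itv; rewrite divr_ge0// ltW.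
pose t := j.+1%:R * (tau * H).
have rt : r <= t by rewrite -ler_pdivrMr// ltW.
have tr : t <= r + tau * H.
  rewrite /t -natr1 mulrDl mul1r lerD2r.
  by rewrite -ler_pdivlMr.
have jJ : (j < Num.truncn (4 / (c * (tau * H))))%N.
  have ctH : 0 < c * (tau * H) by exact: mulr_gt0.
  rewrite truncn_ge_nat; last by apply/ltW; exact: divr_gt0.
  have -> : 4 / (c * (tau * H)) = 4 / c / (tau * H).
    by rewrite invfM mulrA.
  by rewrite ler_pdivlMr// (le_trans tr).
have tHt : tau * H <= t.
  by rewrite /t -[leLHS]mul1r ler_pM2r// ler1n.
have m0 : 0 < n%:R * h ^+ d by rewrite mulr_gt0 ?ltr0n// exprn_gt0.
apply: (le_trans _ tr).
apply: (@lp_error_bound R d p K q B KM K0 K_ge0 K_le K_supp K0_gt0 K_ge I pt c e c_gt0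
  pt_unit pt_sep n (Xs ^~ w) (Ys ^~ w) alpha h x (bhat n w h x) (bs x) n0 h0
  (bhat_min n w x h0) (Cb * H) t (n%:R * h ^+ d) c1 c2 c3) => //.
- by rewrite mulr_ge0// ltW.
- move=> i /K_supp Ki; have hB0 : 0 < h * B by rewrite mulr_gt0.
  apply: le_trans (bias X0x hB0 hB _) _.
    move=> k; have := box0_coord Ki k; rewrite !mxE normrM gtr0_norm ?invr_gt0//.
    by rewrite ler_pdivrMl.
  rewrite powRM ?(ltW h0) ?(ltW B0)// -/H mulrA mulrAC ler_wpM2r ?(ltW H0)//.
  by rewrite /Cb lerDl.
- exact: lt_le_trans tHt.
- apply: (@le_trans _ _ (c * (tau * H))); last by rewrite ler_wpM2l.
  by rewrite !mulrA ler_wpM2r ?(ltW H0).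
- by move=> a; have [] := low a j jJ.
- by move=> a; have [] := low a j jJ.
- move=> u; apply: le_trans (Sr u) _.
  by rewrite ler_wpM2l// mulr_ge0// ltW.
- have -> : 2 * #|{: mindex d p}|%:R * c3 * t ^+ 2 = K0 * c / 4 * c1 * t ^+ 2.
    by rewrite /c3 -/Pn; field; rewrite gt_eqF.
  have -> : K0 * c / 2 * c1 * t ^+ 2 =
     K0 * c / 4 * c1 * t ^+ 2 + K0 * c / 4 * c1 * t ^+ 2 by field.
  rewrite ltrD2l exprMn.
  apply: (@lt_le_trans _ _ (K0 * c / 4 * c1 * tau ^+ 2 * H ^+ 2)).
    by rewrite mulrA ltr_pM2r ?exprn_gt0// tau_balance.
  have k0 : 0 < K0 * c / 4 * c1.
    by apply: mulr_gt0 => //; apply: divr_gt0 => //; exact: mulr_gt0.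
  rewrite -mulrA -exprMn ler_wpM2l ?(ltW k0)//.
  have t0 : 0 < t by exact: lt_le_trans tHt.
  by apply: lerXn2r => //; rewrite nnegrE; exact: ltW.
Qed.

Hypothesis d_gt0 : (0 < d)%N.
Variable h : nat -> R.
Hypothesis h_gt0 : \forall n \near \oo, 0 < h n.
Hypothesis h_cvg0 : h n @[n --> \oo] --> (0 : R).
Hypothesis h_ln : ln n%:R / (n%:R * h n ^+ d) @[n --> \oo] --> (0 : R).
Hypothesis h_fast : forall A : R,
  \forall n \near \oo, A * ln n%:R <= n%:R * h n ^+ d * h n `^ s.

(* Large enough for the exponent of Chernoff's bound to beat the size n^(2 d) of the net. *)
Let M : R := 2 * CW ^+ 2 * (cu * B ^+ d) + (2 * d).+1%:R.

Let near_h (del : R) : 0 < del -> \forall n \near \oo, h n <= del.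
Proof.
move=> d0; near=> n; apply: le_trans (ler_norm _) _; near: n.
by move/cvgr0Pnorm_le : h_cvg0; apply.
Unshelve. all: by end_near. Qed.

Let near_ln (del : R) : 0 < del ->
  \forall n \near \oo, ln n%:R / (n%:R * h n ^+ d) <= del.
Proof.
move=> d0; near=> n; apply: le_trans (ler_norm _) _; near: n.
by move/cvgr0Pnorm_le : h_ln; apply.
Unshelve. all: by end_near. Qed.

Let near_H (del : R) : 0 < del -> \forall n \near \oo, h n `^ s <= del.
Proof.
move=> d0; have [e' e'0 eP] := powR_small s_gt0 d0.
by have := near_h e'0; apply: filterS2 h_gt0 => n; exact: eP.
Qed.

(* A crude lower bound, used to see that nets and families of levels have polynomial
   size. *)
Let near_hn : \forall n \near \oo, n%:R^-1 <= h n.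
Proof.
near=> n.
have h0 : 0 < h n by near: n.
have h1 : h n <= 1 by near: n; exact: near_h.
have ln1 : 1 <= ln n%:R :> R by near: n; exists 4%N => // n; exact: ln_ge1.
have n0 : 0 < n%:R :> R by near: n; exact: nbhs_infty_gtr.
have m0 : 0 < n%:R * h n ^+ d by rewrite mulr_gt0// exprn_gt0.
have : ln n%:R / (n%:R * h n ^+ d) <= 1 by near: n; exact: near_ln.
rewrite ler_pdivrMr// mul1r => lnm.
rewrite -[leLHS]mul1r ler_pdivrMr// [leRHS]mulrC; apply: le_trans ln1 _.
apply: le_trans lnm _; rewrite ler_pM2l//.
by rewrite -[leRHS]expr1 ler_wiXn2l// ltW.
Unshelve. all: by end_near. Qed.

Let net_size_le (b g : R) n : 0 <= b -> 0 < g -> 1 <= n%:R :> R -> n%:R^-1 <= g ->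
  (b / g + 1) ^+ d <= ((b + 1) * n%:R) ^+ d.
Proof.
move=> b0 g0 n1 ng; have n0 : 0 < n%:R :> R by exact: lt_le_trans n1.
have g0' := ltW g0; apply: lerXn2r; rewrite ?nnegrE.
- by rewrite addr_ge0// divr_ge0.
- by rewrite mulr_ge0 ?addr_ge0.
rewrite mulrDl mul1r; apply: lerD => //; apply: ler_wpM2l => //.
by rewrite -[leRHS]invrK lef_pV2 ?posrE ?invr_gt0.
Qed.

Let near_low (eps : R) : 0 < eps -> \forall n \near \oo, exists E,
  [/\ measurable E, (P E <= eps%:E)%E &
   forall w, ~ E w -> forall x, X0 x -> low_counts n (h n) w x].
Proof.
move=> eps0; pose S := (Num.truncn s).+1; pose a := (d + S)%N.
have tau0 : 0 < tau by exact: lt_le_trans tau1.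
pose Clow := 2 * #|I|%:R * (4 / (c * tau)) * (4 * BX / e + 1) ^+ d.
have c1tau : 0 < c1 * tau by exact: mulr_gt0.
near=> n.
have h0 : 0 < h n by near: n.
have h1 : h n <= 1 by near: n; exact: near_h.
have hr : h n <= rho / 2 by near: n; apply: near_h; exact: divr_gt0.
have n0 : 0 < n%:R :> R by near: n; exact: nbhs_infty_gtr.
have n0' : (0 < n)%N by rewrite -(ltr0n R).
have n1 : 1 <= n%:R :> R by rewrite ler1n.
have nh : n%:R^-1 <= h n by near: n; exact: near_hn.
have hA : (a.+1%:R / (c1 * tau)) * ln n%:R <= n%:R * h n ^+ d * h n `^ s by near: n.
have fin : Clow * n%:R ^+ a * expR (- (a.+1%:R * ln n%:R)) <= eps.
  by near: n; exact: poly_exp_small.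
have H0 : 0 < h n `^ s by exact: powR_gt0.
have tH0 : 0 < tau * h n `^ s by exact: mulr_gt0.
have ctH0 : 0 < c * (tau * h n `^ s) by exact: mulr_gt0.
set J := Num.truncn (4 / (c * (tau * h n `^ s))).
have J0 : 0 <= 4 / (c * (tau * h n `^ s)) by apply/ltW; exact: divr_gt0.
have tP j : (j < J)%N -> 0 < c * (j.+1%:R * (tau * h n `^ s)) / 4 /\
    c * (j.+1%:R * (tau * h n `^ s)) / 4 <= 1 /\
    tau * h n `^ s <= j.+1%:R * (tau * h n `^ s).
  move=> jJ; split; first by apply: divr_gt0 => //; apply: mulr_gt0 => //; exact: mulr_gt0.
  split; last by rewrite -[leLHS]mul1r ler_pM2r// ler1n.
  rewrite ler_pdivrMr// mul1r mulrCA -ler_pdivlMr//.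
  by move: jJ; rewrite /J truncn_ge_nat.
have inS b x : X0 x -> box (x + h n *: pt b) (h n * e / 2) `<=` supp.
  move=> Xx; apply: subset_trans (X0rho Xx); apply: subset_box => i.
  rewrite !mxE addrAC subrr add0r normrM (gtr0_norm h0).
  have := box0_coord (pt1 b) i => pi1.
  have g1 : h n * `|pt b 0 i| <= h n * 1 by rewrite ler_pM2l.
  have g2 : h n * e <= h n * 1 by rewrite ler_pM2l.
  lra.
have [E [mE PE lowE]] := lower_event iidXY mq cl0 BX0 X0B cells n e_gt0 c_gt0 h0
  (ltW tH0) tP inS.
have rE0 : 0 < 2 * BX / (h n * e / 2).
  by apply: divr_gt0; [exact: mulr_gt0|apply: divr_gt0 => //; exact: mulr_gt0].
have he : (h n * e / 2) ^+ d = h n ^+ d * (e / 2) ^+ d by rewrite -mulrA exprMn.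
exists E; split => //.
  apply: le_trans PE _; rewrite lee_fin; apply: le_trans fin.
  apply: ler_pM.
  - by rewrite !mulr_ge0// exprn_ge0// addr_ge0// ltW.
  - exact: expR_ge0.
  - rewrite [leRHS](_ : _ = (2 * #|I|%:R * ((4 / (c * tau)) * n%:R ^+ S)) *
        ((4 * BX / e + 1) * n%:R) ^+ d); last first.
      by rewrite /Clow /a exprD exprMn; ring.
    apply: ler_pM; first by rewrite mulr_ge0 ?mulr_ge0.
    + by apply: exprn_ge0; rewrite addr_ge0 ?(ltW rE0).
    + rewrite ler_wpM2l ?mulr_ge0//.
      have : J%:R <= 4 / (c * (tau * h n `^ s)) by rewrite truncn_le.
      move=> /le_trans; apply; rewrite mulrA invfM mulrA.
      rewrite ler_pM2l; last by apply: divr_gt0 => //; exact: mulr_gt0.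
      exact: inv_powR_le.
    + rewrite (_ : 2 * BX / (h n * e / 2) = 4 * BX / e / h n); last first.
        by field; rewrite !gt_eqF.
      apply: net_size_le => //; apply: divr_ge0; last exact: ltW.
      by rewrite mulr_ge0// ltW.
  - rewrite ler_expR lerN2.
    rewrite (_ : n%:R * _ / 4 = c1 * tau * (n%:R * h n ^+ d * h n `^ s)); last first.
      by rewrite he /c1; move: ((e / 2) ^+ d) => ?; field.
    rewrite -ler_pdivrMl//; apply: le_trans hA.
    by rewrite mulrA [_^-1 * _]mulrC.
move=> w Ew x Xx b j jJ; have := lowE w Ew x b j Xx jJ.
rewrite (_ : n%:R * _ / 4 = n%:R * h n ^+ d * c1 * (j.+1%:R * (tau * h n `^ s)))//.
by rewrite he /c1; move: ((e / 2) ^+ d) => ?; field.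
Unshelve. all: by end_near. Qed.

Let near_up (eps : R) : 0 < eps -> \forall n \near \oo, exists E,
  [/\ measurable E, (P E <= eps%:E)%E & forall w, ~ E w -> forall x, X0 x ->
   cnt XYs (cell_abs q x (h n * B) (Cb * h n `^ s)) n w <=
     n%:R * h n ^+ d * c2 * (Cb * h n `^ s)].
Proof.
move=> eps0; pose k := cu * (B + 1) ^+ d * Cb.
have B10 : 0 < B + 1 by exact: addr_gt0.
have k0 : 0 < k by apply: mulr_gt0 => //; apply: mulr_gt0 => //; exact: exprn_gt0.
near=> n.
have h0 : 0 < h n by near: n.
have hr : h n <= rho / (B + 1) by near: n; apply: near_h; exact: divr_gt0.
have hC : h n `^ s <= Cb^-1 by near: n; apply: near_H; rewrite invr_gt0.
have n0 : 0 < n%:R :> R by near: n; exact: nbhs_infty_gtr.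
have n1 : 1 <= n%:R :> R by rewrite ler1n -(ltr0n R).
have nh : n%:R^-1 <= h n by near: n; exact: near_hn.
have hA : (d.+1%:R / k) * ln n%:R <= n%:R * h n ^+ d * h n `^ s by near: n.
have fin : (2 * BX + 1) ^+ d * n%:R ^+ d * expR (- (d.+1%:R * ln n%:R)) <= eps.
  by near: n; exact: poly_exp_small.
have H0 : 0 < h n `^ s by exact: powR_gt0.
have be0 : 0 < Cb * h n `^ s by exact: mulr_gt0.
have be1 : Cb * h n `^ s <= 1 by rewrite -ler_pdivlMl// mulr1.
have inS x : X0 x -> box x (h n * (B + 1)) `<=` supp.
  move=> Xx; apply: subset_trans (X0rho Xx); apply: subset_box => i.
  by rewrite subrr normr0 add0r -ler_pdivlMr.
have [E [mE PE upE]] := upper_event iidXY mq BX0 X0B cells n B0 h0 be0 be1 inS.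
exists E; split => //.
  apply: le_trans PE _; rewrite lee_fin; apply: le_trans fin.
  apply: ler_pM; rewrite ?expR_ge0//.
  - by rewrite exprn_ge0// addr_ge0// divr_ge0 ?mulr_ge0// ltW.
  - by rewrite -exprMn; apply: net_size_le => //; rewrite mulr_ge0// ltW.
  - rewrite ler_expR lerN2.
    rewrite (_ : n%:R * _ = k * (n%:R * h n ^+ d * h n `^ s)); last first.
      by rewrite /k exprMn; ring.
    rewrite -ler_pdivrMl//; apply: le_trans hA.
    by rewrite mulrA [_^-1 * _]mulrC.
move=> w Ew x Xx; apply: le_trans (upE w Ew x Xx) _.
by rewrite /c2 exprMn; apply: le_of_eq; ring.
Unshelve. all: by end_near. Qed.

Let M_ge0 : 0 <= M.
Proof.
by rewrite addr_ge0// !mulr_ge0// ?exprn_ge0// ltW// (lt_le_trans ltr01).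
Qed.

Let PXbox y r : 0 < r -> box y r `<=` supp ->
  (P (X @^-1` box y r) <= (cu * r ^+ d)%:E)%E.
Proof. by move=> r0 yr; have [] := cells r0 yr. Qed.

Let W_supp v z : moment_kernel v z != 0 -> box 0 B z.
Proof. by rewrite /moment_kernel mulf_eq0 negb_or => /andP[/K_supp]. Qed.

Let near_score (eps : R) : 0 < eps -> \forall n \near \oo, exists E,
  [/\ measurable E, (P E <= eps%:E)%E & forall w, ~ E w -> forall x v, X0 x ->
   `|scores n (h n) v x w| <= (M + 1) * Num.sqrt (ln n%:R * (n%:R * h n ^+ d))].
Proof.
move=> eps0; have CW0 : 0 < CW by exact: lt_le_trans CW1.
pose k := 2 * BX * CW + 1.
have k0 : 0 < k by rewrite addr_gt0// !mulr_gt0.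
near=> n.
have h0 : 0 < h n by near: n.
have h1 : h n <= 1 by near: n; exact: near_h.
have hr : h n <= rho / B by near: n; apply: near_h; exact: divr_gt0.
have n0 : 0 < n%:R :> R by near: n; exact: nbhs_infty_gtr.
have n1 : 1 <= n%:R :> R by rewrite ler1n -(ltr0n R).
have ln1 : 1 <= ln n%:R :> R by near: n; exists 4%N => // n; exact: ln_ge1.
have nh : n%:R^-1 <= h n by near: n; exact: near_hn.
have lm1 : ln n%:R / (n%:R * h n ^+ d) <= 1 by near: n; exact: near_ln.
have lmC : ln n%:R / (n%:R * h n ^+ d) <= (2 * CW)^-1 ^+ 2.
  by near: n; apply: near_ln; rewrite exprn_gt0// invr_gt0 mulr_gt0.
have fin : 2 * Pn * k ^+ d * n%:R ^+ (2 * d) * expR (- ((2 * d).+1%:R * ln n%:R)) <= eps.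
  by near: n; exact: poly_exp_small.
set m := n%:R * h n ^+ d in lm1 lmC *.
have m0 : 0 < m by rewrite mulr_gt0// exprn_gt0.
have ln0 : 0 < ln n%:R :> R by exact: lt_le_trans ln1.
pose eta := Num.sqrt (ln n%:R / m).
have eta0 : 0 < eta by rewrite sqrtr_gt0 divr_gt0.
have eta2 : eta ^+ 2 * m = ln n%:R.
  by rewrite sqr_sqrtr ?divfK ?gt_eqF// divr_ge0 ?ltW.
have etam : eta * m = Num.sqrt (ln n%:R * m).
  have e0 : 0 <= eta * m by rewrite mulr_ge0 ?ltW.
  rewrite -[LHS]ger0_norm// -sqrtr_sqr; congr Num.sqrt.
  by rewrite exprMn [m ^+ 2]expr2 mulrA eta2.
have etaC : eta * CW <= 2^-1.
  have : eta <= (2 * CW)^-1.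
    rewrite -[leRHS]ger0_norm ?invr_ge0 ?mulr_ge0 ?(ltW CW0)//.
    by rewrite -sqrtr_sqr ler_wsqrtr.
  by rewrite invfM -ler_pdivlMr.
have sq1 : 1 <= Num.sqrt (ln n%:R * m).
  rewrite -[leLHS]sqrtr1 ler_wsqrtr//.
  have : ln n%:R <= m by move: lm1; rewrite ler_pdivrMr// mul1r.
  move=> lnm; have m1 : 1 <= m by exact: le_trans lnm.
  by rewrite -[leLHS]mulr1; apply: ler_pM.
(* With this step the scores vary by at most 1 between points of the net. *)
pose delta := h n / (n%:R * CW).
have nCW : 1 <= n%:R * CW by rewrite -[leLHS]mulr1; apply: ler_pM.
have nCW0 : 0 < n%:R * CW by exact: mulr_gt0.
have de0 : 0 < delta by exact: divr_gt0.
have deh : delta <= h n by rewrite ler_pdivrMr// ler_peMr// ltW.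
have inS x : X0 x -> box x (h n * B) `<=` supp.
  move=> Xx; apply: subset_trans (X0rho Xx); apply: subset_box => i.
  by rewrite subrr normr0 add0r -ler_pdivlMr.
have [E [mE PE scE]] := score_event iidXY mq BX0 X0B alpha01 PXbox Pq B0 mW
  W_le W_supp W_lip n M h0 de0 deh eta0 etaC inS.
exists E; split => //.
  apply: le_trans PE _; rewrite lee_fin; apply: le_trans fin.
  rewrite -/m eta2 /M [X in expR (- (X * _))]addrC addKr.
  apply: ler_wpM2r; first exact: expR_ge0.
  rewrite [X in _ <= X](_ : _ = 2 * Pn * (k * n%:R ^+ 2) ^+ d); last first.
    by rewrite exprMn -exprM mulrA.
  have b0 : 0 <= 2 * BX * CW * n%:R by rewrite !mulr_ge0// ltW.
  rewrite (_ : 2 * BX / delta = 2 * BX * CW * n%:R / h n); last first.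
    by rewrite /delta; field; rewrite !gt_eqF.
  apply: ler_wpM2l; first by rewrite mulr_ge0// ltW.
  apply: le_trans (net_size_le b0 h0 n1 nh) _.
  apply: lerXn2r.
  - by rewrite nnegrE mulr_ge0 ?addr_ge0.
  - by rewrite nnegrE mulr_ge0 ?(ltW k0) ?sqr_ge0.
  by rewrite expr2 mulrA ler_wpM2r// /k [leRHS]mulrDl mul1r lerD2l.
move=> w Ew x v Xx; apply: le_trans (scE w Ew x v Xx) _.
rewrite -/m -mulrA etam [X in _ <= X]mulrDl mul1r lerD2l.
apply: le_trans sq1; apply: le_of_eq.
by rewrite /delta; field; rewrite !gt_eqF.
Unshelve. all: by end_near. Qed.

(** The scores are kept in the bound, next to their uniform size: the uniform size suffices
    for the uniform rate, and for the integrated rate the scores are averaged over X0. *)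
Lemma uniform_error_event : exists2 C : R, 0 < C & forall eps : R, 0 < eps ->
  \forall n \near \oo, exists E,
  [/\ measurable E, (P E <= eps%:E)%E & forall w, ~ E w -> forall x, X0 x ->
   (forall v, `|scores n (h n) v x w| <=
     C * Num.sqrt (ln n%:R * (n%:R * h n ^+ d))) /\
   (forall v, `|h n ^+ mi_size (mi_of v) * (bhat n w (h n) x v - bs x v)| <=
     C * ((\sum_u `|scores n (h n) u x w|) / (n%:R * h n ^+ d) + h n `^ s))].
Proof.
have tau0 : 0 < tau by exact: lt_le_trans tau1.
have M1 : 0 < M + 1 by rewrite ltr_wpDl.
pose C := M + 1 + c3^-1 + tau.
have c3V : 0 < c3^-1 by rewrite invr_gt0.
have CM : M + 1 <= C by apply: (@le_trans _ _ (M + 1 + c3^-1)); rewrite /C lerDl ltW.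
have C3 : c3^-1 <= C by rewrite /C addrAC lerDr; apply/ltW/addr_gt0.
have Ct : tau <= C by rewrite /C lerDr; apply/ltW/addr_gt0.
exists C; first by apply: addr_gt0 => //; exact: addr_gt0.
move=> eps eps0; have eps3 : 0 < eps / 3 by exact: divr_gt0.
pose eta1 := 2 / c / (Pn * (M + 1) / c3).
have PM0 : 0 < Pn * (M + 1) / c3 by apply: divr_gt0 => //; exact: mulr_gt0.
have cc0 : 0 < 2 / c by exact: divr_gt0.
have eta10 : 0 < eta1 by exact: divr_gt0.
have side : \forall n \near \oo, [/\ 0 < h n, h n <= rho / B,
    h n `^ s <= 2 / c / tau, 0 < n%:R :> R &
    ln n%:R / (n%:R * h n ^+ d) <= eta1 ^+ 2].
  near=> n; split; first by near: n.
  - by near: n; apply: near_h; exact: divr_gt0.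
  - by near: n; apply: near_H; exact: divr_gt0.
  - by near: n; exact: nbhs_infty_gtr.
  - by near: n; apply: near_ln; exact: exprn_gt0.
apply: filterS3 (filterI side (near_low eps3)) (near_up eps3) (near_score eps3).
move=> n [[h0 hr hH n0 lm] [E1 [mE1 PE1 E1P]]] [E2 [mE2 PE2 E2P]] [E3 [mE3 PE3 E3P]].
have n0' : (0 < n)%N by rewrite -(ltr0n R).
set m := n%:R * h n ^+ d in lm E1P E2P E3P *.
have m0 : 0 < m by rewrite mulr_gt0// exprn_gt0.
exists (E1 `|` E2 `|` E3); split.
- by apply: measurableU => //; exact: measurableU.
- apply: le_trans (measureU2 _ _ _) _ => //; first exact: measurableU.
  rewrite (_ : eps = eps / 3 + eps / 3 + eps / 3); last by field.
  rewrite EFinD leeD// EFinD; apply: le_trans (measureU2 _ _ _) _ => //.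
  exact: leeD.
move=> w Ew x Xx.
have nE1 : ~ E1 w by move=> ?; apply: Ew; left; left.
have nE2 : ~ E2 w by move=> ?; apply: Ew; left; right.
have nE3 : ~ E3 w by move=> ?; apply: Ew; right.
split=> [v|].
  apply: le_trans (E3P w nE3 x v Xx) _; by rewrite ler_wpM2r ?sqrtr_ge0.
set Sg := \sum_u _.
have Sg0 : 0 <= Sg by apply: sumr_ge0.
pose r := Sg / (m * c3).
have mc3 : 0 < m * c3 by exact: mulr_gt0.
have r0 : 0 <= r by rewrite divr_ge0// ltW.
have Sgle : Sg <= Pn * ((M + 1) * Num.sqrt (ln n%:R * m)).
  apply: (@le_trans _ _ (\sum_(u : mindex d p) (M + 1) * Num.sqrt (ln n%:R * m))).
    by apply: ler_sum => u _; exact: E3P.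
  by rewrite sumr_const -[leLHS]mulr_natl.
have sqm : Num.sqrt (ln n%:R * m) <= eta1 * m.
  have em0 : 0 <= eta1 * m by rewrite mulr_ge0// ltW.
  rewrite -[leRHS]ger0_norm// -sqrtr_sqr ler_wsqrtr// exprMn [m ^+ 2]expr2.
  by rewrite [X in _ <= X]mulrA ler_pM2r// -ler_pdivrMr.
have r_le : r <= 2 / c.
  rewrite ler_pdivrMr//; apply: le_trans Sgle _.
  have -> : 2 / c * (m * c3) = Pn * ((M + 1) * (eta1 * m)).
    by rewrite /eta1; field; rewrite !gt_eqF.
  rewrite ler_wpM2l ?(ltW Pn0)// ler_wpM2l ?(ltW M1)//.
have tH : tau * h n `^ s <= 2 / c.
  by move: hH; rewrite ler_pdivlMr// mulrC.
have rt : r + tau * h n `^ s <= 4 / c.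
  by rewrite (_ : 4 / c = 2 / c + 2 / c) ?lerD//; field; rewrite gt_eqF.
have hB : h n * B <= rho by rewrite -ler_pdivlMr.
have Sr u : `|scores n (h n) u x w| <= n%:R * h n ^+ d * c3 * r.
  rewrite -/m /r mulrC divfK ?gt_eqF//.
  by rewrite /Sg (bigD1 u)//= lerDl sumr_ge0.
move=> v; apply: le_trans (error_bound_on_counts n0' h0 hB Xx r0 rt Sr _ _ v) _.
- exact: E1P.
- exact: E2P.
rewrite mulrDr; apply: lerD.
  by rewrite /r invfM mulrA mulrC ler_wpM2r// divr_ge0// ltW.
by rewrite ler_wpM2r ?powR_ge0.
Unshelve. all: by end_near. Qed.

End estimation.

(** * Iterated partial derivatives and local coefficients *)

Section smooth.
Context {R : realType} {d : nat}.
Implicit Types (A C : set 'rV[R]_d) (g : 'rV[R]_d -> R).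

Lemma compact_interior_margin C A : compact C -> C `<=` interior A ->
  exists2 rho : R, 0 < rho & forall x, C x -> box x rho `<=` interior A.
Proof.
move=> /compact_near_coveringP cC CA.
have H : \forall r \near (0 : R)^'+, C `<=` (fun x => box x r `<=` interior A).
  apply: (cC R (0^'+) (fun r x => box x r `<=` interior A)) => x /CA xA.
  have [e e0 eA] := nbhs_box (open_nbhs_nbhs (conj (open_interior A) xA)).
  have e2 : 0 < e / 2 by exact: divr_gt0.
  near=> x' r; apply: subset_trans eA; apply: subset_box => i.
  have : box x (e / 2) x' by near: x'; exact: box_nbhs.
  move=> /(_ i) xi; have re : r <= e / 2 by near: r; exact: nbhs_right_le.
  by rewrite [leRHS]splitr; exact: lerD.
near (0 : R)^'+ => r; exists r => //; near: r; exact: H.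
Unshelve. all: by end_near. Qed.

Let add_index (w : {ffun 'I_d -> nat}) i m := iter m (fun u => mi_succ u i) w.

Let add_indexE w i m j : add_index w i m j = (w j + m * (j == i))%N.
Proof.
by elim: m => [|m ih]; rewrite ?mul0n ?addn0// /= ffunE -/(add_index w i m) ih; lia.
Qed.

Let mi_size_add_index w i m : mi_size (add_index w i m) = (mi_size w + m)%N.
Proof. by elim: m => [|m ih] /=; rewrite ?addn0// mi_size_succ ih addnS. Qed.

(** Partial derivatives only depend on the germ of a function, and on the interior each of
    them is again one of the functions G. *)
Lemma mpartial_derivatives_on A k g G v x : derivatives_on A k g G ->
  (mi_size v <= k)%N -> interior A x -> mpartial v g x = G v x.
Proof.
move=> [G0 _ GD] vk xA.
have step u i f : (mi_size u < k)%N -> (forall y, interior A y -> f y = G u y) ->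
    forall y, interior A y -> partial i f y = G (mi_succ u i) y.
  move=> uk fG y yA; have yG := GD u i y uk yA.
  rewrite /partial (@near_eq_derive R _ _ f (G u)); first exact: derive_val.
  by near=> z; apply: fG; near: z; exact: (open_nbhs_nbhs (conj (open_interior A) yA)).
have steps u i m f : (mi_size u + m <= k)%N -> (forall y, interior A y -> f y = G u y) ->
    forall y, interior A y -> iter m (partial i) f y = G (add_index u i m) y.
  move=> + fG; elim: m => [|m ih] um y yA; first exact: fG.
  apply: (step (add_index u i m)) => //; first by rewrite mi_size_add_index -addnS.
  by apply: ih; apply: leq_trans um; rewrite leq_add2l.
pose fold (l : seq 'I_d) := foldr (fun i w => add_index w i (v i)) mi0 l.
have foldE l j : fold l j = (v j * count_mem j l)%N.
  elim: l => [|i l ih]; first by rewrite /= ffunE muln0.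
  rewrite /= add_indexE -/(fold l) ih mulnDr addnC eq_sym.
  by case: eqVneq => [->|]; rewrite ?muln0.
have fold_enum : fold (enum 'I_d) = v.
  by apply/ffunP => j; rewrite foldE count_uniq_mem ?enum_uniq// mem_enum muln1.
have foldP l : (mi_size (fold l) <= k)%N -> forall y, interior A y ->
    foldr (fun i => iter (v i) (partial i)) g l y = G (fold l) y.
  elim: l => [_ y yA|i l ih].
    by rewrite /= G0//; exact: interior_subset.
  rewrite [fold _]/= -/(fold l) mi_size_add_index => lk y yA.
  apply: steps => //; apply: ih; exact: leq_trans (leq_addr _ _) lk.
by rewrite -[in RHS]fold_enum; apply: foldP => //; rewrite fold_enum.
Unshelve. all: by end_near. Qed.

(** Padded by zeros, because the local polynomial may have a larger order than the Taylor
    polynomial. *)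
Definition taylor_coef p k (c : {ffun 'I_d -> nat} -> R) : {ffun mindex d p -> R} :=
  [ffun u => if (mi_size (mi_of u) <= k)%N then c (mi_of u) else 0].

Lemma lp_value_taylor_coef p k c (x z : 'rV[R]_d) :
  lp_value (taylor_coef p k c) (z - x) = taylor_poly p k c x mi0 z.
Proof.
rewrite /lp_value /taylor_poly [RHS]big_mkcond; apply: eq_bigr => u _.
rewrite /taylor_coef !ffunE mi_add0l.
have -> : mi_size (mi0 : {ffun 'I_d -> nat}) = 0%N by apply/eqP; rewrite mi_size_eq0.
by rewrite addn0; case: ifP; rewrite ?mulr0.
Qed.

End smooth.

(** * Bandwidths and rates *)

Section bandwidths.
Context {R : realType} (d : nat).
Implicit Types (h a r : nat -> R).

Lemma bandwidth_limits h : bandwidth (d := d) h ->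
  [/\ \forall n \near \oo, 0 < h n, h n @[n --> \oo] --> (0 : R) &
      ln n%:R / (n%:R * h n ^+ d) @[n --> \oo] --> (0 : R)].
Proof.
move=> [hlo [hup [hlu hup0 hlo0]]]; split.
- by exists 1%N => // n /= n0; have [l0 /andP[l1 _]] := hlu n n0; exact: lt_le_trans l1.
- apply: (@squeeze_cvgr _ _ _ _ (fun=> 0) hup) => //; last exact: cvg_cst.
  by exists 1%N => // n /= n0; have [l0 /andP[l1 ->]] := hlu n n0;
    rewrite andbT (le_trans (ltW l0)).
- apply: squeeze_cvgr (cvg_cst 0) hlo0.
  exists 4%N => // n /= n4; have n0 : (0 < n)%N by lia.
  have [l0 /andP[l1 _]] := hlu n n0; have h0 := lt_le_trans l0 l1.
  have nR : 0 < n%:R :> R by rewrite ltr0n.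
  have ln0 : 0 <= ln n%:R :> R by rewrite (le_trans ler01)// ln_ge1.
  apply/andP; split; first by rewrite divr_ge0// mulr_ge0 ?exprn_ge0 ?(ltW h0)// ltW.
  apply: ler_wpM2l => //; rewrite lef_pV2 ?posrE ?mulr_gt0 ?exprn_gt0//.
  by rewrite ler_pM2l//; apply: lerXn2r; rewrite ?nnegrE ?(ltW l0) ?(ltW h0).
Qed.

Lemma asymp_prop_bounds h a : asymp_prop h a -> (\forall n \near \oo, 0 < a n) ->
  exists2 c : R, 0 < c & \forall n \near \oo, a n <= c * h n /\ h n <= c * a n.
Proof.
move=> [c c0 ha] a0; exists (2 * c + 2 / c).
  by apply: addr_gt0; [exact: mulr_gt0|exact: divr_gt0].
have hl : \forall n \near \oo, c / 2 <= h n / a n.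
  by apply: cvgr_ge ha _ _; rewrite ltr_pdivrMr// ltr_pMr// ltr1n.
have hu : \forall n \near \oo, h n / a n <= 2 * c.
  by apply: cvgr_le ha _ _; rewrite ltr_pMl// ltr1n.
near=> n.
have an : 0 < a n by near: n.
have h1 : c / 2 <= h n / a n by near: n.
have h2 : h n / a n <= 2 * c by near: n.
move: h1 h2; rewrite ler_pdivlMr// ler_pdivrMr// => h1 h2.
have c2 : 0 < 2 / c by exact: divr_gt0.
have hn : 0 < h n by apply: lt_le_trans h1; rewrite mulr_gt0// divr_gt0.
split.
  rewrite mulrDl; apply: ler_wpDl; first by rewrite !mulr_ge0// ltW.
  by rewrite -ler_pdivrMl// invf_div.
rewrite mulrDl; apply: ler_wpDr => //.
by apply: mulr_ge0; exact: ltW.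
Unshelve. all: by end_near. Qed.

Lemma ln_powR_small (g eps : R) : 0 < g -> 0 < eps ->
  \forall n \near \oo, ln n%:R * n%:R^-1 `^ g <= eps.
Proof.
move=> g0 e0; have g2 : 0 < g / 2 by exact: divr_gt0.
have ge : 0 < eps * (g / 2) by exact: mulr_gt0.
have [del del0 delP] := powR_small g2 ge.
near=> n.
have n0 : 0 < n%:R :> R by near: n; exact: nbhs_infty_gtr.
have nd : n%:R^-1 <= del.
  rewrite -[leRHS]invrK lef_pV2 ?posrE ?invr_gt0//.
  by apply: ltW; near: n; exact: nbhs_infty_gtr.
have lnn : ln n%:R <= (g / 2)^-1 * n%:R `^ (g / 2).
  rewrite ler_pdivlMl// -ln_powR; apply: ltW; apply: ln_sublinear.
  exact: powR_gt0.
have gE : g = g / 2 + g / 2 by field.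
apply: (@le_trans _ _ ((g / 2)^-1 * n%:R `^ (g / 2) * n%:R^-1 `^ g)).
  by apply: ler_wpM2r => //; exact: powR_ge0.
have -> : n%:R^-1 `^ g = n%:R^-1 `^ (g / 2) * n%:R^-1 `^ (g / 2).
  by rewrite [in LHS]gE powRD// invr_eq0 (gt_eqF n0) implybT.
rewrite -mulrA [X in _ * X]mulrA -powRM ?invr_ge0 ?ler0n//.
rewrite mulfV ?gt_eqF// powR1 mul1r ler_pdivrMl// [leRHS]mulrC.
by apply: delP => //; rewrite invr_gt0.
Unshelve. all: by end_near. Qed.

Variable s : R.
Hypothesis s_gt0 : 0 < s.

Lemma rate_power h r t : 0 <= t -> (\forall n \near \oo, 0 < r n) ->
  (\forall n \near \oo, 0 < h n) ->
  asymp_prop h (fun n => r n `^ (2 * s + d%:R)^-1) ->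
  exists2 C : R, 0 < C &
    \forall n \near \oo, h n `^ t <= C * r n `^ (t / (2 * s + d%:R)).
Proof.
move=> t0 r0 h0 ha; have a0 : \forall n \near \oo, 0 < r n `^ (2 * s + d%:R)^-1.
  by near=> n; rewrite powR_gt0//; near: n.
have [c c0 cP] := asymp_prop_bounds ha a0.
exists (c `^ t); first exact: powR_gt0.
near=> n; have [_ hc] : r n `^ (2 * s + d%:R)^-1 <= c * h n /\
    h n <= c * r n `^ (2 * s + d%:R)^-1 by near: n.
have hn : 0 < h n by near: n.
rewrite [t / _]mulrC powRrM -powRM ?powR_ge0 ?(ltW c0)//.
by apply: ge0_ler_powR; rewrite ?nnegrE ?mulr_ge0 ?powR_ge0 ?(ltW c0) ?(ltW hn).
Unshelve. all: by end_near. Qed.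

(** The stochastic error sqrt(n r/(n h^d)) is at most of the order of the bias h^s; n r is
    1 for the integrated error and log n for the uniform error. *)
Lemma rate_balance h r : (\forall n \near \oo, 0 < r n) ->
  (\forall n \near \oo, 0 < h n) ->
  asymp_prop h (fun n => r n `^ (2 * s + d%:R)^-1) ->
  exists2 C : R, 0 < C &
    \forall n \near \oo, n%:R * r n <= C * (n%:R * h n ^+ d * (h n `^ s) ^+ 2).
Proof.
move=> r0 h0 ha; have a0 : \forall n \near \oo, 0 < r n `^ (2 * s + d%:R)^-1.
  by near=> n; rewrite powR_gt0//; near: n.
have sd0 : 0 < 2 * s + d%:R by have s0 := s_gt0; rewrite ltr_wpDr// mulr_gt0.
have [c c0 cP] := asymp_prop_bounds ha a0.
exists (c `^ (2 * s + d%:R)); first exact: powR_gt0.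
near=> n; have [ac _] : r n `^ (2 * s + d%:R)^-1 <= c * h n /\
    h n <= c * r n `^ (2 * s + d%:R)^-1 by near: n.
have hn : 0 < h n by near: n.
have rn : 0 < r n by near: n.
rewrite -[X in _ <= _ * X]mulrA mulrCA ler_wpM2l//.
have -> : h n ^+ d * h n `^ s ^+ 2 = h n `^ (2 * s + d%:R).
  rewrite -powR_mulrn ?(ltW hn)// -powR_mulrn ?powR_ge0// -powRrM [2 * s]mulrC addrC.
  by rewrite [RHS]powRD// (gt_eqF hn)/= implybT.
rewrite -powRM ?(ltW c0) ?(ltW hn)//.
have -> : r n = (r n `^ (2 * s + d%:R)^-1) `^ (2 * s + d%:R).
  by rewrite -powRrM mulVf ?gt_eqF// powRr1// ltW.
by apply: ge0_ler_powR; rewrite ?nnegrE ?mulr_ge0 ?powR_ge0 ?(ltW c0) ?(ltW hn) ?(ltW sd0).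
Unshelve. all: by end_near. Qed.

End bandwidths.

(** * The error in terms of normalized scores *)

Lemma box_lipschitz_continuous {R : realType} {d : nat} (f : 'rV[R]_d -> R) :
  box_lipschitz f -> continuous f.
Proof.
move=> lf x; pose B := \sum_i `|x 0 i| + 1.
have [C C0 [_ CP]] := lf B.
have xB e z : e <= 1 -> box x e z -> box 0 B z.
  move=> e1 zx i; rewrite mxE subr0 (_ : z 0 i = x 0 i + (z 0 i - x 0 i)); last by ring.
  apply: le_trans (ler_normD _ _) _; apply: lerD; last exact: le_trans (zx i) e1.
  by rewrite (bigD1 i)//= lerDl sumr_ge0.
move=> A /nbhs_ballP[eps /= eps0 epsA].
pose e := Num.min 1 (eps / 2 / (C + 1)).
have C1 : 0 < C + 1 by rewrite ltr_wpDl.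
have e0 : 0 < e by rewrite lt_min ltr01 !divr_gt0.
have e1 : e <= 1 by rewrite ge_min lexx.
apply: (@filterS _ (nbhs x) (nbhs_filter x) _ _ _ (box_nbhs x e0)) => z zx.
apply: epsA; apply: (@le_lt_trans _ _ (eps / 2)); last by rewrite ltr_pdivrMr// ltr_pMr// ltr1n.
rewrite distrC; apply: (@le_trans _ _ (C * e)).
  apply: CP => //; [exact: xB zx|apply: (xB 0) => // i|exact: ltW].
  by rewrite subrr normr0.
apply: (@le_trans _ _ ((C + 1) * e)).
  by apply: ler_wpM2r; rewrite ?(ltW e0)// lerDl.
by rewrite -ler_pdivlMl// mulrC ge_min lexx orbT.
Qed.

Section expansion.
Context {R : realType} {d p : nat} {dT : measure_display} {T : measurableType dT}.
Variables (P : probability T R).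
Variables (X : {RV P >-> 'rV[R]_d}) (Y : {RV P >-> R}).
Variables (Xs : nat -> {RV P >-> 'rV[R]_d}) (Ys : nat -> {RV P >-> R}).
Variables (kappa : R.-pker 'rV[R]_d ~> R) (al au : R) (X0 : set 'rV[R]_d)
  (K : 'rV[R]_d -> R) (h : nat -> R)
  (bhat : nat -> T -> R -> R -> 'rV[R]_d -> {ffun mindex d p -> R}) (L s : R).
Let supp := msupport (distribution P X).
Let Q := cquantile kappa.
Hypothesis d_gt0 : (0 < d)%N.
Hypothesis al_gt0 : 0 < al.
Hypothesis au_lt1 : au < 1.
Hypothesis iidXY : iid_copies P (fun w => (X w, Y w)) (fun i w => (Xs i w, Ys i w)).
Hypothesis XYcond : is_cond_law P X Y kappa.
Hypothesis bhat_lp : is_lp_estimator K Xs Ys al au bhat.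
Hypothesis L_gt0 : 0 < L.
Hypothesis s_gt0 : 0 < s.
Hypothesis Q_holder : holder_class supp al au L s Q.
Hypothesis s_le_p : (lowint s <= p)%N.
Hypothesis aX : assumption_X (distribution P X) X0.
Hypothesis aF : assumption_F kappa supp.
Hypothesis aK : assumption_K K.
Hypothesis hband : bandwidth (d := d) h.
Variable alpha : R.
Hypothesis alpha_itv : al <= alpha <= au.
Hypothesis h_fast : forall A : R,
  \forall n \near \oo, A * ln n%:R <= n%:R * h n ^+ d * h n `^ s.

Let sqm n := Num.sqrt (n%:R * h n ^+ d).

(** S is the family of the scores divided by sqrt(n h^d).  Both rates follow from these
    bounds by deterministic estimates, one with the pointwise bound on S, the other with
    the integrated one. *)
Lemma local_expansion : exists (S : nat -> mindex d p -> 'rV[R]_d -> T -> R) (C : R),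
 [/\ 0 < C,
  forall eps : R, 0 < eps -> \forall n \near \oo, exists E,
    [/\ measurable E, (P E <= eps%:E)%E & forall w, ~ E w -> forall x, X0 x ->
     (forall u, `|S n u x w| <= C * Num.sqrt (ln n%:R)) /\
     (forall v, (mi_size (mi_of v) <= lowint s)%N ->
       h n ^+ mi_size (mi_of v) *
         `|bhat n w alpha (h n) x v - mpartial (mi_of v) (Q alpha) x| <=
       C * ((\sum_u `|S n u x w|) / sqm n + h n `^ s))],
  forall n w, measurable_fun setT
    (fun x => \sum_u (expR (S n u x w) + expR (- S n u x w))) &
  forall eps : R, 0 < eps -> \forall n \near \oo, exists E,
    [/\ measurable E, (P E <= eps%:E)%E & forall w, ~ E w ->
     (\int[leb d]_(x in X0) (\sum_u (expR (S n u x w) + expR (- S n u x w)))%:E <=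
      (C / eps)%:E)%E]].
Proof.
have hal := al_gt0; have hau := au_lt1; have /andP[a1 a2] := alpha_itv.
have alpha01 : 0 < alpha < 1.
  by rewrite (lt_le_trans hal a1) (le_lt_trans a2 hau).
have alpha01' : 0 <= alpha <= 1 by have /andP[/ltW-> /ltW->] := alpha01.
have [G dG HG] := Q_holder alpha_itv.
have [G0 Gc GD] := dG.
have size0 : mi_size (mi0 : {ffun 'I_d -> nat}) = 0%N by apply/eqP; rewrite mi_size_eq0.
have cQ : {within supp, continuous Q alpha}.
  apply: (@subspace_eq_continuous _ _ _ (G mi0) (Q alpha)).
    by move=> x /set_mem /G0.
  by apply: Gc; rewrite size0.
have [q [cl [cu [[cl0 cu0] mq qE Pq cells]]]] := conditional_law_facts alpha01 XYcond aX aF cQ.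
have [B [KM [B0 KM0 Ksupp Kle Klip]]] := assumption_K_bounded d_gt0 aK.
have [Kge0 _ _ _ [K0 K00 Kge]] := aK.
have [_ _ cX0 X0supp] := aX.
have [BX BX0 X0B] := compact_coord_bounded cX0.
have [rho rho0 X0rho] := compact_interior_margin cX0 X0supp.
have mX0 : measurable X0.
  by apply: closed_measurable_rV; apply: compact_closed => //; exact: norm_hausdorff.
have Wlip (u : mindex d p) : box_lipschitz (moment_kernel K u).
  exact: box_lipschitzM Klip (box_lipschitz_lp_basis u).
have Wsupp (u : mindex d p) z : moment_kernel K u z != 0 -> box 0 B z.
  by rewrite mulf_eq0 negb_or => /andP[/Ksupp].
have mW (u : mindex d p) : measurable_fun setT (moment_kernel K u).
  apply: continuous_measurable_rV; exact: box_lipschitz_continuous.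
have /choice[Cu CuP] : forall u : mindex d p, exists Cu : R, 0 < Cu /\
    ((forall z, `|moment_kernel K u z| <= Cu) /\
     forall z z' e, 0 <= e -> e <= 1 -> box z' e z ->
       `|moment_kernel K u z - moment_kernel K u z'| <= Cu * e).
  by move=> u; have [C C0 CP] := box_lipschitz_support B0 (Wlip u) (@Wsupp u); exists C.
pose CW := 1 + \sum_u Cu u.
have CuW u : Cu u <= CW.
  rewrite /CW (bigD1 u)//= addrCA lerDl addr_ge0// sumr_ge0// => u' _.
  by have [/ltW] := CuP u'.
have CW1 : 1 <= CW.
  by rewrite lerDl sumr_ge0// => u _; have [/ltW] := CuP u.
have CW0 : 0 < CW by exact: lt_le_trans CW1.
have W_le (u : mindex d p) z : `|moment_kernel K u z| <= CW.
  by have [_ [H _]] := CuP u; exact: le_trans (H z) (CuW u).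
have W_lip (u : mindex d p) z z' e : 0 <= e -> e <= 1 -> box z' e z ->
    `|moment_kernel K u z - moment_kernel K u z'| <= CW * e.
  move=> e0 e1 zz'; have [_ [_ H]] := CuP u.
  by apply: le_trans (H _ _ _ e0 e1 zz') _; rewrite ler_wpM2r.
have dR : 0 < d%:R :> R by rewrite ltr0n.
have dV0 : 0 < (2 * d%:R)^-1 :> R by rewrite invr_gt0 mulr_gt0.
have dV1 : (2 * d%:R)^-1 <= 1 :> R.
  by rewrite invf_le1 ?mulr_gt0// -natrM ler1n muln_gt0.
have [I [pt [c [e [c0 e0 e_le pt_box pt_sep]]]]] := @lp_value_lower R d p _ dV0.
have pt1 a : box 0 1 (pt a).
  by apply: subset_box (pt_box a) => i; rewrite subrr normr0 add0r.
have pt_unit a z : box (pt a) e z -> enorm z <= 1.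
  move=> za; rewrite -(mulfV (lt0r_neq0 dR)); apply: enorm_le.
    by rewrite invr_ge0 ltW.
  move=> i; rewrite (_ : d%:R^-1 = (2 * d%:R)^-1 + (2 * d%:R)^-1); last first.
    by field; rewrite gt_eqF.
  rewrite (_ : z 0 i = (z 0 i - pt a 0 i) + pt a 0 i); last by ring.
  apply: le_trans (ler_normD _ _) _; apply: lerD; first exact: le_trans (za i) e_le.
  exact: box0_coord (pt_box a) i.
have /andP[ks _] := lowint_itv s_gt0.
have [CT CT0 CTP] := taylor_remainder s_le_p dG (ltW L_gt0) ks HG.
pose bs x := taylor_coef p (lowint s) (G ^~ x).
have bias x z r : X0 x -> 0 < r -> r <= rho -> box x r z ->
    `|q z - lp_value (bs x) (z - x)| <= CT * r `^ s.
  move=> Xx r0 rr xz; have xr : box x r `<=` interior supp.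
    apply: subset_trans (X0rho _ Xx); apply: subset_box => i.
    by rewrite subrr normr0 add0r.
  rewrite qE; last by apply: interior_subset; exact: xr.
  by rewrite lp_value_taylor_coef; exact: CTP.
have X0rho' x : X0 x -> box x rho `<=` supp.
  by move=> /X0rho xs; apply: subset_trans xs _; exact: interior_subset.
have bmin n w b x : 0 < b -> forall b' : {ffun mindex d p -> R},
    lp_criterion K n (Xs ^~ w) (Ys ^~ w) alpha b x (bhat n w alpha b x) <=
    lp_criterion K n (Xs ^~ w) (Ys ^~ w) alpha b x b'.
  by move=> b0; exact: bhat_lp.
have [h0 hcvg hln] := bandwidth_limits hband.
have [C C0 CP] := uniform_error_event iidXY mq cl0 cu0 BX0 rho0 X0B X0rho' alpha01' cells Pq
  Kge0 Kle Ksupp K00 Kge B0 CW1 mW W_le W_lip c0 e0 (le_trans e_le dV1) pt1 pt_unit pt_sep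
  s_gt0 CT0 bias bmin d_gt0 h0 hcvg hln h_fast.
pose S n (u : mindex d p) x w :=
  (sqm n)^-1 * score Xs Ys q alpha (moment_kernel K) n (h n) u x w.
pose C2 := #|{: mindex d p}|%:R * (2 * expR (2 * CW ^+ 2 * (cu * B ^+ d))) * (2 * BX) ^+ d.
have V0 : (0 < #|{: mindex d p}|)%N by apply/card_gt0P; exists (mi_mk mi0).
have C20 : 0 < C2.
  apply: mulr_gt0; last by rewrite exprn_gt0// mulr_gt0.
  by rewrite mulr_gt0 ?ltr0n// mulr_gt0// expR_gt0.
have sqm0 : \forall n \near \oo, 0 < sqm n.
  near=> n; rewrite sqrtr_gt0 mulr_gt0//; first by near: n; exact: nbhs_infty_gtr.
  by rewrite exprn_gt0//; near: n.
exists S, (C + C2); split; first exact: addr_gt0.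
- move=> eps eps0; have := CP eps eps0; apply: filterS3 sqm0 h0 => n m0 hn [E [mE PE EP]].
  exists E; split => // w Ew x Xx; have [H1 H2] := EP w Ew x Xx.
  have mE2 : n%:R * h n ^+ d = sqm n ^+ 2.
    rewrite sqr_sqrtr// ltW// -sqrtr_gt0; exact: m0.
  have CC : C <= C + C2 by rewrite lerDl ltW.
  have SE u : `|S n u x w| =
      (sqm n)^-1 * `|score Xs Ys q alpha (moment_kernel K) n (h n) u x w|.
    by rewrite /S normrM gtr0_norm ?invr_gt0.
  split=> [u|v vk].
    rewrite SE ler_pdivrMl//; apply: le_trans (H1 u) _.
    have ln0 : 0 <= ln n%:R :> R.
      case: (posnP n) => [->|np]; first by rewrite ln0.
      by rewrite ln_ge0// ler1n.
    rewrite sqrtrM// -/(sqm n) [leRHS]mulrC -mulrA ler_wpM2r//.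
    by rewrite mulr_ge0 ?sqrtr_ge0.
  have := H2 v; rewrite normrM (ger0_norm (exprn_ge0 _ (ltW hn))).
  rewrite {1}/bs ffunE vk -(mpartial_derivatives_on dG vk (X0supp _ Xx)).
  move=> /le_trans; apply; apply: ler_pM => //; first exact: ltW.
    by rewrite addr_ge0 ?powR_ge0// divr_ge0 ?sumr_ge0// mE2 sqr_ge0.
  rewrite lerD2r mE2; under [X in _ <= X / _]eq_bigr do rewrite SE.
  rewrite -mulr_sumr; apply: le_of_eq.
  by rewrite /scores; field; rewrite gt_eqF.
- move=> n w; apply: measurable_sum => u.
  have mS : measurable_fun setT (fun x => S n u x w).
    apply: measurable_funM => //.
    exact: (measurableT_comp (measurable_score Xs Ys alpha mq mW n (h n) u)
      (pair1_measurable w)).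
  by apply: measurable_funD; apply: measurableT_comp => //; exact: measurableT_comp.
move=> eps eps0.
near=> n.
have hn : 0 < h n by near: n.
have m0 : 0 < sqm n by near: n.
have n0 : 0 < n%:R :> R by near: n; exact: nbhs_infty_gtr.
have ln1 : 1 <= ln n%:R :> R by near: n; exists 4%N => // n; exact: ln_ge1.
have hB : h n <= rho / B.
  apply: le_trans (ler_norm _) _; near: n.
  by move/cvgr0Pnorm_le : hcvg; apply; exact: divr_gt0.
have lnm : ln n%:R / (n%:R * h n ^+ d) <= (2 * CW)^-1 ^+ 2.
  apply: le_trans (ler_norm _) _; near: n.
  by move/cvgr0Pnorm_le : hln; apply; rewrite exprn_gt0// invr_gt0 mulr_gt0.
have nh0 : 0 < n%:R * h n ^+ d by rewrite mulr_gt0// exprn_gt0.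
have m2 : sqm n ^+ 2 = n%:R * h n ^+ d by rewrite sqr_sqrtr// ltW.
have lW : `|(sqm n)^-1| * CW <= 2^-1.
  have mV : (sqm n)^-1 <= (2 * CW)^-1.
    rewrite -[leRHS]ger0_norm ?invr_ge0 ?mulr_ge0 ?(ltW CW0)//.
    rewrite -[leLHS]ger0_norm ?invr_ge0 ?(ltW m0)//.
    rewrite -!sqrtr_sqr ler_wsqrtr// exprVn m2; apply: le_trans lnm.
    by rewrite ler_peMl// invr_ge0 ltW.
  by rewrite gtr0_norm ?invr_gt0// -ler_pdivlMr// -invfM.
have inS x : X0 x -> box x (h n * B) `<=` supp.
  move=> Xx; apply: subset_trans (X0rho' _ Xx); apply: subset_box => i.
  by rewrite subrr normr0 add0r -ler_pdivlMr.
have PXbox y r : 0 < r -> box y r `<=` supp ->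
    (P (X @^-1` box y r) <= (cu * r ^+ d)%:E)%E.
  by move=> r0 yr; have [] := cells y r r0 yr.
have [E [mE PE EP]] := score_moments iidXY mq BX0 X0B alpha01' PXbox Pq B0 mW W_le
  Wsupp mX0 V0 n hn eps0 inS lW.
exists E; split => // w Ew; apply: le_trans (EP w Ew) _.
rewrite lee_fin ler_pM2r ?invr_gt0//.
rewrite (_ : n%:R * _ = 2 * CW ^+ 2 * (cu * B ^+ d)); first by rewrite lerDr ltW.
have hd0 : 0 < h n ^+ d by rewrite exprn_gt0.
by rewrite !exprMn exprVn m2; field; rewrite !gt_eqF.
Unshelve. all: by end_near. Qed.

End expansion.

(** * Rates of convergence *)

(** The factor rho is the size of the normalized scores in units of A: with A their sum
    and rho = 1 the bound stays pointwise, with A constant and rho = sqrt(log n) it is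
    uniform. *)
Lemma scaled_error {R : realType} (err Z A rho C C1 m s h : R) j :
  0 < h -> 0 < m -> 0 <= C -> 0 <= C1 -> 0 <= A -> 0 <= rho ->
  Z <= A * rho -> rho ^+ 2 <= C1 * (m * (h `^ s) ^+ 2) ->
  h ^+ j * err <= C * (Z / Num.sqrt m + h `^ s) ->
  err <= C * (A * Num.sqrt C1 + 1) * h `^ (s - j%:R).
Proof.
move=> h0 m0 C0 C10 A0 rho0 ZA rhoC herr; have H0 := powR_ge0 h s.
have sm0 : 0 < Num.sqrt m by rewrite sqrtr_gt0.
have rhoH : rho <= Num.sqrt C1 * Num.sqrt m * h `^ s.
  rewrite -(ger0_norm rho0) -sqrtr_sqr -[X in _ * X](ger0_norm H0) -sqrtr_sqr.
  rewrite -!sqrtrM ?mulr_ge0 ?(ltW m0)//; apply: ler_wsqrtr.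
  by rewrite -mulrA.
have ZH : Z / Num.sqrt m <= A * Num.sqrt C1 * h `^ s.
  rewrite ler_pdivrMr//; apply: le_trans ZA _.
  by apply: le_trans (ler_wpM2l A0 rhoH) _; rewrite !mulrA [leRHS]mulrAC.
have -> : h `^ (s - j%:R) = h `^ s / h ^+ j.
  by rewrite powRB ?powR_mulrn ?(ltW h0)//; apply/implyP => _; rewrite gt_eqF.
rewrite mulrA ler_pdivlMr ?exprn_gt0//.
rewrite mulrC; apply: le_trans herr _; rewrite -mulrA ler_wpM2l//.
by rewrite mulrDl mul1r lerD2r.
Qed.

(** Both calibrations make the bandwidth large enough for the uniform counting
    bounds: n h^d h^s dominates log n. *)
Lemma near_fast {R : realType} d (s : R) (h r : nat -> R) : 0 < s ->
  (\forall n \near \oo, 0 < r n) -> (\forall n \near \oo, 0 < h n) ->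
  asymp_prop h (fun n => r n `^ (2 * s + d%:R)^-1) ->
  (forall eps : R, 0 < eps ->
    \forall n \near \oo, ln n%:R * r n `^ (s / (2 * s + d%:R)) <= eps * (n%:R * r n)) ->
  forall A : R, \forall n \near \oo, A * ln n%:R <= n%:R * h n ^+ d * h n `^ s.
Proof.
move=> s0 r0 h0 ha small A.
have [C C0 CP] := rate_power (ltW s0) r0 h0 ha.
have [C1 C10 C1P] := rate_balance s0 r0 h0 ha.
have A0 : 0 < `|A| + 1 by rewrite ltr_wpDl.
have e0 : 0 < ((`|A| + 1) * C * C1)^-1 by rewrite invr_gt0 !mulr_gt0.
have smn0 := small _ e0; near=> n.
have hn : 0 < h n by near: n.
have H0 : 0 < h n `^ s by exact: powR_gt0.
have n1 : 1 <= n%:R :> R by near: n; exists 1%N => // n; rewrite /= ler1n.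
have ln0 : 0 <= ln n%:R :> R by rewrite ln_ge0.
have hC : h n `^ s <= C * r n `^ (s / (2 * s + d%:R)) by near: n.
have hC1 : n%:R * r n <= C1 * (n%:R * h n ^+ d * (h n `^ s) ^+ 2) by near: n.
have smn : ln n%:R * r n `^ (s / (2 * s + d%:R)) <=
    ((`|A| + 1) * C * C1)^-1 * (n%:R * r n) by near: n.
apply: (@le_trans _ _ ((`|A| + 1) * ln n%:R)).
  by rewrite ler_wpM2r// (le_trans (ler_norm A))// lerDl.
rewrite -(ler_pM2r H0); apply: (@le_trans _ _ ((`|A| + 1) * C * (ln n%:R * r n `^ (s / (2 * s + d%:R))))).
  rewrite -!mulrA ler_pM2l// mulrCA ler_wpM2l//.
apply: (@le_trans _ _ (C1^-1 * (n%:R * r n))).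
  apply: le_trans (ler_wpM2l _ smn) _; first by rewrite mulr_ge0// ltW.
  apply: le_of_eq.
  by field; rewrite !gt_eqF.
rewrite ler_pdivrMl//; apply: le_trans hC1 _; apply: le_of_eq.
by ring.
Unshelve. all: by end_near. Qed.

Theorem corollary1 (R : realType) (d p : nat)
    (dT : measure_display) (T : measurableType dT) (P : probability T R)
    (X : {RV P >-> 'rV[R]_d}) (Y : {RV P >-> R})
    (Xs : nat -> {RV P >-> 'rV[R]_d}) (Ys : nat -> {RV P >-> R})
    (kappa : R.-pker 'rV[R]_d ~> R)
    (al au : R) (X0 : set 'rV[R]_d) (K : 'rV[R]_d -> R) (h : nat -> R)
    (bhat : nat -> T -> R -> R -> 'rV[R]_d -> {ffun mindex d p -> R})
    (L s : R) :
  let supp := msupport (distribution P X) in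
  let Q := cquantile kappa in
  (0 < d)%N -> 0 < al -> al <= au -> au < 1 ->
  iid_copies P (fun w => (X w, Y w)) (fun i w => (Xs i w, Ys i w)) ->
  is_cond_law P X Y kappa ->
  is_lp_estimator K Xs Ys al au bhat ->
  0 < L -> 0 < s -> holder_class supp al au L s Q -> (lowint s <= p)%N ->
  assumption_X (distribution P X) X0 ->
  assumption_F kappa supp ->
  assumption_K K -> bandwidth (d := d) h ->
  forall (v : mindex d p) (alpha : R),
  (mi_size (mi_of v) <= lowint s)%N -> al <= alpha <= au ->
  let err (n : nat) (w : T) (x : 'rV[R]_d) : R :=
    `|bhat n w alpha (h n) x v - mpartial (mi_of v) (Q alpha) x| in
  let rate := (s - (mi_size (mi_of v))%:R) / (2 * s + d%:R) in
  (forall m : R, 0 < m ->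
     asymp_prop h (fun n => n%:R `^ (- (2 * s + d%:R)^-1)) ->
     big_O_P P
       (fun n w => ((\int[leb d]_(x in X0) (err n w x `^ m)%:E) `^ m^-1)%E)
       (fun n => (n%:R^-1) `^ rate))
  /\
  (asymp_prop h (fun n => (ln n%:R / n%:R) `^ (2 * s + d%:R)^-1) ->
     big_O_P P
       (fun n w => ereal_sup (0%E |` [set (err n w x)%:E | x in X0]))
       (fun n => (ln n%:R / n%:R) `^ rate)).
Proof.
move=> supp Q d_gt0 al0 alau au1 iidXY XYcond bhat_lp L0 s0 Qh sp aX aF aK hband.
move=> v alpha vk alpha_itv err rate.
have [h0 hcvg hln] := bandwidth_limits hband.
have /andP[ks _] := lowint_itv s0.
have t0 : 0 <= s - (mi_size (mi_of v))%:R.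
  by rewrite subr_ge0 ltW// (le_lt_trans _ ks)// ler_nat.
have near_ln : \forall n \near \oo, 0 <= ln n%:R :> R.
  by exists 1%N => // n /= n0; rewrite ln_ge0// ler1n.
have mX0 : measurable X0.
  have [_ _ cX0 _] := aX; apply: closed_measurable_rV.
  by apply: compact_closed => //; exact: norm_hausdorff.
have V0 : (0 < #|{: mindex d p}|)%N by apply/card_gt0P; exists (mi_mk mi0).
have sd0 : 0 < 2 * s + d%:R by rewrite ltr_wpDr// mulr_gt0.
have near_n : \forall n \near \oo, 0 < n%:R :> R by exact: nbhs_infty_gtr.
have expand := @local_expansion R d p dT T P X Y Xs Ys kappa al au X0 K h bhat L s
  d_gt0 al0 au1 iidXY XYcond bhat_lp L0 s0 Qh sp aX aF aK hband alpha alpha_itv.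
split=> [m m0 ha|ha].
- have {}ha : asymp_prop h (fun n => n%:R^-1 `^ (2 * s + d%:R)^-1).
    move: ha; congr (asymp_prop _ _); apply/funext => n.
    by rewrite -(powR_inv1 (ler0n R n)) -powRrM mulN1r.
  have r0 : \forall n \near \oo, 0 < n%:R^-1 :> R.
    by apply: filterS near_n => n; rewrite invr_gt0.
  have g0 : 0 < s / (2 * s + d%:R) by exact: divr_gt0.
  have fast := near_fast s0 r0 h0 ha _.
  have {expand fast} [|S [C [C0 H1 mS H2]]] := expand (fast _).
    move=> eps eps0; have := ln_powR_small g0 eps0; apply: filterS2 near_n => n n0.
    by rewrite mulfV ?mulr1// gt_eqF.
  have [C1 C10 C1P] := rate_balance s0 r0 h0 ha.
  have [C2 C20 C2P] := rate_power t0 r0 h0 ha.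
  move=> eps eps0; have eps2 : 0 < eps / 2 by exact: divr_gt0.
  set Pn := #|{: mindex d p}|%:R : R in V0 *.
  pose C3 := C * (Num.sqrt C1 + 1).
  have C30 : 0 < C3 by rewrite mulr_gt0// ltr_wpDl// sqrtr_ge0.
  have Pm : 0 < 1 + Pn * m by rewrite ltr_wpDr// mulr_ge0// ltW.
  have Ce : 0 < C / (eps / 2) by exact: divr_gt0.
  exists (C3 * C2 * (1 + Pn * m) * (C / (eps / 2)) `^ m^-1).
    by rewrite !mulr_gt0// powR_gt0.
  apply: filterS3 (filterI h0 near_n) (filterI (H1 _ eps2) (H2 _ eps2)) (filterI C1P C2P).
  move=> n [hn n0] [[E1 [mE1 PE1 E1P]] [E2 [mE2 PE2 E2P]]] [bal hr].
  have nh0 : 0 < n%:R * h n ^+ d by rewrite mulr_gt0// exprn_gt0.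
  have {}bal : 1 ^+ 2 <= C1 * (n%:R * h n ^+ d * (h n `^ s) ^+ 2).
    by rewrite expr1n; move: bal; rewrite mulfV// gt_eqF.
  exists (E1 `|` E2); split; first exact: measurableU.
  - move=> w /= nw; apply: contrapT => /not_orP[nE1 nE2]; apply: nw.
    have err_le x : X0 x -> err n w x <=
        C3 * h n `^ (s - (mi_size (mi_of v))%:R) * (1 + \sum_u `|S n u x w|).
      move=> Xx; have [_ /(_ v vk) hv] := E1P w nE1 x Xx.
      have Sg0 : 0 <= \sum_u `|S n u x w| by exact: sumr_ge0.
      have := scaled_error hn nh0 (ltW C0) (ltW C10) Sg0 ler01 _ bal hv.
      rewrite mulr1 => /(_ (lexx _)) /le_trans; apply.
      rewrite [leRHS]mulrAC ler_wpM2r ?powR_ge0// /C3 -mulrA ler_pM2l//.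
      have := sqrtr_ge0 C1; nra.
    set b := h n `^ _ in hr err_le.
    have b0 : 0 <= b by exact: powR_ge0.
    have Cb0 : 0 <= C3 * b by apply: mulr_ge0 => //; exact: ltW.
    set kap := (C3 * b * (1 + Pn * m)) `^ m.
    have kap0 : 0 <= kap by exact: powR_ge0.
    have int_le : (\int[leb d]_(x in X0) (err n w x `^ m)%:E <=
        (kap * (C / (eps / 2)))%:E)%E.
      apply: (@le_trans _ _ (\int[leb d]_(x in X0)
          (kap%:E * (\sum_u (expR (S n u x w) + expR (- S n u x w)))%:E))%E).
        apply: nonneg_integral_le => x Xx; first by rewrite lee_fin powR_ge0.
        rewrite -EFinM lee_fin.
        have z0 : 0 <= 1 + \sum_u `|S n u x w| by rewrite addr_ge0// sumr_ge0.
        apply: (@le_trans _ _ ((C3 * b * (1 + \sum_u `|S n u x w|)) `^ m)).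
          have e0 : 0 <= err n w x by exact: normr_ge0.
          apply: ge0_ler_powR; rewrite ?nnegrE ?(ltW m0)//; last exact: err_le.
          exact: mulr_ge0.
        rewrite (powRM _ Cb0 z0) /kap (powRM _ Cb0 (ltW Pm)) -[leRHS]mulrA.
        apply: ler_wpM2l; first exact: powR_ge0.
        exact: powR_sum_le.
      rewrite ge0_integralZl_EFin//; last first.
      - by apply/measurable_EFinP; apply: measurable_funTS; exact: mS.
      - by move=> x _; rewrite lee_fin sumr_ge0// => u _; rewrite addr_ge0 ?expR_ge0.
      by rewrite EFinM; apply: lee_wpmul2l => //; exact: E2P.
    rewrite gee0_abs ?poweR_ge0//.
    apply: (@le_trans _ _ ((kap * (C / (eps / 2)))%:E `^ m^-1)%E).
      apply: gt0_ler_poweR => //; rewrite ?invr_ge0 ?(ltW m0)// in_itv/= leey andbT//.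
        by apply: integral_ge0 => x _; rewrite lee_fin powR_ge0.
      by rewrite lee_fin mulr_ge0// ltW.
    have CbP0 : 0 <= C3 * b * (1 + Pn * m) by apply: mulr_ge0 => //; exact: ltW.
    rewrite poweR_EFin lee_fin powRM// ?(ltW Ce)// /kap -powRrM mulfV ?gt_eqF// powRr1//.
    rewrite [leRHS](_ : _ = C3 * (C2 * n%:R^-1 `^ rate) * (1 + Pn * m) *
      (C / (eps / 2)) `^ m^-1); last by ring.
    apply: ler_wpM2r; first exact: powR_ge0.
    apply: ler_wpM2r; first exact: ltW.
    by apply: ler_wpM2l; first exact: ltW.
  - rewrite [X in (_ <= X%:E)%E]splitr EFinD; apply: le_trans (measureU2 _ _ _) _ => //.
    exact: leeD.
have r0 : \forall n \near \oo, 0 < ln n%:R / n%:R :> R.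
  exists 4%N => // n /= n4; apply: divr_gt0; last by rewrite ltr0n; lia.
  by rewrite (lt_le_trans ltr01)// ln_ge1.
have fast := near_fast s0 r0 h0 ha _.
have {expand fast} [|S [C [C0 H1 _ _]]] := expand (fast _).
  have g0 : 0 < s / (2 * s + d%:R) by exact: divr_gt0.
  move=> eps eps0; have [del del0 delP] := powR_small g0 eps0.
  have small : \forall n \near \oo, ln n%:R / n%:R <= del :> R.
    have := ln_powR_small ltr01 del0; apply: filterS => n.
    by rewrite powRr1// invr_ge0.
  near=> n.
  have n0 : 0 < n%:R :> R by near: n.
  have ln1 : 1 <= ln n%:R :> R by near: n; exists 4%N => // n; exact: ln_ge1.
  rewrite (mulrC n%:R) divfK ?gt_eqF// mulrC ler_wpM2r ?(le_trans ler01)//.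
  by apply: delP; near: n.
have [C1 C10 C1P] := rate_balance s0 r0 h0 ha.
have [C2 C20 C2P] := rate_power t0 r0 h0 ha.
set Pn := #|{: mindex d p}|%:R : R in V0 *.
have Pn0 : 0 <= Pn * C by rewrite mulr_ge0// ltW.
pose C3 := C * (Pn * C * Num.sqrt C1 + 1).
have C30 : 0 < C3 by rewrite mulr_gt0// ltr_wpDl// mulr_ge0 ?sqrtr_ge0.
move=> eps eps0; exists (C3 * C2); first exact: mulr_gt0.
apply: filterS3 (filterI h0 near_n) (filterI near_ln (H1 _ eps0)) (filterI C1P C2P).
move=> n [hn n0] [ln0 [E [mE PE EP]]] [bal hr].
have nh0 : 0 < n%:R * h n ^+ d by rewrite mulr_gt0// exprn_gt0.
have {}bal : Num.sqrt (ln n%:R) ^+ 2 <= C1 * (n%:R * h n ^+ d * (h n `^ s) ^+ 2).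
  by rewrite sqr_sqrtr//; move: bal; rewrite mulrC divfK// gt_eqF.
exists E; split => // w /= nw; apply: contrapT => nE; apply: nw.
rewrite gee0_abs; last by apply: ereal_sup_ubound; left.
apply: ge_ereal_sup => _ [->|[x Xx <-]].
  rewrite lee_fin; apply: mulr_ge0; last exact: powR_ge0.
  by apply/ltW; exact: mulr_gt0.
rewrite lee_fin; have [HS /(_ v vk) hv] := EP w nE x Xx.
have Sg : \sum_u `|S n u x w| <= Pn * C * Num.sqrt (ln n%:R).
  apply: (@le_trans _ _ (\sum_(u : mindex d p) C * Num.sqrt (ln n%:R))).
    by apply: ler_sum => u _; exact: HS.
  by rewrite sumr_const -[leLHS]mulr_natl mulrA.
have := scaled_error hn nh0 (ltW C0) (ltW C10) Pn0 (sqrtr_ge0 _) Sg bal hv.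
move=> /le_trans; apply; rewrite -[leRHS]mulrA.
by apply: ler_wpM2l => //; exact: ltW.
Unshelve. all: by end_near. Qed.
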